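(* Let $q$ be a power of an odd prime, $\mathbb{A}=\mathbb{F}_q[T]$ and $K=\mathbb{F}_q(T)$. Let $P\in\mathbb{A}$ be monic irreducible of degree $d$, and let $G\in\mathbb{A}$ be a primitive root modulo $P$ with $\deg G\ge \deg P$. Let $L=K\left(\sqrt{(-1)^dP}\right)$, and let $h_L$ be the divisor class number of $L$. Let $1/P=\sum_{k=1}^{\infty}H_k/G^k$ be the digit expansion of $1/P$ in base $G$, and put $r=(q^d-1)/(q-1)$. Then $$h_L=\begin{cases}\displaystyle\sum_{k=1}^{r}(-1)^k\deg H_k & \text{if } d \text{ is even},\\[3mm] \displaystyle(-\eta_G)\sum_{k=1}^{r}(-1)^k\varepsilon_k & \text{if } d\text{ is odd},\end{cases}$$ where $$\eta_G=\begin{cases}1 & \text{if }\delta(G)\in(\mathbb{F}_q^{\times})^2,\\ -1&\text{if }\delta(G)\notin(\mathbb{F}_q^{\times})^2,\end{cases}\qquad \varepsilon_k=\begin{cases}1 & \text{if }\delta(H_k)\in(\mathbb{F}_q^{\times})^2,\\ -1&\text{if }\delta(H_k)\notin(\mathbb{F}_q^{\times})^2,\end{cases}$$ and $\delta(I)$ denotes the leading coefficient of $I\in\mathbb{A}$ if $I\ne0$, with $\delta(0)=0$.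
   Context: A primitive root modulo $P$ is a polynomial $G\in\mathbb{A}$ whose residue class generates the cyclic group $(\mathbb{A}/P\mathbb{A})^{\times}$ (of order $q^d-1$). Digit expansion: let $K_\infty$ be the completion of $K$ at the valuation $v_\infty$ with $v_\infty(F_1/F_2)=\deg F_2-\deg F_1$. For $G\in\mathbb{A}$ with $\deg G\ge1$, the digit expansion of $f\in K$ in base $G$ is the unique expression $f=\sum_{k=0}^{\infty}H_k/G^k$ (convergent in $K_\infty$) with $H_0\in\mathbb{A}$ and, for each $k\ge1$, $H_k\in\mathbb{A}$ with $H_k=0$ or $\deg H_k<\deg G$. If $v_\infty(f)>0$ (as for $f=1/P$) then $H_0=0$. (When $\deg G\ge\deg P$, all digits $H_k$, $k\ge1$, of $1/P$ are nonzero.) The divisor class number $h_L$ of a function field $L$ is the order of the group of divisor classes of degree $0$ of $L$. *)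

(* Defs.v *)
From HB Require Import structures.
From mathcomp Require Import all_boot all_order all_fingroup all_algebra.
From mathcomp Require Import all_solvable all_field.
From mathcomp Require Import zify finmap.
From mathcomp Require Import boolp classical_sets functions cardinality fsbigop.

Set Implicit Arguments.
Unset Strict Implicit.
Unset Printing Implicit Defensive.

Import Order.TTheory GRing.Theory Num.Theory.

Local Open Scope classical_set_scope.
Local Open Scope ring_scope.

Notation "x %:F" := (@FracField.tofrac _ x) : ring_scope.

Lemma frac_repr (R : idomainType) (x : {fraction R}) :
  x = (\n_(generic_quotient.repr x))%:F / (\d_(generic_quotient.repr x))%:F.
Proof.
set n := \n__; set d := \d__.
have d0 : d != 0 by exact: denom_ratioP.
apply: (@mulIf _ d%:F); first by rewrite tofrac_eq0.
rewrite mulfVK ?tofrac_eq0 //.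
rewrite -[in LHS](generic_quotient.reprK x) -[_ * _]/(FracField.mul _ _).
rewrite !generic_quotient.piE; apply/eqP.
rewrite FracField.equivf_def /FracField.mulf.
by rewrite !numden_Ratio ?mulf_neq0 ?oner_neq0 ?mulr1 // -/d -/n mulrC.
Qed.

Section Polynomials.
Variable F : finFieldType.
Implicit Types P G I : {poly F}.

(* degree of a nonzero polynomial; the zero polynomial gets the value 0 *)
Definition pdeg I : nat := (size I).-1.

(* {poly %/ P} is F[T]/(P) for P monic and nonconstant *)
Definition primitive_root P G : Prop :=
  exists2 u : {unit {poly %/ P}},
    val u = in_qpoly P G & generator [set: {unit {poly %/ P}}]%SET u.

(* 1 if the leading coefficient is the square of a nonzero element, -1
   otherwise; lead_coef 0 = 0, so the zero polynomial is sent to -1 *)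
Definition lead_sign I : int :=
  if [exists a : F, (a != 0) && (lead_coef I == a ^+ 2)] then 1 else -1.

(* v_oo(N / D) = deg D - deg N, independently of the chosen fraction (vinf_frac
   below); the value at 0, where v_oo is infinite, is meaningless *)
Definition vinf (x : {fraction {poly F}}) : int :=
  (pdeg (\d_(generic_quotient.repr x)))%:Z -
  (pdeg (\n_(generic_quotient.repr x)))%:Z.

Lemma vinf_frac (N D : {poly F}) : N != 0 -> D != 0 ->
  vinf (N%:F / D%:F) = (pdeg D)%:Z - (pdeg N)%:Z.
Proof.
move=> N0 D0; rewrite /vinf /pdeg; set x := _ / _.
have xE := frac_repr x; move: xE.
set n : {poly F} := \n_(generic_quotient.repr x).
set d : {poly F} := \d_(generic_quotient.repr x).
have d0 : d != 0 by exact: denom_ratioP.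
move=> xE.
have : (n * D)%:F = (N * d)%:F.
  rewrite !tofracM; apply/eqP.
  by rewrite -eqr_div ?tofrac_eq0 // -xE.
move/eqP; rewrite tofrac_eq => /eqP e.
have n0 : n != 0.
  apply: contraNneq (mulf_neq0 N0 d0) => n0.
  by rewrite -e n0 mul0r.
have := congr1 (fun p : {poly F} => size p) e.
rewrite !size_mul //.
move: n0 D0 N0 d0; rewrite -!size_poly_gt0.
move: (size n) (size D) (size N) (size d) => a b c k; lia.
Qed.

(* f = \sum_(k >= 0) H_k / G^k.  All partial sums and the limit lie in F(T), which
   embeds isometrically in its completion at v_oo, so convergence in the
   completion means v_oo(f - partial sum) -> oo. *)
Definition digit_expansion G (f : {fraction {poly F}}) (H : nat -> {poly F}) :
    Prop :=
  (forall k, (0 < k)%N -> H k = 0 \/ (pdeg (H k) < pdeg G)%N) /\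
  (forall M : int, exists n0 : nat, forall n : nat, (n0 <= n)%N ->
     let rest := f - \sum_(0 <= k < n.+1) (H k)%:F / G%:F ^+ k in
     rest = 0 \/ M <= vinf rest).

End Polynomials.

Section ClassNumber.
Variables (F : finFieldType) (L : fieldExtType {fraction {poly F}}).

Definition const (c : F) : L := ((c%:P)%:F)%:A.

(* The places of L / F, as normalised discrete valuations.  The integer value
   at 0 is a convention which makes each place a unique element of the type.  *)
Record place := Place {
  pval :> L -> int;
  _ : pval 0 = 0;
  _ : forall x y, x != 0 -> y != 0 -> pval (x * y) = pval x + pval y;
  _ : forall x y, x != 0 -> y != 0 -> x + y != 0 ->
        Num.min (pval x) (pval y) <= pval (x + y);
  _ : forall c : F, c != 0 -> pval (const c) = 0;
  _ : exists2 t, t != 0 & pval t = 1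
}.

HB.instance Definition _ := gen_eqMixin place.
HB.instance Definition _ := gen_choiceMixin place.

Definition valuation_ring (v : place) : set L :=
  [set x | x = 0 \/ 0 <= v x].

Definition maximal_ideal (v : place) : set L :=
  [set x | x = 0 \/ 0 < v x].

(* e_0, ..., e_(n-1) reduce to an F-basis of the residue field of v *)
Definition residue_basis (v : place) (n : nat) (e : 'I_n -> L) : Prop :=
  (forall i, valuation_ring v (e i)) /\
  (forall x, valuation_ring v x ->
     exists! c : {ffun 'I_n -> F},
       maximal_ideal v (x - \sum_(i < n) const (c i) * e i)).

(* dimension over F of the residue field *)
Definition place_degree (v : place) : nat :=
  xget 0%N [set n | exists e : 'I_n -> L, residue_basis v e].

Definition is_divisor (D : place -> int) : Prop :=
  finite_set [set v | D v != 0].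

Definition divisor_degree (D : place -> int) : int :=
  \sum_(v \in [set: place]) D v * (place_degree v)%:Z.

Definition linearly_equivalent (D E : place -> int) : Prop :=
  exists2 x : L, x != 0 & forall v, D v - E v = v x.

Definition divisor_class (D : place -> int) : set (place -> int) :=
  [set E | is_divisor E /\ linearly_equivalent E D].

Definition divisor_classes0 : set (set (place -> int)) :=
  [set divisor_class D | D in [set D | is_divisor D /\ divisor_degree D = 0]].

(* fset_set sends an infinite set to the empty one; divisor_classes0 contains the
   class of 0, so a nonzero value is the order of the group *)
Definition divisor_class_number : nat := #|` fset_set divisor_classes0 |.

End ClassNumber.

Arguments divisor_class_number {F} L.

(* Main.v *)
(* Put D = (-1)^d P, let (f/P) be the quadratic residue symbol and S_j the sum of
   (f/P) over the monic f of degree j, which vanishes for j >= d.  By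
   quadratic reciprocity (Q/P) tells how the place Q of F(T) decomposes in L, so
   the number A_n of effective divisors of degree n of L is an explicit
   combination of the S_j.  Counting the same divisors class by class,
   Riemann's inequality dim RR(E) >= deg E + 2 - ceil(d/2) gives
   (q - 1) A_n + h_L = 0 modulo q^(n + 2 - ceil(d/2)).  The explicit formula
   gives the same kind of congruence with h_L replaced by lvalue, and letting n
   grow yields h_L = lvalue: neither the zeta function of L nor its functional
   equation is needed.

   Up to constants the R_k = G^k mod P, k < r, are the monic polynomials
   of degree < d, each once, and (R_k/P) = (-1)^k.  As P H_k = G R_(k-1) - R_k and
   deg G >= d, the degree and the leading coefficient of H_k are those of
   R_(k-1) up to a shift and the factor lead_coef G, so the digit sum is lvalue. *)

From HB Require Import structures.
Require Import Defs.
From mathcomp Require Import all_boot all_order all_fingroup all_algebra.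
From mathcomp Require Import all_solvable all_field.
From mathcomp Require Import finmap boolp classical_sets functions cardinality fsbigop.
From mathcomp Require Import zify ring.

Set Implicit Arguments.
Unset Strict Implicit.
Unset Printing Implicit Defensive.

Import Order.TTheory GRing.Theory Num.Theory.
Local Open Scope ring_scope.

(** * The quadratic residue symbol *)

(** A congruence suffices because an integer divisible by every power of q is 0. For a class of
    degree n, the number a of its effective divisors satisfies (q - 1) a + 1 = q^l, so a lower bound
    for l is all that is needed; l > 0 also shows that every class contains an effective divisor,
    hence that there are finitely many classes. Passing from degree 0 to degree n needs a place of
    degree 1. The sign (-1)^d provides one above oo, which splits when d is even (D = P is monic of
    even degree) and ramifies when d is odd. For even d the split place makes the explicit count
    grow like n q^n; clearing it costs a further factor q - 1 and uses that the S_j sum to 0. The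
    main obstacle is that a place is any normalised integer-valued function on L, so all places have
    to be found. Each restricts to a multiple of a place w of F(T). Where w does not split, the
    place comes from w of the norm; where it splits, from approximate square roots of D in F(T),
    which avoids completions. *)

Lemma odd_pred_half n : odd n -> n.-1 = (n.-1./2).*2.
Proof. by case: n => // n /= on; rewrite -[LHS]odd_double_half (negbTE on). Qed.

(** Euler's criterion. For the converse write x = z^i with z a generator: x^((n-1)/2) = 1 forces n -
    1 to divide i (n-1)/2, so i is even. *)
Lemma finField_euler (k : finFieldType) (x : k) : odd #|k| -> x != 0 ->
  (x ^+ (#|k|.-1)./2 == 1) = [exists y, (y != 0) && (x == y ^+ 2)].
Proof.
move=> /odd_pred_half k1 x0; have ck := card_finNzRing_gt1 k.
apply/idP/existsP => [|[y /andP[y0 /eqP->]]]; last first.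
  rewrite -exprM mul2n -k1; apply/eqP/(mulfI y0).
  by rewrite mulr1 -exprS prednK ?expf_card //; apply: ltnW.
have /cyclicP[z zE] := field_unit_group_cyclic [set: {unit k}]%G.
have oz : #[z]%g = #|k|.-1 by rewrite -card_finField_unit zE.
have ux : x \is a GRing.unit by rewrite unitfE.
have : FinRing.unit k ux \in <[z]>%g by rewrite -zE inE.
case/cycleP => i xi.
have -> : x = val z ^+ i by rewrite -FinRing.val_unitX -xi.
rewrite -exprM => /eqP zi.
have : (#[z]%g %| (i * #|k|.-1./2))%N.
  by rewrite order_dvdn; apply/eqP; apply: val_inj; rewrite FinRing.val_unitX.
rewrite oz k1 doubleK -mul2n dvdn_pmul2r; last by rewrite -double_gt0 -k1 -subn1 subn_gt0.
move/dvdnP=> [j ->]; exists (val z ^+ j); rewrite exprM eqxx andbT.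
by rewrite expf_neq0 // -unitfE; case: (z).
Qed.

Lemma char_odd (k : finFieldType) : odd #|k| -> (2 : k) != 0.
Proof.
move=> ok; have [p pp pc] := finPcharP k.
have [n kE] : exists n, #|k| = (p ^ n)%N by eexists; exact: card_pprimeChar pc.
apply: contraTneq ok => h2.
have : 2%N \in [pchar k] by rewrite inE /= h2 eqxx.
rewrite (pcharf_eq pc) inE => /eqP E2.
rewrite kE -E2 oddX /= orbF.
by have := card_finNzRing_gt1 k; rewrite kE; case: n {kE}.
Qed.

Section Character.
Variables (F : finFieldType) (P : {poly F}).
Hypotheses (P_monic : P \is monic) (P_irr : irreducible_poly P).
Let hP : monic_irreducible_poly P := (P_irr, P_monic).
Local Notation kP := {poly %/ P with hP}.
Local Notation q := #|F|.

(** The reduction map is retyped into the field instance, where it carries a ring morphism structure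
    and the field lemmas apply. *)
Definition resid (f : {poly F}) : kP := in_qpoly P f.

Lemma resid_is_zmod_morphism : zmod_morphism resid.
Proof. by move=> f g; exact: (raddfB (in_qpoly P)). Qed.
Lemma resid_is_monoid_morphism : monoid_morphism resid.
Proof. split=> [|f g]; [exact: in_qpoly1|exact: in_qpolyM]. Qed.
HB.instance Definition _ :=
  GRing.isZmodMorphism.Build {poly F} kP resid resid_is_zmod_morphism.
HB.instance Definition _ :=
  GRing.isMonoidMorphism.Build {poly F} kP resid resid_is_monoid_morphism.

Lemma resid_eq0 f : (resid f == 0) = (P %| f).
Proof.
apply/eqP/idP => [/val_eqP /= | hDp].
  by rewrite -Pdiv.IdomainMonic.modpE // mk_monicE.
by apply/val_eqP; rewrite /= -Pdiv.IdomainMonic.modpE // mk_monicE.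
Qed.

Lemma resid_eq f g : (resid f == resid g) = (P %| f - g).
Proof. by rewrite -resid_eq0 rmorphB subr_eq0. Qed.

Lemma resid_surj (x : kP) : exists f, resid f = x.
Proof. 
exists (val x); apply: val_inj; apply: in_qpoly_small; exact: size_mk_monic.
Qed.

Lemma card_resid : #|kP| = (q ^ pdeg P)%N.
Proof. by rewrite card_qfpoly. Qed.

Definition half_exp := (q ^ pdeg P).-1./2.

(** Euler's criterion serves as the definition, phrased by divisibility in F[T] so that the symbol
    takes no proof that [P] is irreducible. *)
Definition legendre (f : {poly F}) : int :=
  if P %| f then 0 else if P %| f ^+ half_exp - 1 then 1 else -1.

Hypothesis q_odd : odd q.

Lemma legendre_pm f : ~~ (P %| f) ->
  resid f ^+ half_exp = 1 \/ resid f ^+ half_exp = -1.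
Proof.
rewrite -resid_eq0 => f0.
have : resid f ^+ half_exp ^+ 2 = 1.
  rewrite -exprM muln2 /half_exp -odd_pred_half ?oddX ?q_odd ?orbT //.
  apply/(mulfI f0); rewrite mulr1 -exprS prednK -?card_resid ?expf_card //.
  exact: ltnW (card_finNzRing_gt1 _).
by move/eqP; rewrite sqrf_eq1 => /orP[]/eqP; [left|right].
Qed.

Lemma N1neq1 : (-1 : kP) != 1.
Proof. by rewrite eq_sym -subr_eq0 opprK -[1+1]/(2%:R) char_odd // card_resid oddX q_odd orbT. Qed.

Lemma legendre0 f : P %| f -> legendre f = 0.
Proof. by rewrite /legendre => ->. Qed.

Lemma legendre1 f : ~~ (P %| f) -> resid f ^+ half_exp = 1 -> legendre f = 1.
Proof.
by rewrite /legendre => /negbTE-> h; rewrite -resid_eq rmorphXn rmorph1 h eqxx.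
Qed.

Lemma legendreN1 f : ~~ (P %| f) -> resid f ^+ half_exp = -1 -> legendre f = -1.
Proof.
rewrite /legendre => /negbTE-> h.
by rewrite -resid_eq rmorphXn rmorph1 h (negbTE N1neq1).
Qed.

Lemma legendreM f g : legendre (f * g) = legendre f * legendre g.
Proof.
have Mg : (P %| f * g) = (P %| f) || (P %| g).
  by rewrite -!resid_eq0 rmorphM mulf_eq0.
have [Pf|Pf] := boolP (P %| f).
  by rewrite (legendre0 Pf) mul0r legendre0 // Mg Pf.
have [Pg|Pg] := boolP (P %| g).
  by rewrite (legendre0 Pg) mulr0 legendre0 // Mg Pg orbT.
have Pfg : ~~ (P %| f * g) by rewrite Mg negb_or Pf.
have E : resid (f * g) ^+ half_exp = resid f ^+ half_exp * resid g ^+ half_exp.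
  by rewrite rmorphM exprMn.
case: (legendre_pm Pf) => hf; case: (legendre_pm Pg) => hg; rewrite hf hg in E.
- by rewrite !legendre1 // E mulr1.
- by rewrite (legendre1 Pf) // !legendreN1 // E mul1r.
- by rewrite (legendre1 Pg) // !legendreN1 // E mulr1.
by rewrite (legendreN1 Pf) // (legendreN1 Pg) // legendre1 // E mulrNN mulr1.
Qed.

Lemma legendre_mod f g : P %| f - g -> legendre f = legendre g.
Proof.
rewrite -resid_eq => /eqP fg; rewrite /legendre -!resid_eq0 fg.
by rewrite !rmorphB !rmorphXn /= fg.
Qed.

Lemma legendre_modp f : legendre (f %% P) = legendre f.
Proof.
apply: legendre_mod; rewrite {2}(divp_eq f P) opprD addrCA subrr addr0.
by rewrite dvdpNr dvdp_mull.
Qed.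

Lemma legendre_one : legendre 1 = 1.
Proof.
rewrite legendre1 ?rmorph1 ?expr1n //.
by rewrite -resid_eq0 rmorph1 oner_eq0.
Qed.

Lemma legendre_square f : ~~ (P %| f) ->
  (legendre f = 1 <-> exists b, P %| b ^+ 2 - f).
Proof.
move=> Pf.
have ok : odd #|kP| by rewrite card_resid oddX q_odd orbT.
have := finField_euler (x := resid f) ok.
rewrite resid_eq0 card_resid -/half_exp => /(_ Pf) E.
split=> [l1|[b bf]].
  case: (legendre_pm Pf) => h; last by move: l1; rewrite legendreN1.
  move: E; rewrite h eqxx => /esym/existsP[y /andP[_ /eqP fy]].
  have [b bE] := resid_surj y.
  by exists b; rewrite -resid_eq rmorphXn /= bE fy.
apply: legendre1 => //; apply/eqP; rewrite E; apply/existsP; exists (resid b) => /=.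
move: bf; rewrite -resid_eq rmorphXn /= => /eqP h; rewrite h eqxx andbT.
by apply: contraNneq Pf => b0; rewrite -resid_eq0 -h b0 expr0n.
Qed.

End Character.

(** * Quadratic reciprocity *)

Section Conjugates.
Variables (F : finFieldType) (E : fieldExtType F).
Local Notation q := #|F|.
Local Notation ev f x := ((map_poly (in_alg E) f).[x]).

(** The q-power map is additive in characteristic p and fixes the coefficients of f. *)
Lemma horner_frobenius (f : {poly F}) (x : E) n :
  ev f x ^+ (q ^ n) = ev f (x ^+ (q ^ n)).
Proof.
elim: n x => [|n IH] x; first by rewrite expn0 !expr1.
rewrite expnSr !exprM IH; move: (x ^+ _) => {IH}x.
have [p pp pc] := finPcharP F.
have [m qE] : exists m, q = (p ^ m)%N by eexists; exact: card_pprimeChar pc.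
have qn : [pchar E].-nat q.
  have pcE : p \in [pchar E] by rewrite pchar_lalg.
  rewrite qE (eq_pnat _ (pcharf_eq pcE)) pnatX pnat_id ?orTb //.
elim/poly_ind: f => [|f c IH]; first by rewrite rmorph0 !horner0 expr0n gtn_eqF // ltnW // card_finNzRing_gt1.
rewrite !rmorphD !rmorphM /= !map_polyX !map_polyC /= !hornerMXaddC.
by rewrite exprDn_pchar // exprMn IH -in_algE -rmorphXn /= expf_card.
Qed.

Variables (P : {poly F}) (a : E).
Hypotheses (P_monic : P \is monic) (P_irr : irreducible_poly P).
Hypothesis Pa : ev P a = 0.

Lemma ev_eq0 f : (ev f a == 0) = (P %| f).
Proof.
apply/idP/idP => [/eqP fa|/dvdpP[g ->]]; last first.
  by rewrite rmorphM hornerM Pa mulr0.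
apply: contraLR (oner_neq0 E); rewrite negbK -irreducible_poly_coprime // => /Bezout_eq1_coprimepP[[u v] /= uv].
apply/eqP; move: (congr1 (fun p => ev p a) uv).
by rewrite rmorphD !rmorphM rmorph1 hornerD !hornerM Pa fa !mulr0 add0r hornerC.
Qed.

Lemma ev_card : a ^+ (q ^ pdeg P) = a.
Proof.
have : P %| 'X^(q ^ pdeg P) - 'X.
  rewrite -(resid_eq P_monic P_irr) rmorphXn /=.
  by rewrite -(card_resid P_monic P_irr) expf_card.
rewrite -ev_eq0 rmorphB rmorphXn /= map_polyX hornerD hornerN hornerXn hornerX.
by rewrite subr_eq0 => /eqP.
Qed.

(** Otherwise every element of F[T]/(P) is fixed by the q^m-power map, so X^(q^m) - X has q^d roots
    with d > m. *)
Lemma conjugate_neq m : (0 < m < pdeg P)%N -> a ^+ (q ^ m) != a.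
Proof.
move=> /andP[m0 md]; apply/eqP => am.
have q1 := card_finNzRing_gt1 F.
pose k : finFieldType := {poly %/ P with (P_irr, P_monic)}.
have kq (x : k) : x ^+ (q ^ m) = x.
  have [f <-] := resid_surj x.
  apply/eqP; rewrite -rmorphXn resid_eq -ev_eq0 rmorphB rmorphXn /=.
  by rewrite hornerD hornerN horner_exp horner_frobenius am subrr.
have qm1 : (1 < q ^ m)%N by rewrite -(expn0 q) ltn_exp2l.
pose g : {poly k} := 'X^(q ^ m) - 'X.
have sz : size g = (q ^ m).+1.
  by rewrite size_polyDl size_polyXn // size_polyN size_polyX.
have : (size (enum k) < size g)%N.
  apply: max_poly_roots (enum_uniq _); first by rewrite -size_poly_gt0 sz.
  by apply/allP => x _; rewrite rootE /g !hornerE kq subrr.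
by rewrite -cardE (card_resid P_monic P_irr) sz ltnS leq_exp2l // leqNgt md.
Qed.

Lemma conjugate_factor :
  map_poly (in_alg E) P = \prod_(i < pdeg P) ('X - (a ^+ (q ^ i))%:P).
Proof.
pose rs := [seq a ^+ (q ^ i) | i <- iota 0 (pdeg P)].
have ur : uniq rs.
  rewrite map_inj_in_uniq ?iota_uniq // => i j; rewrite !mem_iota /= !add0n.
  suff W i' j' : (i' < j' < pdeg P)%N -> a ^+ (q ^ i') != a ^+ (q ^ j').
    move=> id jd /eqP e; case: (ltngtP i j) => // ij.
      by move: (W i j); rewrite ij jd e => /(_ isT).
    by move: (W j i); rewrite ij id eq_sym e => /(_ isT).
  move=> /andP[ij jd]; apply/eqP => e.
  (* Raising the equality to the power q^(d - j') turns its right side into a^(q^d) = a. *)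
  have := @conjugate_neq (i' + (pdeg P - j')); rewrite expnD exprM e -exprM -expnD.
  rewrite subnKC; last exact: ltnW.
  by rewrite ev_card eqxx => H; apply: (negP (H _)) => //; lia.
have rP : all (root (map_poly (in_alg E) P)) rs.
  apply/allP => x /mapP[i _ ->]; rewrite rootE -horner_frobenius Pa expr0n.
  by rewrite gtn_eqF // expn_gt0 (ltnW (card_finNzRing_gt1 F)).
have [| g Pg] := uniq_roots_prod_XsubC rP; first by rewrite uniq_rootsE.
have mo : \prod_(z <- rs) ('X - z%:P) \is monic by rewrite monic_prod_XsubC.
have mP : map_poly (in_alg E) P \is monic by rewrite map_monic.
have mg : g \is monic by move: mP; rewrite Pg monicMr.
have : size (map_poly (in_alg E) P) = (size rs).+1.
  by rewrite size_map_poly /= size_map size_iota /pdeg prednK // size_poly_gt0 monic_neq0.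
rewrite {1}Pg size_monicM ?monic_neq0 // size_prod_XsubC addnS /= => sg.
have g1 : g = 1.
  have /size_poly1P[c c0 gc] : size g == 1%N by rewrite -(eqn_add2r (size rs)) sg.
  by move: mg; rewrite gc monicE lead_coefC => /eqP->; rewrite polyC1.
by rewrite Pg g1 mul1r big_map -[X in iota 0 X]subn0 big_mkord.
Qed.

(* For a a root of P, the conjugates of a are the a ^+ (q ^ i), so the norm of f(a)
   is f(a) raised to (q^d - 1)/(q - 1). *)
Lemma norm_ev f : \prod_(i < pdeg P) ev f (a ^+ (q ^ i)) =
  ev f a ^+ (\sum_(i < pdeg P) q ^ i).
Proof.
by rewrite expr_sum; apply: eq_bigr => i _; rewrite horner_frobenius.
Qed.

Hypothesis q_odd : odd q.

(** The exponent (q^d - 1)/2 factors as (q - 1)/2 times 1 + q + ... + q^(d-1), and the second factor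
    produces the norm. *)
Lemma legendre_ev f : ~~ (P %| f) ->
  legendre P f = if \prod_(i < pdeg P) ev f (a ^+ (q ^ i)) ^+ q.-1./2 == 1 then 1 else -1.
Proof.
move=> Pf; rewrite /legendre (negbTE Pf).
rewrite -ev_eq0 rmorphB rmorph1 rmorphXn /= hornerD hornerN hornerC horner_exp subr_eq0.
rewrite prodrXl norm_ev -exprM mulnC.
suff -> : half_exp P = (q.-1./2 * \sum_(i < pdeg P) q ^ i)%N by [].
by apply: double_inj; rewrite doubleMl /half_exp -!odd_pred_half ?oddX ?q_odd ?orbT // predn_exp.
Qed.

End Conjugates.

(* Both symbols are the same power of the resultant of P and Q, up to the sign
   (-1)^(deg P deg Q), which the factor (-1)^(deg P) absorbs. *)
Lemma reciprocity (F : finFieldType) (P Q : {poly F}) : odd #|F| ->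
  P \is monic -> irreducible_poly P -> Q \is monic -> irreducible_poly Q ->
  P != Q -> legendre Q ((-1) ^+ pdeg P * P) = legendre P Q.
Proof.
move=> q_odd mP iP mQ iQ PQ.
have nPQ : ~~ (P %| Q).
  apply: contra PQ => h; rewrite -eqp_monic //; apply: iQ.2 h.
  by apply/eqP => s1; have := iP.1; rewrite s1.
have nQP : ~~ (Q %| P).
  apply: contra PQ => h; rewrite eq_sym -eqp_monic //; apply: iP.2 h.
  by apply/eqP => s1; have := iQ.1; rewrite s1.
have PQ0 : P * Q != 0 by rewrite mulf_neq0 ?monic_neq0.
have [E [rs Ers _]] := FinSplittingFieldFor PQ0.
have rt (R : {poly F}) : irreducible_poly R -> R %| P * Q ->
   exists a : E, (map_poly (in_alg E) R).[a] = 0.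
  move=> iR RPQ; have : map_poly (in_alg E) R %| \prod_(z <- rs) ('X - z%:P).
    by rewrite -(eqp_dvdr _ Ers) dvdp_map.
  move/dvdp_prod_XsubC => [m Rm].
  have : (1 < size (map_poly (in_alg E) R))%N by rewrite size_map_poly; case: iR.
  rewrite (eqp_size Rm) size_prod_XsubC ltnS.
  case E1 : (mask m rs) => [//|z s] _; exists z; apply/eqP.
  by rewrite -[_ == 0]/(root _ z) (eqp_root Rm) root_prod_XsubC E1 inE eqxx.
have [a Pa] := rt P iP (dvdp_mulr _ (dvdpp _)).
have [b Qb] := rt Q iQ (dvdp_mull _ (dvdpp _)).
rewrite (legendre_ev iP Pa) //.
rewrite (legendre_ev iQ Qb) //; last first.
  by rewrite -signr_odd mulr_sign; case: ifP; rewrite ?dvdpNr.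
rewrite !prodrXl.
suff -> : \prod_(i < pdeg Q) (map_poly (in_alg E) ((-1) ^+ pdeg P * P)).[b ^+ (#|F| ^ i)]
  = \prod_(i < pdeg P) (map_poly (in_alg E) Q).[a ^+ (#|F| ^ i)] by [].
under [RHS]eq_bigr => i _.
  rewrite (conjugate_factor mQ iQ Qb) horner_prod.
  under eq_bigr => j _ do rewrite hornerXsubC.
  over.
rewrite exchange_big /=; apply: eq_bigr => j _.
rewrite rmorphM rmorphXn /= rmorphN1 hornerM horner_exp hornerN hornerC.
rewrite (conjugate_factor mP iP Pa) horner_prod.
rewrite -{1}(card_ord (pdeg P)) -prodrN /=.
by apply: eq_bigr => i _; rewrite hornerXsubC opprB.
Qed.

(** * Character sums over monic polynomials *)

Section Monics.
Variable F : finFieldType.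
Implicit Types f g : {poly F}.
Local Notation q := #|F|.

Definition monics n : seq {poly F} := [seq 'X^n + polyn t | t : {poly_n F}].

Lemma size_monics n : size (monics n) = (q ^ n)%N.
Proof. by rewrite size_map -cardE card_npoly. Qed.

Lemma monics_uniq n : uniq (monics n).
Proof.
by rewrite map_inj_uniq ?enum_uniq // => s t /addrI; apply: val_inj.
Qed.

Lemma mem_monics n f : (f \in monics n) = (f \is monic) && (size f == n.+1).
Proof.
apply/mapP/andP => [[t _ ->]|[mf /eqP sf]].
  have st : (size (polyn t) < n.+1)%N by rewrite ltnS size_npoly.
  rewrite size_polyDl size_polyXn //; split => //.
  by rewrite monicE lead_coefDl ?size_polyXn // lead_coefXn.
have sf' : (size (f - 'X^n)%R <= n)%N.
  apply/leq_sizeP => j; rewrite leq_eqVlt coefB coefXn => /orP[/eqP<-|nj].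
    by rewrite eqxx -[n]/(n.+1.-1) -sf -lead_coefE (monicP mf) subrr.
  by rewrite gtn_eqF // subr0 nth_default // sf.
exists (npolyp n (f - 'X^n)); first by rewrite mem_enum.
by rewrite npolypK // addrC subrK.
Qed.

Lemma monicsP f n : f \in monics n -> [/\ f \is monic, f != 0 & pdeg f = n].
Proof. by rewrite mem_monics => /andP[mf /eqP sf]; rewrite /pdeg sf monic_neq0. Qed.

Lemma monic_in_monics f : f \is monic -> f \in monics (pdeg f).
Proof.
move=> mf; rewrite mem_monics mf /pdeg prednK ?eqxx // size_poly_gt0.
exact: monic_neq0.
Qed.

Lemma sum_monics_mul (V : nmodType) (w : {poly F} -> V) n m g : g \in monics m ->
  (m <= n)%N ->
  \sum_(f <- monics n | g %| f) w f = \sum_(h <- monics (n - m)) w (g * h).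
Proof.
move=> gm mn; have [mg g0 dg] := monicsP gm.
rewrite -big_filter -(big_map (fun h => g * h) xpredT w); apply: perm_big.
apply: uniq_perm; first by rewrite filter_uniq ?monics_uniq.
  by rewrite map_inj_uniq ?monics_uniq //; apply: mulfI.
move=> f; rewrite mem_filter; apply/andP/mapP => [[/dvdpP[h ->]]|[h hm ->]].
  rewrite mem_monics monicMr // => /andP[mh].
  rewrite size_monicM ?monic_neq0 // => /eqP sh.
  exists h; last by rewrite mulrC.
  rewrite mem_monics mh; apply/eqP; move: sh dg.
  by rewrite /pdeg; move: (size_poly_gt0 g); rewrite g0; lia.
have [mh h0 dh] := monicsP hm.
rewrite dvdp_mulr // mem_monics monicMl // mh size_monicM //; split=> //.
apply/eqP; move: dg dh (size_poly_gt0 g) (size_poly_gt0 h).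
by rewrite g0 h0 /pdeg; lia.
Qed.

End Monics.

Lemma unit_expr_eq1 (k : finFieldType) (u : {unit k}) n :
  (val u ^+ n == 1) = (#[u]%g %| n)%N.
Proof. by rewrite order_dvdn -FinRing.val_unitX -val_eqE. Qed.

Section LegendreSums.
Variables (F : finFieldType) (P : {poly F}).
Hypotheses (P_monic : P \is monic) (P_irr : irreducible_poly P).
Hypothesis q_odd : odd #|F|.
Local Notation q := #|F|.
Local Notation d := (pdeg P).
Variable G : {poly F}.
Hypothesis G_prim : primitive_root P G.

Definition legendre_sum j := \sum_(f <- monics F j) legendre P f.

Lemma primitive_rootE : exists2 u : {unit {poly %/ P with (P_irr, P_monic)}},
  val u = resid P_monic P_irr G & #[u]%g = (q ^ d).-1.
Proof.
case: G_prim => u uG /eqP gu; exists u => //.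
rewrite -(card_resid P_monic P_irr) -card_finField_unit.
by rewrite orderE -gu.
Qed.

Lemma resid_prim_eq1 k : (resid P_monic P_irr G ^+ k == 1) = ((q ^ d).-1 %| k)%N.
Proof.
by have [u <- <-] := primitive_rootE; rewrite unit_expr_eq1.
Qed.

Lemma primitive_root_ndvd : ~~ (P %| G).
Proof.
have [u uG _] := primitive_rootE.
by rewrite -(resid_eq0 P_monic P_irr) -uG -unitfE; case: (u).
Qed.

Lemma ndvd_primX k : ~~ (P %| G ^+ k).
Proof.
rewrite -(resid_eq0 P_monic P_irr) rmorphXn expf_neq0 //.
by rewrite /= resid_eq0 primitive_root_ndvd.
Qed.

(** The value 1 would make the order q^d - 1 of G divide its half. *)
Lemma legendre_primitive_root : legendre P G = -1.
Proof.
apply: (legendreN1 (P_monic := P_monic) (P_irr := P_irr) q_odd primitive_root_ndvd).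
case: (legendre_pm P_monic P_irr q_odd primitive_root_ndvd) => // /eqP.
have qd1 : (1 < q ^ d)%N.
  by rewrite -(card_resid P_monic P_irr) card_finNzRing_gt1.
rewrite resid_prim_eq1 /half_exp => /dvdn_leq.
have := @odd_pred_half (q ^ d); rewrite oddX q_odd orbT => /(_ isT).
by move: qd1; move: (q ^ d)%N; lia.
Qed.

Lemma legendreX k : legendre P (G ^+ k) = (-1) ^+ k.
Proof.
elim: k => [|k IH]; first by rewrite !expr0 legendre_one.
by rewrite !exprS legendreM // legendre_primitive_root IH.
Qed.

Lemma modp_size (f : {poly F}) : (size (f %% P)%R <= d)%N.
Proof.
have P0 := monic_neq0 P_monic.
by rewrite -ltnS /pdeg prednK ?size_poly_gt0 // ltn_modp.
Qed.

Lemma dvdp_npoly_eq (s t : {poly_d F}) : P %| polyn s - polyn t -> s = t.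
Proof.
move=> h; apply: val_inj; apply/eqP; rewrite -subr_eq0; apply: contraTT h => st.
apply/negP => /(dvdp_leq st); rewrite leqNgt => /negP[].
apply: leq_ltn_trans (size_polyD _ _) _; rewrite size_polyN gtn_max.
have lt (r : {poly_d F}) : (size (polyn r) < size P)%N.
  apply: leq_ltn_trans (size_npoly r) _; rewrite /pdeg ltn_predL size_poly_gt0.
  exact: monic_neq0.
by rewrite !lt.
Qed.

(** Multiplication by G permutes the residues and changes the sign of every term. *)
Lemma sum_legendre_residues : \sum_(t : {poly_d F}) legendre P (polyn t) = 0.
Proof.
pose g (t : {poly_d F}) : {poly_d F} := npolyp d ((G * polyn t) %% P).
have gi : injective g.
  move=> s t /(congr1 val); rewrite /= !npolypK ?modp_size // => st.
  apply: dvdp_npoly_eq; rewrite -(Gauss_dvdpr _ (q := G)); last first.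
    by rewrite irreducible_poly_coprime // primitive_root_ndvd.
  by rewrite mulrBr /dvdp modpD modpN st subrr.
have E : \sum_(t : {poly_d F}) legendre P (polyn t) =
       - \sum_(t : {poly_d F}) legendre P (polyn t).
  rewrite {1}(reindex_inj gi) /= -sumrN; apply: eq_bigr => t _.
  rewrite npolypK ?modp_size // legendre_modp // legendreM //.
  by rewrite legendre_primitive_root mulN1r.
by move: E; lia.
Qed.

Lemma sum_legendre_translate f :
  \sum_(t : {poly_d F}) legendre P (f + polyn t) = 0.
Proof.
pose g (t : {poly_d F}) : {poly_d F} := npolyp d ((f + polyn t) %% P).
have gi : injective g.
  move=> s t /(congr1 val); rewrite /= !npolypK ?modp_size // => st.
  apply: dvdp_npoly_eq; apply/modp_eq0P.
  have -> : polyn s - polyn t = (f + polyn s) - (f + polyn t) by ring.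
  by rewrite modpD modpN st subrr.
rewrite -[RHS]sum_legendre_residues [RHS](reindex_inj gi) /=.
by apply: eq_bigr => t _; rewrite npolypK ?modp_size // legendre_modp.
Qed.

(* For j >= d the monic polynomials of degree j are equidistributed modulo P. *)
Lemma legendre_sum_big j : (d <= j)%N -> legendre_sum j = 0.
Proof.
move=> dj; rewrite /legendre_sum big_image /=.
have tr (t : {poly_d F}) : \sum_(r : {poly_j F}) legendre P ('X^j + polyn r) =
    \sum_(r : {poly_j F}) legendre P ('X^j + polyn r + polyn t).
  have st : (size (polyn t) <= j)%N := leq_trans (size_npoly t) dj.
  rewrite (reindex_inj (addIr (npolyp j (polyn t)))) /=.
  by apply: eq_bigr => r _; rewrite npolypK // addrA.
have : \sum_(t : {poly_d F}) \sum_(r : {poly_j F}) legendre P ('X^j + polyn r) = 0.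
  under eq_bigr => t _ do rewrite (tr t).
  by rewrite exchange_big big1 // => r _; rewrite sum_legendre_translate.
rewrite sumr_const card_npoly => /eqP; rewrite mulrn_eq0 expn_eq0.
by have := card_finNzRing_gt1 F; case: #|F| => //= n _ /eqP.
Qed.

(** Since c^(q-1) = 1, only the parity of 1 + q + ... + q^(d-1) matters in the exponent, and it is
    that of d. *)
Lemma legendre_const (c : F) : c != 0 ->
  legendre P c%:P = if odd d then lead_sign c%:P else 1.
Proof.
move=> c0.
have ev : half_exp P = (q.-1./2 * \sum_(i < d) q ^ i)%N.
  by apply: double_inj; rewrite doubleMl /half_exp -!odd_pred_half ?oddX ?q_odd ?orbT // predn_exp.
have os : odd (\sum_(i < d) q ^ i)%N = odd d.
  elim: (d) => [|n IH]; first by rewrite big_ord0.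
  by rewrite big_ord_recr /= oddD IH oddX q_odd orbT addbT.
have cq : c ^+ q.-1 = 1.
  apply: (mulfI c0); rewrite mulr1 -exprS prednK ?expf_card //.
  exact: ltnW (card_finNzRing_gt1 F).
have ch : c ^+ half_exp P = if odd d then c ^+ q.-1./2 else 1.
  rewrite ev -os; set m := (\sum_(i < d) q ^ i)%N.
  have -> : (q.-1./2 * m = q.-1./2 * odd m + q.-1 * m./2)%N.
    rewrite -{1}[m]odd_double_half mulnDr; congr (_ + _)%N.
    by rewrite -doubleMr doubleMl -odd_pred_half.
  rewrite exprD [X in _ * X]exprM cq expr1n mulr1.
  by case: (odd m); rewrite ?muln1 // muln0.
rewrite /legendre.
have -> : (P %| c%:P) = false.
  apply/negP => /dvdp_leq; rewrite polyC_eq0 c0 size_polyC c0 => /(_ isT).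
  by case: P_irr; case: size => // -[].
rewrite -polyC_exp ch; case: (odd d); last by rewrite polyC1 subrr dvdp0.
have -> : (P %| (c ^+ q.-1./2)%:P - 1) = (c ^+ q.-1./2 == 1).
  rewrite -polyC1 -polyCB.
  apply/idP/eqP => [|->]; last by rewrite subrr polyC0 dvdp0.
  move=> h; apply/eqP; rewrite -subr_eq0; apply: contraTT h => h.
  apply/negP => /dvdp_leq; rewrite polyC_eq0 h size_polyC h => /(_ isT).
  by case: P_irr; case: size => // -[].
by rewrite finField_euler // /lead_sign lead_coefC.
Qed.

End LegendreSums.

(** * Residues of the powers of a primitive root *)

Section Digits.
Variables (F : finFieldType) (P : {poly F}).
Hypotheses (P_monic : P \is monic) (P_irr : irreducible_poly P).
Hypothesis q_odd : odd #|F|.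
Local Notation q := #|F|.
Local Notation d := (pdeg P).
Variable G : {poly F}.
Hypothesis G_prim : primitive_root P G.
Local Notation rep := (\sum_(i < d) q ^ i)%N.
Local Notation R k := (G ^+ k %% P).

Lemma primitive_modp_neq0 k : R k != 0.
Proof.
by rewrite -[_ == 0]/(P %| _); apply: (ndvd_primX P_monic P_irr G_prim).
Qed.

Definition monic_part (f : {poly F}) := (lead_coef f)^-1 *: f.

Lemma monic_partE f : f != 0 -> f = (lead_coef f)%:P * monic_part f.
Proof.
by move=> f0; rewrite mul_polyC scalerA divff ?scale1r // lead_coef_eq0.
Qed.

Lemma monic_part_monic f : f != 0 -> monic_part f \is monic.
Proof. by move=> f0; rewrite monicE lead_coefZ mulVf // lead_coef_eq0. Qed.

Lemma size_monic_part f : f != 0 -> size (monic_part f) = size f.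
Proof. by move=> f0; rewrite size_scale // invr_eq0 lead_coef_eq0. Qed.

Lemma rep_q : (q.-1 * rep)%N = (q ^ d).-1.
Proof. by rewrite predn_exp. Qed.

Lemma resid_mod f : resid P_monic P_irr (f %% P) = resid P_monic P_irr f.
Proof.
apply/eqP; rewrite resid_eq; apply/modp_eq0P.
by rewrite modpD modpN modp_id subrr.
Qed.

(** Raising to the power q - 1 kills the leading coefficients, so a coincidence would give
    G^((l-k)(q-1)) = 1 modulo P with an exponent strictly between 0 and q^d - 1. *)
Lemma monic_part_inj k l : (k < l < rep)%N ->
  monic_part (R k) != monic_part (R l).
Proof.
move=> /andP[kl lr]; apply/eqP => e.
pose rs := resid P_monic P_irr.
have q1 : (0 < q.-1)%N by have := card_finNzRing_gt1 F; case: #|F| => // -[].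
have rsM f g : rs (f * g) = rs f * rs g by exact: rmorphM.
have cq (c : F) : c != 0 -> rs c%:P ^+ q.-1 = 1.
  move=> c0; rewrite -rmorphXn -polyC_exp.
  suff -> : c ^+ q.-1 = 1 by rewrite polyC1 rmorph1.
  apply: (mulfI c0); rewrite mulr1 -exprS prednK ?expf_card //.
  exact: ltnW (card_finNzRing_gt1 F).
have hk m : rs G ^+ m ^+ q.-1 = rs (monic_part (R m)) ^+ q.-1.
  have -> : rs G ^+ m = rs (R m) by rewrite /rs resid_mod rmorphXn.
  rewrite {1}(monic_partE (primitive_modp_neq0 m)) rsM exprMn cq ?mul1r //.
  by rewrite lead_coef_eq0 primitive_modp_neq0.
have G0 : rs G != 0 by rewrite resid_eq0 (primitive_root_ndvd P_monic P_irr).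
have : rs G ^+ ((l - k) * q.-1) = 1.
  apply: (mulfI (expf_neq0 (k * q.-1) G0)).
  by rewrite -exprD -mulnDl subnKC 1?ltnW // mulr1 !exprM hk -e -hk.
move/eqP; rewrite (resid_prim_eq1 P_monic P_irr G_prim) -rep_q => /dvdn_leq.
by rewrite muln_gt0 q1 subn_gt0 kl => /(_ isT); rewrite mulnC leq_pmul2r //; lia.
Qed.

(** The monic parts are distinct monic polynomials of degree < d, and there are just as many of the
    latter: 1 + q + ... + q^(d-1). *)
Lemma sum_monics_powers (V : nmodType) (w : {poly F} -> V) :
  \sum_(j < d) \sum_(f <- monics F j) w f = \sum_(k < rep) w (monic_part (R k)).
Proof.
pose M := flatten [seq monics F j | j <- iota 0 d].
have -> : \sum_(j < d) \sum_(f <- monics F j) w f = \sum_(f <- M) w f.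
  by rewrite big_flatten big_map -[X in iota 0 X]subn0 big_mkord.
pose Rs := [seq monic_part (R k) | k <- iota 0 rep].
have -> : \sum_(k < rep) w (monic_part (R k)) = \sum_(f <- Rs) w f.
  by rewrite big_map -[X in iota 0 X]subn0 big_mkord.
have uR : uniq Rs.
  rewrite map_inj_in_uniq ?iota_uniq // => i j; rewrite !mem_iota /= !add0n.
  move=> id jd /eqP e; case: (ltngtP i j) => // ij.
    by have := @monic_part_inj i j; rewrite ij jd e => /(_ isT).
  by have := @monic_part_inj j i; rewrite ij id eq_sym e => /(_ isT).
have sRM : {subset Rs <= M}.
  move=> f /mapP[k _ ->]; have R0 := primitive_modp_neq0 k.
  apply/flatten_mapP; exists (pdeg (monic_part (R k))); last first.
    exact: monic_in_monics (monic_part_monic R0).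
  rewrite mem_iota /= add0n /pdeg size_monic_part //.
  by rewrite prednK ?size_poly_gt0 ?modp_size.
have sMR : (size M <= size Rs)%N.
  rewrite size_flatten /shape -map_comp size_map size_iota sumnE big_map.
  rewrite -[X in iota 0 X]subn0 big_mkord.
  by apply: leq_sum => i _; rewrite /= size_monics.
apply/esym/perm_big/uniq_perm => //; first exact: leq_size_uniq sMR.
by have [_ h] := uniq_min_size uR sRM sMR.
Qed.

(** The symbol of the leading coefficient is 1 or -1, hence its own inverse, and moves to the other
    side. *)
Lemma lead_legendre f : f != 0 -> legendre P (monic_part f) =
  (if odd d then lead_sign f else 1) * legendre P f.
Proof.
move=> f0; have l0 : lead_coef f != 0 by rewrite lead_coef_eq0.
rewrite {3}(monic_partE f0) legendreM // legendre_const // mulrA.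
rewrite /lead_sign lead_coefC; case: (odd d); rewrite ?mul1r //.
by set b := [exists a, _]; case: b; rewrite ?mul1r ?mulrNN ?mul1r.
Qed.

Lemma odd_rep : odd rep = odd d.
Proof.
elim: (d) => [|n IH]; first by rewrite big_ord0.
by rewrite big_ord_recr /= oddD IH oddX q_odd orbT addbT.
Qed.

Lemma legendre_R k : legendre P (R k) = (-1) ^+ k.
Proof. by rewrite legendre_modp // (legendreX P_monic P_irr). Qed.

(** For even d the constants have symbol 1, so the sum is that of (-1)^k over an even number of
    indices; the induction removes two terms at a time. *)
Lemma legendre_sum_total : ~~ odd d -> \sum_(j < d) legendre_sum P j = 0.
Proof.
move=> /negbTE ed; rewrite sum_monics_powers.
under eq_bigr => k _ do rewrite lead_legendre ?primitive_modp_neq0 // ed mul1r legendre_R.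
have := odd_rep; rewrite ed; elim: rep {-2}rep (leqnn rep) => [|n IH] [|[|m]] //=.
- by rewrite big_ord0.
- by rewrite big_ord0.
rewrite negbK => mn om; rewrite !big_ord_recr /= IH //; last by apply: ltnW.
by rewrite add0r exprS mulN1r subrr.
Qed.

(** By Euler's criterion [lead_sign] is the (q-1)/2-th power of the leading coefficient. *)
Lemma lead_signM (f g : {poly F}) : f != 0 -> g != 0 ->
  lead_sign (f * g) = lead_sign f * lead_sign g.
Proof.
move=> f0 g0.
have E (h : {poly F}) : h != 0 -> lead_sign h = if lead_coef h ^+ q.-1./2 == 1 then 1 else -1.
  by move=> h0; rewrite finField_euler ?lead_coef_eq0.
rewrite !E ?mulf_neq0 // lead_coefM exprMn.
have pm (h : {poly F}) : h != 0 -> lead_coef h ^+ q.-1./2 = 1 \/ lead_coef h ^+ q.-1./2 = -1.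
  rewrite -lead_coef_eq0 => h0.
  suff : (lead_coef h ^+ q.-1./2) ^+ 2 == 1.
    by rewrite sqrf_eq1 => /orP[]/eqP; [left|right].
  rewrite -exprM muln2 -odd_pred_half //.
  apply/eqP/(mulfI h0); rewrite mulr1 -exprS prednK ?expf_card //.
  exact: ltnW (card_finNzRing_gt1 F).
have n1 : (-1 == 1 :> F) = false.
  by rewrite eq_sym -subr_eq0 opprK -[1+1]/(2%:R); apply/negbTE/char_odd.
by case: (pm f f0) => ->; case: (pm g g0) => ->; rewrite ?mulr1 ?mul1r ?mulrNN ?mulr1 ?eqxx ?n1.
Qed.

End Digits.

(** * Valuations and the places of F(T) *)

Section Valuation.
Variables (R : fieldType) (v : R -> int).

Definition is_valuation :=
  (forall x y, x != 0 -> y != 0 -> v (x * y) = v x + v y) /\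
  (forall x y, x != 0 -> y != 0 -> x + y != 0 ->
     Num.min (v x) (v y) <= v (x + y)).

(* v x >= m, with the convention v 0 = +oo *)
Definition vge (x : R) (m : int) : bool := (x == 0) || (m <= v x).

Hypothesis vv : is_valuation.

Lemma valM x y : x != 0 -> y != 0 -> v (x * y) = v x + v y.
Proof. exact: vv.1. Qed.

Lemma val1 : v 1 = 0.
Proof. by apply: (addrI (v 1)); rewrite -valM ?oner_neq0 // mulr1 addr0. Qed.

Lemma valN x : v (- x) = v x.
Proof.
have [->|x0] := eqVneq x 0; first by rewrite oppr0.
have n0 : (-1 : R) != 0 by rewrite oppr_eq0 oner_neq0.
have := valM n0 n0; rewrite mulrNN mulr1 val1 => h.
by rewrite -mulN1r valM //; lia.
Qed.

Lemma valV x : x != 0 -> v x^-1 = - v x.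
Proof.
by move=> x0; have := @valM x x^-1; rewrite invr_eq0 divff // val1 x0 => /(_ isT isT); lia.
Qed.

Lemma valX x n : x != 0 -> v (x ^+ n) = n%:Z * v x.
Proof.
move=> x0; elim: n => [|n IH]; first by rewrite expr0 val1 mul0r.
by rewrite exprS valM ?expf_neq0 // IH; lia.
Qed.

Lemma val_div x y : x != 0 -> y != 0 -> v (x / y) = v x - v y.
Proof. by move=> x0 y0; rewrite valM ?invr_eq0 // valV. Qed.

Lemma val_divX x y n : x != 0 -> y != 0 -> v (y / x ^+ n) = v y - n%:Z * v x.
Proof. by move=> x0 y0; rewrite val_div ?expf_neq0 // valX. Qed.

Lemma vge_zero m : vge 0 m. Proof. by rewrite /vge eqxx. Qed.

Lemma vgeE x m : x != 0 -> vge x m = (m <= v x).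
Proof. by rewrite /vge => /negbTE->. Qed.

Lemma vge_val x : vge x (v x).
Proof. by rewrite /vge lexx orbT. Qed.

Lemma vge_le x m n : n <= m -> vge x m -> vge x n.
Proof. by move=> nm /orP[/eqP->|h]; rewrite ?vge_zero // /vge (le_trans nm h) orbT. Qed.

Lemma vgeN x m : vge (- x) m = vge x m.
Proof. by rewrite /vge oppr_eq0 valN. Qed.

Lemma vgeD x y m : vge x m -> vge y m -> vge (x + y) m.
Proof.
have [->|x0] := eqVneq x 0; first by rewrite add0r.
have [->|y0] := eqVneq y 0; first by rewrite addr0.
have [->|xy0] := eqVneq (x + y) 0; first by rewrite vge_zero.
rewrite !vgeE // => hx hy; apply: le_trans (vv.2 _ _ x0 y0 xy0).
by rewrite le_min hx.
Qed.

Lemma vgeB x y m : vge x m -> vge y m -> vge (x - y) m.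
Proof. by move=> hx hy; rewrite vgeD // vgeN. Qed.

Lemma vge_sum (I : Type) (s : seq I) (p : pred I) (f : I -> R) m :
  (forall i, p i -> vge (f i) m) -> vge (\sum_(i <- s | p i) f i) m.
Proof. by move=> h; elim/big_rec: _ => [|i x pi]; [exact: vge_zero|apply: vgeD (h i pi)]. Qed.

Lemma vgeM x y m n : vge x m -> vge y n -> vge (x * y) (m + n).
Proof.
have [->|x0] := eqVneq x 0; first by rewrite mul0r !vge_zero.
have [->|y0] := eqVneq y 0; first by rewrite mulr0 !vge_zero.
by rewrite !vgeE ?mulf_neq0 // valM //; lia.
Qed.

Lemma vgeMl c x m : c != 0 -> v c = 0 -> vge (c * x) m = vge x m.
Proof. by move=> c0 h; rewrite /vge mulf_eq0 (negbTE c0) /=; case: eqVneq => //= x0; rewrite valM // h add0r. Qed.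

(** The hypothesis on y means v y > v x in a form that admits y = 0. The upper bound on v (x + y)
    comes from x = (x + y) - y. *)
Lemma val_addr x y : x != 0 -> vge y (v x + 1) -> x + y != 0 /\ v (x + y) = v x.
Proof.
move=> x0 hy; have xy0 : x + y != 0.
  apply/eqP => xy; have yx : y = - x by apply: (addrI x); rewrite xy subrr.
  by move: hy; rewrite yx vgeN vgeE //; lia.
split=> //; have [y0|y0] := eqVneq y 0; first by rewrite y0 addr0.
rewrite vgeE // in hy; have := vv.2 _ _ x0 y0 xy0.
have := @vv.2 (x + y) (- y) xy0; rewrite oppr_eq0 addrK valN => /(_ y0 x0).
by rewrite !ge_min; lia.
Qed.

Lemma val_mod x y : x != 0 -> vge (x - y) (v x + 1) -> y != 0 /\ v y = v x.
Proof.
move=> x0 h; have := @val_addr x (y - x) x0; rewrite [x + _]addrC subrK; apply.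
by rewrite -vgeN opprB.
Qed.

Lemma vge_neq x y : x != 0 -> y != 0 -> v x < v y -> x + y != 0 /\ v (x + y) = v x.
Proof. by move=> x0 y0 h; apply: val_addr; rewrite ?vgeE //; lia. Qed.

End Valuation.

(** * Extending valuations from F[T] to F(T) *)

Section FractionValuation.
Variable F : finFieldType.
Local Notation K := {fraction {poly F}}.
Implicit Types (f g : {poly F}) (x : K).

Lemma fracP x : exists f g, g != 0 /\ x = f%:F / g%:F.
Proof. by exists (\n_(generic_quotient.repr x)), (\d_(generic_quotient.repr x)); split; [exact: denom_ratioP|exact: frac_repr]. Qed.

Lemma fracP0 x : x != 0 -> exists f g, [/\ f != 0, g != 0 & x = f%:F / g%:F].
Proof.
move=> x0; have [f [g [g0 xE]]] := fracP x; exists f, g; split=> //.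
by apply: contraNneq x0 => f0; rewrite xE f0 tofrac0 mul0r.
Qed.

Variable o : {poly F} -> int.
Hypothesis oM : forall f g, f != 0 -> g != 0 -> o (f * g) = o f + o g.
Hypothesis oD : forall f g, f != 0 -> g != 0 -> f + g != 0 ->
  Num.min (o f) (o g) <= o (f + g).

(* The extension to F(T) of an additive degree function o on nonzero polynomials. *)
Definition fracval x : int :=
  o (\n_(generic_quotient.repr x)) - o (\d_(generic_quotient.repr x)).

Lemma fracval_frac f g : f != 0 -> g != 0 -> fracval (f%:F / g%:F) = o f - o g.
Proof.
move=> f0 g0; rewrite /fracval; set x := _ / _.
have xE := frac_repr x; move: xE.
set n : {poly F} := \n_(generic_quotient.repr x).
set d : {poly F} := \d_(generic_quotient.repr x).
have d0 : d != 0 by exact: denom_ratioP.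
move=> xE.
have : (n * g)%:F = (f * d)%:F.
  rewrite !tofracM; apply/eqP.
  by rewrite -eqr_div ?tofrac_eq0 // -xE.
move/eqP; rewrite tofrac_eq => /eqP e.
have n0 : n != 0.
  by apply: contraNneq (mulf_neq0 f0 d0) => n0; rewrite -e n0 mul0r.
by have := congr1 o e; rewrite !oM //; lia.
Qed.

Lemma fracval_poly f : f != 0 -> fracval f%:F = o f.
Proof.
have o1 : o 1 = 0.
  by apply: (addrI (o 1)); rewrite -oM ?oner_neq0 // mulr1 addr0.
move=> f0; have := @fracval_frac f 1 f0 (oner_neq0 _).
by rewrite tofrac1 divr1 o1 subr0.
Qed.

Lemma fracval_valuation : is_valuation fracval.
Proof.
split=> x y /fracP0[f [g [f0 g0 ->]]] /fracP0[h [k [h0 k0 ->]]].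
  rewrite mulrACA -invfM -!tofracM !fracval_frac ?mulf_neq0 // !oM //; lia.
rewrite addf_div ?tofrac_eq0 // -!tofracM -tofracD => xy0.
have s0 : f * k + h * g != 0.
  by apply: contraNneq xy0 => ->; rewrite tofrac0 mul0r.
rewrite !fracval_frac ?mulf_neq0 //.
have := oD (mulf_neq0 f0 k0) (mulf_neq0 h0 g0) s0; rewrite !oM // !ge_min.
move: (o (f * k + h * g)) (o f) (o g) (o h) (o k) => a b c u w; lia.
Qed.

End FractionValuation.

Section PlacesOfK.
Variable F : finFieldType.
Local Notation K := {fraction {poly F}}.
Implicit Types (f g Q : {poly F}) (x : K).

Lemma vinfE x : vinf x = fracval (fun f => - (pdeg f)%:Z) x.
Proof. by rewrite /vinf /fracval; lia. Qed.

Lemma pdegM f g : f != 0 -> g != 0 -> pdeg (f * g) = (pdeg f + pdeg g)%N.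
Proof.
move=> f0 g0; rewrite /pdeg size_mul //.
by move: f0 g0; rewrite -!size_poly_gt0; move: (size f) (size g) => a b; lia.
Qed.

Lemma pdegM_int f g : f != 0 -> g != 0 ->
  - (pdeg (f * g))%:Z = - (pdeg f)%:Z - (pdeg g)%:Z.
Proof. by move=> f0 g0; rewrite pdegM //; lia. Qed.

Lemma pdegD_int f g : f != 0 -> g != 0 -> f + g != 0 ->
  Num.min (- (pdeg f)%:Z) (- (pdeg g)%:Z) <= - (pdeg (f + g))%:Z.
Proof.
rewrite ge_min -!size_poly_gt0 /pdeg; move: (size_polyD f g).
move: (size f) (size g) (size (f + g)) => a b c; lia.
Qed.

Lemma vinf_valuation : is_valuation (@vinf F).
Proof.
by rewrite (funext vinfE); apply: fracval_valuation; [exact: pdegM_int|exact: pdegD_int].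
Qed.

Lemma vinf_poly f : f != 0 -> vinf f%:F = - (pdeg f)%:Z.
Proof. by move=> f0; rewrite vinfE fracval_poly //; exact: pdegM_int. Qed.

(** The bound is harmless: for nonconstant Q and f != 0, Q^k | f forces k < [size f]. *)
Definition ord Q f : nat := \max_(k < size f | Q ^+ k %| f) k.

Lemma dvdp_ord Q f k : (1 < size Q)%N -> f != 0 -> (Q ^+ k %| f) = (k <= ord Q f)%N.
Proof.
move=> sQ f0; have Q0 : Q != 0 by rewrite -size_poly_gt0 ltnW.
have lt j : Q ^+ j %| f -> (j < size f)%N.
  move/(dvdp_leq f0); apply: leq_trans; elim: j => [|j IH]; first by rewrite expr0 size_poly1.
  rewrite exprS size_mul ?expf_neq0 //; move: IH sQ; move: (size Q) (size _) => a b; lia.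
have dv : Q ^+ ord Q f %| f.
  rewrite /ord; elim/big_ind: _ => //; first by rewrite expr0 dvd1p.
  by move=> i j hi hj; rewrite /maxn; case: ifP.
apply/idP/idP => [h|kf].
  by rewrite /ord -[k]/(val (Ordinal (lt _ h))); exact: leq_bigmax_cond.
by apply: dvdp_trans dv; apply: dvdp_exp2l.
Qed.

Section Irreducible.
Variable Q : {poly F}.
Hypothesis Q_irr : irreducible_poly Q.
Let sQ : (1 < size Q)%N. Proof. by case: Q_irr. Qed.
Let Q0 : Q != 0. Proof. by rewrite -size_poly_gt0 ltnW. Qed.

Lemma ord_eq f k g : f = Q ^+ k * g -> ~~ (Q %| g) -> ord Q f = k.
Proof.
move=> fE Qg; have g0 : g != 0 by apply: contraNneq Qg => ->; rewrite dvdp0.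
have f0 : f != 0 by rewrite fE mulf_neq0 ?expf_neq0.
apply/eqP; rewrite eqn_leq -[(k <= _)%N]dvdp_ord // fE dvdp_mulr // andbT.
rewrite leqNgt -dvdp_ord // -?fE // fE exprSr dvdp_mul2l // expf_neq0 //.
Qed.

Lemma ordP f : f != 0 -> exists2 g, f = Q ^+ ord Q f * g & ~~ (Q %| g).
Proof.
move=> f0; have : Q ^+ ord Q f %| f by rewrite dvdp_ord.
move/dvdpP => [g fE]; exists g; first by rewrite {1}fE mulrC.
apply/negP => /dvdpP[h gE].
have : Q ^+ (ord Q f).+1 %| f by rewrite {2}fE gE exprS -mulrA dvdp_mull.
by rewrite dvdp_ord // ltnn.
Qed.

Lemma irr_dvdM f g : (Q %| f * g) = (Q %| f) || (Q %| g).
Proof.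
have [Qf|Qf] := boolP (Q %| f); first by rewrite dvdp_mulr.
by rewrite Gauss_dvdpr // irreducible_poly_coprime.
Qed.

Lemma ordM f g : f != 0 -> g != 0 -> ord Q (f * g) = (ord Q f + ord Q g)%N.
Proof.
move=> f0 g0; have [a fE Qa] := ordP f0; have [b gE Qb] := ordP g0.
apply: (@ord_eq _ _ (a * b)); last by rewrite irr_dvdM negb_or Qa.
by rewrite {1}fE {1}gE exprD; ring.
Qed.

Lemma ord_gt0 f : f != 0 -> (0 < ord Q f)%N = (Q %| f).
Proof. by move=> f0; rewrite -dvdp_ord ?expr1. Qed.

Lemma ord0 f : ~~ (Q %| f) -> ord Q f = 0%N.
Proof. by move=> Qf; apply: (@ord_eq _ _ f); rewrite ?expr0 ?mul1r. Qed.

Lemma ordM_int f g : f != 0 -> g != 0 ->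
  (ord Q (f * g))%:Z = (ord Q f)%:Z + (ord Q g)%:Z.
Proof. by move=> f0 g0; rewrite ordM //; lia. Qed.

Lemma ordD_int f g : f != 0 -> g != 0 -> f + g != 0 ->
  Num.min (ord Q f)%:Z (ord Q g)%:Z <= (ord Q (f + g))%:Z.
Proof.
move=> f0 g0 fg0; suff : (minn (ord Q f) (ord Q g) <= ord Q (f + g))%N.
  by rewrite ge_min; lia.
by rewrite -dvdp_ord // dvdp_add // dvdp_ord // ?geq_minl ?geq_minr.
Qed.

Definition vord : K -> int := fracval (fun f => (ord Q f)%:Z).

Lemma vord_valuation : is_valuation vord.
Proof. by apply: fracval_valuation; [exact: ordM_int|exact: ordD_int]. Qed.

Lemma vord_poly f : f != 0 -> vord f%:F = (ord Q f)%:Z.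
Proof. by move=> f0; rewrite /vord fracval_poly //; exact: ordM_int. Qed.

End Irreducible.
End PlacesOfK.

Section MonicIrreducible.
Variable F : finFieldType.
Local Notation K := {fraction {poly F}}.
Implicit Types (f g Q : {poly F}) (x a : K).

Definition mirr Q := (Q \is monic) && irreducibleb Q.

Lemma mirrP Q : mirr Q -> Q \is monic /\ irreducible_poly Q.
Proof. by move=> /andP[mQ /irreducibleP iQ]. Qed.

Lemma mirr_neq0 Q : mirr Q -> Q != 0.
Proof. by move=> /mirrP[/monic_neq0]. Qed.

Lemma mirr_pdeg Q : mirr Q -> (0 < pdeg Q)%N.
Proof. by move=> /mirrP[_ [sQ _]]; rewrite /pdeg -subn1 subn_gt0. Qed.

Lemma mirr_dvd Q Q' : mirr Q -> mirr Q' -> Q %| Q' -> Q = Q'.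
Proof.
move=> /mirrP[mQ iQ] /mirrP[mQ' iQ'] h; apply/eqP; rewrite -eqp_monic //.
by apply: iQ'.2 h; apply/eqP => s1; have := iQ.1; rewrite s1.
Qed.

Lemma exists_mirr f : (1 < size f)%N -> exists2 Q, mirr Q & Q %| f.
Proof.
move: {2}(size f) (leqnn (size f)) => n; elim: n f => [|n IH] f; first by case: size.
move=> sf f1; have f0 : f != 0 by rewrite -size_poly_gt0 ltnW.
have [/irreducibleP fi|] := boolP (irreducibleb f).
  exists ((lead_coef f)^-1 *: f); last first.
    by rewrite dvdpZl ?dvdpp // invr_eq0 lead_coef_eq0.
  apply/andP; split; first by rewrite monicE lead_coefZ mulVf // lead_coef_eq0.
  have l0 : (lead_coef f)^-1 != 0 by rewrite invr_eq0 lead_coef_eq0.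
  apply/irreducibleP; split=> [|g sg]; first by rewrite size_scale.
  by rewrite dvdpZr // => /(fi.2 _ sg) h; rewrite eqp_sym (eqp_ltrans (eqp_scale _ l0)) eqp_sym.
rewrite negb_and f1 /= negb_forall => /existsP[g].
rewrite negb_imply -ltnNge -dvdpE => /andP[gf sg].
have [|//|Q mQ Qg] := IH g; last by exists Q => //; apply: dvdp_trans Qg gf.
by apply: leq_trans (size_npoly g) _; rewrite -ltnS prednK // ltnW.
Qed.

Definition primes_of f : seq {poly F} :=
  [seq Q <- flatten [seq monics F j | j <- iota 0 (size f)] | mirr Q && (Q %| f)].

Lemma mem_primes_of f Q : f != 0 -> (Q \in primes_of f) = mirr Q && (Q %| f).
Proof.
move=> f0; rewrite mem_filter; have [/andP[mQ Qf]|//] := boolP (mirr Q && (Q %| f)); rewrite /=.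
apply/flatten_mapP; exists (pdeg Q); last first.
  by apply: monic_in_monics; case/mirrP: mQ.
rewrite mem_iota /= add0n; apply: leq_trans (dvdp_leq f0 Qf).
by rewrite /pdeg prednK // size_poly_gt0 mirr_neq0.
Qed.

Lemma ord_mirr Q Q' : mirr Q -> mirr Q' -> ord Q Q' = (Q == Q').
Proof.
move=> mQ mQ'; have [mo iQ] := mirrP mQ; case: eqVneq => [<-|QQ'].
  apply: (ord_eq iQ (g := 1)); first by rewrite mulr1.
  by rewrite dvdp1; case: iQ; case: size => [|[]].
by apply: ord0 => //; apply: contra QQ' => /(mirr_dvd mQ mQ') ->.
Qed.

(** Induction on the degree, splitting off one irreducible factor. [Qs] may exceed the prime factors
    of f, so that one list can serve numerator and denominator of a fraction. *)
Lemma sum_ord f (Qs : seq {poly F}) : f != 0 -> uniq Qs -> all mirr Qs ->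
  {subset primes_of f <= Qs} ->
  (\sum_(Q <- Qs) pdeg Q * ord Q f)%N = pdeg f.
Proof.
move: {2}(size f) (leqnn (size f)) => n; elim: n f => [|n IH] f.
  by rewrite size_poly_leq0 => ->.
move=> sf f0 uQ /allP mQ sub; have [f1|f1] := leqP (size f) 1.
  rewrite big_seq big1 => [|Q QQs]; first by rewrite /pdeg; case: size f1 => [|[]].
  have [_ iQ] := mirrP (mQ _ QQs).
  rewrite ord0 ?muln0 //; apply/negP => /(dvdp_leq f0); rewrite leqNgt.
  by rewrite (leq_ltn_trans f1) //; case: iQ.
have [Q0 mQ0 Qf] := exists_mirr f1; have [mo iQ0] := mirrP mQ0.
have [g fE] := dvdpP _ _ Qf.
have g0 : g != 0 by apply: contraNneq f0 => g0; rewrite fE g0 mul0r.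
have Q00 := mirr_neq0 mQ0.
rewrite fE pdegM // addnC -(IH g) //; first last.
- move=> Q; rewrite mem_primes_of // => /andP[mq Qg]; apply: sub.
  by rewrite mem_primes_of // mq fE dvdp_mulr.
- by apply/allP.
- rewrite -ltnS (leq_trans _ sf) // fE size_mul //.
  by case: iQ0 => s _; move: s g0; rewrite -size_poly_gt0; move: (size g) (size Q0) => u w; lia.
have Q0Qs : Q0 \in Qs by apply: sub; rewrite mem_primes_of // mQ0.
rewrite [X in (X + _)%N](_ : _ = \sum_(Q <- Qs) pdeg Q * (Q == Q0))%N; last first.
  by rewrite (bigD1_seq Q0) //= eqxx muln1 big1 ?addn0 // => Q /negbTE->; rewrite muln0.
rewrite -big_split /= big_seq [RHS]big_seq; apply: eq_bigr => Q QQs.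
have [_ iQ] := mirrP (mQ _ QQs).
by rewrite -mulnDr (ordM iQ) // (ord_mirr (mQ _ QQs) mQ0) addnC.
Qed.

(** After division by the gcd, an irreducible factor left in f would also divide what is left of
    g. *)
Lemma dvdp_ordP f g : f != 0 -> g != 0 ->
  (forall Q, mirr Q -> (ord Q f <= ord Q g)%N) -> f %| g.
Proof.
move=> f0 g0 h.
pose r := gcdp f g; pose f' := f %/ r; pose g' := g %/ r.
have cp : coprimep f' g' by apply: coprimep_div_gcd; rewrite f0.
have fE : f = f' * r by rewrite divpK // dvdp_gcdl.
have gE : g = g' * r by rewrite divpK // dvdp_gcdr.
clearbody f' g' r.
have r0 : r != 0 by apply: contraNneq f0 => e; rewrite fE e mulr0.
have f'0 : f' != 0 by apply: contraNneq f0 => e; rewrite fE e mul0r.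
have g'0 : g' != 0 by apply: contraNneq g0 => e; rewrite gE e mul0r.
have [s1|s1] := leqP (size f') 1.
  have /eqP/size_poly1P[c c0 f'c] : size f' = 1%N.
    by apply/eqP; rewrite eqn_leq s1 size_poly_gt0.
  by rewrite fE f'c mul_polyC dvdpZl // gE dvdp_mull.
have [Q mQ Qf] := exists_mirr s1; have [mo iQ] := mirrP mQ.
have := h Q mQ; rewrite fE gE !(ordM iQ) // leq_add2r => o.
have Qg : Q %| g' by rewrite -(ord_gt0 iQ) // (leq_trans _ o) // (ord_gt0 iQ).
have := coprimepP _ _ cp Q Qf Qg; rewrite -size_poly_eq1 => /eqP s.
by case: iQ; rewrite s.
Qed.

(* The places of F(T): Some Q for the Q-adic one, None for the place at oo. *)
Definition kidx (i : option {poly F}) := if i is Some Q then mirr Q else true.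
Definition kw (i : option {poly F}) : K -> int :=
  if i is Some Q then vord Q else @vinf F.
Definition kd (i : option {poly F}) := if i is Some Q then pdeg Q else 1%N.

(* The polynomials of degree < n represent the residue field. *)
Definition is_kplace (w : K -> int) (n : nat) :=
  [/\ is_valuation w, (0 < n)%N, exists2 a, a != 0 & w a = 1,
      forall t : {poly F}, (size t <= n)%N -> t != 0 -> w t%:F = 0
    & forall a, vge w a 0 -> exists2 t : {poly F}, (size t <= n)%N & vge w (a - t%:F) 1].

Lemma vge_vord Q f m : mirr Q -> vge (vord Q) f%:F m%:Z = (Q ^+ m %| f).
Proof.
move=> mQ; have [_ iQ] := mirrP mQ.
have [->|f0] := eqVneq f 0; first by rewrite tofrac0 vge_zero dvdp0.
by rewrite vgeE ?tofrac_eq0 // vord_poly // dvdp_ord //; case: iQ.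
Qed.

Lemma vord_kplace Q : mirr Q -> is_kplace (vord Q) (pdeg Q).
Proof.
move=> mQ; have [mo iQ] := mirrP mQ; have Q0 := mirr_neq0 mQ.
have vv := vord_valuation iQ.
have ndv (t : {poly F}) : (size t <= pdeg Q)%N -> t != 0 -> ~~ (Q %| t).
  move=> st t0; apply/negP => /(dvdp_leq t0); rewrite leqNgt => /negP[].
  by rewrite (leq_ltn_trans st) // /pdeg prednK // size_poly_gt0.
split=> //; first exact: mirr_pdeg.
- by exists Q%:F; rewrite ?tofrac_eq0 // vord_poly // ord_mirr // eqxx.
- by move=> t st t0; rewrite vord_poly // ord0 // ndv.
move=> a; have [f [g [g0 ->]]] := fracP a.
have [->|f0] := eqVneq f 0.
  by exists 0; rewrite ?size_poly0 // tofrac0 mul0r subrr vge_zero.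
have [f' fE Qf'] := ordP iQ f0; have [g' gE Qg'] := ordP iQ g0.
have F0 (h : {poly F}) : h != 0 -> h%:F != 0 by rewrite tofrac_eq0.
rewrite vgeE ?mulf_neq0 ?invr_eq0 ?F0 // (val_div vv) ?F0 // !vord_poly // => le.
have g'0 : g' != 0 by apply: contraNneq Qg' => ->; rewrite dvdp0.
have lf : (ord Q g <= ord Q f)%N by move: le; lia.
have cp : coprimep g' Q by rewrite coprimep_sym irreducible_poly_coprime.
have [[u v] /= uv] := Bezout_eq1_coprimepP _ _ cp.
pose b := Q ^+ (ord Q f - ord Q g) * f'.
have aE : f%:F / g%:F = b%:F / g'%:F.
  apply/eqP; rewrite eqr_div ?F0 // -!tofracM; apply/eqP; congr (_%:F).
  by rewrite {1}fE {1}gE /b -{1}(subnK lf) exprD; ring.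
(* The Bezout coefficient [u] inverts [g'] modulo Q, so b / g' is congruent to b u. *)
exists ((b * u) %% Q).
  by rewrite -ltnS [(pdeg Q).+1]prednK ?size_poly_gt0 // ltn_modp.
have -> : f%:F / g%:F - ((b * u) %% Q)%:F =
    (b * v * Q)%:F / g'%:F + ((b * u) %/ Q * Q)%:F.
  rewrite aE; apply: (mulIf (F0 _ g'0)).
  rewrite mulrBl mulrDl !mulfVK ?F0 // -!tofracM -tofracB -tofracD; congr (_%:F).
  rewrite (_ : (b * u) %% Q = b * u - (b * u) %/ Q * Q); last first.
    by rewrite {2}(divp_eq (b * u) Q) addrC addKr.
  by move: (_ %/ _) => D; rewrite -{1}[b]mulr1 -uv; ring.
apply: (vgeD vv); last by rewrite -[1]/(1%N%:Z) vge_vord // expr1 dvdp_mull.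
rewrite -[1]addr0; apply: (vgeM vv); first by rewrite -[1]/(1%N%:Z) vge_vord // expr1 dvdp_mull.
by rewrite vgeE ?invr_eq0 ?F0 // (valV vv) ?F0 // vord_poly // ord0.
Qed.

Lemma vinf_kplace : is_kplace (@vinf F) 1.
Proof.
have vv := @vinf_valuation F.
have F0 (h : {poly F}) : h != 0 -> h%:F != 0 by rewrite tofrac_eq0.
split=> //.
- exists ('X%:F)^-1; first by rewrite invr_eq0 F0 // polyX_eq0.
  by rewrite (valV vv) ?F0 ?polyX_eq0 // vinf_poly ?polyX_eq0 // /pdeg size_polyX.
- by move=> t st t0; rewrite vinf_poly // /pdeg; move: st; case: size => [|[]].
move=> a; have [f [g [g0 ->]]] := fracP a.
have [->|f0] := eqVneq f 0.
  by exists 0; rewrite ?size_poly0 // tofrac0 mul0r subrr vge_zero.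
rewrite vgeE ?mulf_neq0 ?invr_eq0 ?F0 // (val_div vv) ?F0 // !vinf_poly // => le.
have sfg : (size f <= size g)%N.
  move: le f0 g0; rewrite -!size_poly_gt0 /pdeg.
  by move: (size f) (size g) => u w; lia.
(* The value of f / g at oo: the ratio of the leading coefficients if the degrees agree, and 0 if
   deg f < deg g. *)
pose c := f`_(size g).-1 / lead_coef g.
exists c%:P; first by rewrite size_polyC leq_b1.
have -> : f%:F / g%:F - c%:P%:F = (f - c%:P * g)%:F / g%:F.
  by rewrite tofracB mulrBl tofracM mulfK // F0.
have [->|h0] := eqVneq (f - c%:P * g) 0; first by rewrite tofrac0 mul0r vge_zero.
have sh : (size (f - c%:P * g)%R <= (size g).-1)%N.
  apply/leq_sizeP => j gj; rewrite coefB coefCM.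
  move: gj; rewrite leq_eqVlt => /orP[/eqP<-|gj].
    by rewrite -lead_coefE /c divfK ?subrr // lead_coef_eq0.
  have sj : (size g <= j)%N by move: gj; case: (size g).
  by rewrite !nth_default ?mulr0 ?subr0 // (leq_trans sfg).
rewrite vgeE ?mulf_neq0 ?invr_eq0 ?F0 // (val_div vv) ?F0 // !vinf_poly //.
move: sh h0; rewrite -size_poly_gt0 /pdeg.
by move: (size (f - c%:P * g)) (size g) => u w; lia.
Qed.

Lemma kplaceP i : kidx i -> is_kplace (kw i) (kd i).
Proof. by case: i => [Q|_]; [exact: vord_kplace|exact: vinf_kplace]. Qed.

Lemma fraction_integral a : (forall Q, mirr Q -> vge (vord Q) a 0) ->
  exists f, a = f%:F.
Proof.
have [f [g [g0 ->]]] := fracP a => h.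
have [->|f0] := eqVneq f 0; first by exists 0; rewrite tofrac0 mul0r.
suff /dvdpP[k fE] : g %| f by exists k; rewrite fE tofracM mulfK // tofrac_eq0.
apply: dvdp_ordP => // Q mQ; have [_ iQ] := mirrP mQ.
have := h Q mQ; rewrite vgeE ?mulf_neq0 ?invr_eq0 ?tofrac_eq0 //.
by rewrite (val_div (vord_valuation iQ)) ?tofrac_eq0 // !vord_poly //; lia.
Qed.

(** Every list containing [Qs0] is allowed, so that the supports of several elements can be
    merged. *)
Lemma product_formula a : a != 0 -> exists2 Qs0 : seq {poly F}, all mirr Qs0 & forall Qs,
  uniq Qs -> all mirr Qs -> {subset Qs0 <= Qs} ->
  (forall Q, mirr Q -> Q \notin Qs -> vord Q a = 0) /\
  \sum_(Q <- Qs) (pdeg Q)%:Z * vord Q a + vinf a = 0.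
Proof.
move=> /fracP0[f [g [f0 g0 ->]]]; exists (primes_of f ++ primes_of g).
  by apply/allP => Q; rewrite mem_cat !mem_primes_of // => /orP[]/andP[].
move=> Qs uQ mQs sub.
have sf : {subset primes_of f <= Qs}.
  by move=> Q h; apply: sub; rewrite mem_cat h.
have sg : {subset primes_of g <= Qs}.
  by move=> Q h; apply: sub; rewrite mem_cat h orbT.
have vE Q : mirr Q -> vord Q (f%:F / g%:F) = (ord Q f)%:Z - (ord Q g)%:Z.
  move=> /mirrP[_ iQ].
  by rewrite (val_div (vord_valuation iQ)) ?tofrac_eq0 // !vord_poly.
split=> [Q mQ QQs|].
  have [_ iQ] := mirrP mQ.
  rewrite vE // !ord0 //; apply: contra QQs => h; [apply: sg|apply: sf];
  by rewrite mem_primes_of // mQ.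
rewrite (val_div (@vinf_valuation F)) ?tofrac_eq0 // !vinf_poly //.
rewrite big_seq (eq_bigr (fun Q => (pdeg Q * ord Q f)%:Z - (pdeg Q * ord Q g)%:Z)).
  rewrite -big_seq sumrB -!(big_morph Posz PoszD erefl) !sum_ord //; lia.
by move=> Q /(allP mQs) mQ; rewrite vE //; lia.
Qed.

End MonicIrreducible.

(** * Ostrowski's theorem for F(T) *)

Section Classification.
Variable F : finFieldType.
Local Notation K := {fraction {poly F}}.
Implicit Types (f g Q : {poly F}) (a : K).

Let F0 (h : {poly F}) : h != 0 -> h%:F != 0. Proof. by rewrite tofrac_eq0. Qed.

(** If v(T) < 0 the top term of a polynomial dominates and v is a multiple of [vinf]. Otherwise v is
    nonnegative on F[T], some monic irreducible Q has positive value, and by Bezout polynomials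
    prime to Q have value 0. *)
Lemma kval_classification (v : K -> int) : is_valuation v ->
  (forall c, c != 0 -> v (c%:P)%:F = 0) -> (exists2 a, a != 0 & v a != 0) ->
  exists i e, [/\ kidx i, 0 < e & forall a, a != 0 -> v a = e * kw i a].
Proof.
move=> vv vc [a0 a00 va0].
have X0 : 'X%:F != 0 :> K by rewrite F0 // polyX_eq0.
have ext (i : option {poly F}) e : kidx i ->
   (forall f, f != 0 -> v f%:F = e * kw i f%:F) -> forall a, a != 0 -> v a = e * kw i a.
  move=> ki h a /fracP0[f [g [f0 g0 ->]]]; have [wv _ _ _ _] := kplaceP ki.
  by rewrite (val_div vv) ?F0 // (val_div wv) ?F0 // !h // mulrBr.
have vge_c (c : F) : vge v (c%:P)%:F 0.
  have [->|c0] := eqVneq c 0; first by rewrite polyC0 tofrac0 vge_zero.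
  by rewrite /vge vc // lexx orbT.
have [vX|vX] := lerP 0 (v 'X%:F); last first.
  exists None, (- v 'X%:F); split=> //; first by lia.
  apply: ext => // f; elim/poly_ind: f => [|f c IH]; first by rewrite eqxx.
  have [->|f0] := eqVneq f 0.
    rewrite mul0r add0r polyC_eq0 => c0.
    by rewrite vc //= vinf_poly ?polyC_eq0 // /pdeg size_polyC c0; lia.
  move=> fc0; have vfX : v (f * 'X)%:F = (pdeg f).+1%:Z * v 'X%:F.
    rewrite tofracM (valM vv) ?F0 ?polyX_eq0 // IH //= vinf_poly //. by rewrite mulrNN mulrC intS mulrDl mul1r addrC.
  have fX0 : f * 'X != 0 by rewrite mulf_neq0 ?polyX_eq0.
  have [_ E] : (f * 'X)%:F + (c%:P)%:F != 0 /\ v ((f * 'X)%:F + (c%:P)%:F) = v (f * 'X)%:F.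
    apply: (val_addr vv); first exact: F0.
    apply: vge_le (vge_c c); rewrite vfX; nia.
  rewrite /= vinf_poly // tofracD E vfX /pdeg size_MXaddC (negbTE f0) /=.
  by rewrite /pdeg prednK ?size_poly_gt0 //; lia.
have vp f : vge v f%:F 0.
  elim/poly_ind: f => [|f c IH]; first by rewrite tofrac0 vge_zero.
  rewrite tofracD tofracM; apply: (vgeD vv) (vge_c c).
  by rewrite -[0]addr0; apply: (vgeM vv) => //; rewrite vgeE.
have [f f0 vf] : exists2 f, f != 0 & 0 < v f%:F.
  have [f [g [f0 g0 aE]]] := fracP0 a00.
  move: va0; rewrite aE (val_div vv) ?F0 // => h.
  have := vp f; have := vp g; rewrite !vgeE ?F0 // => hg hf.
  have [?|vf] := ltrP 0 (v f%:F); [by exists f|exists g => //].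
move: h hf hg vf; move: (v f%:F) (v g%:F) => u w; lia.
have [Q mQ vQ] : exists2 Q, mirr Q & 0 < v Q%:F.
  move: {2}(size f) (leqnn (size f)) f0 vf => n.
  elim: n f => [|n IH] f; first by rewrite size_poly_leq0 => ->.
  move=> sf f0 vf; have [f1|f1] := leqP (size f) 1.
    have /eqP/size_poly1P[c c0 fc] : size f = 1%N.
      by apply/eqP; rewrite eqn_leq f1 size_poly_gt0.
    by move: vf; rewrite fc vc.
  have [Q mQ /dvdpP[g fE]] := exists_mirr f1; have Q0 := mirr_neq0 mQ.
  have g0 : g != 0 by apply: contraNneq f0 => g0; rewrite fE g0 mul0r.
  have [vQ|vQ] := ltrP 0 (v Q%:F); first by exists Q.
  apply: (IH g) => //; last first.
    move: vf vQ; rewrite fE tofracM (valM vv) ?F0 //.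
    by move: (v g%:F) (v Q%:F) => u w; lia.
  have [_ [sQ _]] := mirrP mQ; rewrite -ltnS (leq_trans _ sf) // fE size_mul //.
  by move: sQ g0; rewrite -size_poly_gt0; move: (size g) (size Q) => u w; lia.
have [_ iQ] := mirrP mQ; have Q0 := mirr_neq0 mQ.
have v0 g : ~~ (Q %| g) -> v g%:F = 0.
  move=> Qg; have g0 : g != 0 by apply: contraNneq Qg => ->; rewrite dvdp0.
  have := vp g; rewrite vgeE ?F0 // => vg; apply/eqP; rewrite eq_le vg andbT leNgt.
  apply/negP => vg1.
  have : coprimep g Q by rewrite coprimep_sym irreducible_poly_coprime.
  move=> /Bezout_eq1_coprimepP[[u w] /= uw].
  have : vge v ((u * g)%:F + (w * Q)%:F) 1.
    rewrite !tofracM; apply: (vgeD vv); rewrite -[1]add0r; apply: (vgeM vv) => //;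
    by rewrite vgeE ?F0 //; lia.
  by rewrite -tofracD uw tofrac1 vgeE ?oner_neq0 // (val1 vv).
exists (Some Q), (v Q%:F); split=> //.
apply: ext => // g g0; have [h gE Qh] := ordP iQ g0.
have h0 : h != 0 by apply: contraNneq Qh => ->; rewrite dvdp0.
rewrite /= vord_poly // {1}gE tofracM tofracXn (valM vv) ?expf_neq0 ?F0 //.
by rewrite (valX vv) ?F0 // (v0 h) // addr0 mulrC.
Qed.

(** Two finite places are told apart by the value at Q, a finite one from oo by the sign of the
    value at T. *)
Lemma kval_unique i j e e' : kidx i -> kidx j -> 0 < e -> 0 < e' ->
  (forall a, a != 0 -> e * kw i a = e' * kw j a) -> i = j.
Proof.
have X0 : 'X%:F != 0 :> K by rewrite F0 // polyX_eq0.
wlog : i j e e' / (if i is None then true else if j is None then false else true).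
  case: i j => [Q|] [Q'|] W hi hj e0 e'0 h //; last exact: (W _ _ e e').
  - exact: (W _ _ e e').
  - by apply/esym; apply: (W _ _ e' e) => // a a0; rewrite h.
case: i => [Q|] => // h hi; case: j h => [Q'|] // _ hj e0 e'0 h.
  have := h _ (F0 (mirr_neq0 hi)); have [_ iQ] := mirrP hi; have [_ iQ'] := mirrP hj.
  rewrite /= !vord_poly ?mirr_neq0 // !ord_mirr // eqxx; case: eqVneq => [->//|_]; lia.
have := h _ X0; have [_ iQ'] := mirrP hj.
rewrite /= vord_poly ?polyX_eq0 // vinf_poly ?polyX_eq0 // /pdeg size_polyX; nia.
Qed.

End Classification.

(** * Places of L above a place of F(T) *)

Section Places.
Variables (F : finFieldType) (L : fieldExtType {fraction {poly F}}).
Local Notation K := {fraction {poly F}}.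
Implicit Types (p : place L) (x y : L) (a b c : K).

Lemma pval0 p : p 0 = 0. Proof. by case: p. Qed.

Lemma pval_valuation p : is_valuation p.
Proof. by case: p. Qed.

Lemma pval_const p (c : F) : c != 0 -> p (const L c) = 0.
Proof. by case: p => /= v _ _ _ h _; exact: h. Qed.

Lemma pval_surj p : exists2 x, x != 0 & p x = 1.
Proof. by case: p. Qed.

Lemma place_ext p p' : (forall x, x != 0 -> p x = p' x) -> p = p'.
Proof.
move=> h; have {h} : Defs.pval p = Defs.pval p'.
  by apply: funext => x; have [->|x0] := eqVneq x 0; [rewrite !pval0|exact: h].
case: p p' => v v1 v2 v3 v4 v5 [v' w1 w2 w3 w4 w5] /= vv'.
by subst v'; congr Place; exact: Prop_irrelevance.
Qed.

(** Both places are normalised: evaluation at elements of value 1 shows that e and e' divide each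
    other. *)
Lemma place_proportional p p' (e e' : int) : 0 < e -> 0 < e' ->
  (forall x, x != 0 -> e * p x = e' * p' x) -> p = p'.
Proof.
move=> e0 e'0 h; have [x x0 px] := pval_surj p; have [y y0 py] := pval_surj p'.
have hx := h x x0; have hy := h y y0; rewrite px py !mulr1 in hx hy.
have u0 : 0 < p' x by rewrite -(pmulr_rgt0 _ e'0) -hx.
have v0 : 0 < p y by rewrite -(pmulr_rgt0 _ e0) hy.
have ee : e = e' by move: e0 e'0 u0 v0 hx hy; move: (p' x) (p y) => u v; nia.
by apply: place_ext => z z0; apply: (mulfI (lt0r_neq0 e0)); rewrite {2}ee h.
Qed.

Lemma place_build (u : L -> int) : is_valuation u ->
  (forall c : F, c != 0 -> u (const L c) = 0) -> (exists2 x, x != 0 & u x = 1) ->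
  exists p, forall x, x != 0 -> p x = u x.
Proof.
move=> uu uc us; pose u' x := if x == 0 then 0 else u x.
have u'E x : x != 0 -> u' x = u x by rewrite /u' => /negbTE->.
have h1 : u' 0 = 0 by rewrite /u' eqxx.
have h2 x y : x != 0 -> y != 0 -> u' (x * y) = u' x + u' y.
  by move=> x0 y0; rewrite !u'E ?mulf_neq0 // uu.1.
have h3 x y : x != 0 -> y != 0 -> x + y != 0 ->
    Num.min (u' x) (u' y) <= u' (x + y).
  by move=> x0 y0 xy0; rewrite !u'E // uu.2.
have h4 (c : F) : c != 0 -> u' (const L c) = 0.
  move=> c0; rewrite u'E ?uc // /const scaler_eq0 oner_eq0 orbF.
  by rewrite tofrac_eq0 polyC_eq0.
have h5 : exists2 x, x != 0 & u' x = 1.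
  by case: us => x x0 ux; exists x; rewrite ?u'E.
by exists (Place h1 h2 h3 h4 h5).
Qed.

Lemma valuation_ringE p x : valuation_ring p x <-> vge p x 0.
Proof.
rewrite /valuation_ring /vge /=; split=> [[->|->]|/orP[/eqP|]]; rewrite ?eqxx ?orbT //; by [left|right].
Qed.

Lemma maximal_idealE p x : maximal_ideal p x <-> vge p x 1.
Proof.
rewrite /maximal_ideal /vge /=; split=> [[->|]|/orP[/eqP|]]; rewrite ?eqxx ?orbT //; by [left|rewrite gtz0_ge1 => ->; rewrite orbT|right].
Qed.

(** [xget] may choose any length, so two residue bases must be shown equally long: passing from one
    set of coordinates to the other is injective, and the coordinate vectors are counted. *)
Lemma place_degreeE p n (e : 'I_n -> L) : residue_basis p e -> place_degree p = n.
Proof.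
move=> he; rewrite /place_degree.
have le m k (f : 'I_m -> L) (g : 'I_k -> L) : residue_basis p f ->
    residue_basis p g -> (m <= k)%N.
  move=> [fi fu] [gi gu].
  have vs m' (h : 'I_m' -> L) (c : {ffun 'I_m' -> F}) :
      (forall i, valuation_ring p (h i)) ->
      vge p (\sum_(i < m') const L (c i) * h i) 0.
    move=> hi; apply: (vge_sum (pval_valuation p)) => i _.
    rewrite -[0]addr0; apply: (vgeM (pval_valuation p)); last exact/valuation_ringE.
    have [c0|c0] := eqVneq (c i) 0.
      by rewrite c0 /const polyC0 tofrac0 scale0r vge_zero.
    by rewrite /vge pval_const // lexx orbT.
  have ex (c : {ffun 'I_m -> F}) : exists c' : {ffun 'I_k -> F},
      vge p (\sum_(i < m) const L (c i) * f i - \sum_(i < k) const L (c' i) * g i) 1.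
    have := vs m f c fi; move/valuation_ringE/gu => [c' [h _]].
    by exists c'; apply/maximal_idealE.
  have {ex}[/= phi phiP] := choice ex.
  have phi_inj : injective phi.
    move=> c c' cc'.
    have /valuation_ringE/fu[c0 [_ c0u]] := vs m f c fi.
    rewrite -(c0u c); last by rewrite subrr; left.
    apply: c0u; apply/maximal_idealE.
    have := vgeB (pval_valuation p) (phiP c) (phiP c').
    by rewrite cc' opprB addrA subrK.
  have := leq_card phi phi_inj; rewrite !card_ffun !card_ord.
  by rewrite leq_exp2l // card_finNzRing_gt1.
case: xgetP => [m _ [f hf]|h]; last by case: (h n); exists e.
by apply/eqP; rewrite eqn_leq (le _ _ _ _ hf he) (le _ _ _ _ he hf).
Qed.

End Places.

(** * Arithmetic in a quadratic extension with basis 1, t *)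

Section Coordinates.
Variables (K : fieldType) (L : fieldExtType K) (t : L) (delta : K) (c1 c2 : L -> K).
Implicit Types (x y : L) (a b c : K).
Hypothesis t_sqr : t ^+ 2 = delta%:A.
Hypothesis coordE : forall x, x = (c1 x)%:A + c2 x *: t.
Hypothesis delta_nsq : forall a, a ^+ 2 != delta.

Lemma algA_inj : injective (fun a => a%:A : L).
Proof. by move=> a b /= /eqP; rewrite -subr_eq0 -scalerBl scaler_eq0 oner_eq0 orbF subr_eq0 => /eqP. Qed.

(** Distinct b and b' would put t in K and make [delta] a square. *)
Lemma coord_uniq a b a' b' : a%:A + b *: t = a'%:A + b' *: t -> a = a' /\ b = b'.
Proof.
move=> h; have E : (a - a')%:A = (b' - b) *: t.
  by rewrite !scalerBl; apply/eqP; rewrite subr_eq addrAC [b' *: t + _]addrC -h addrK.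
have bb : b = b'.
  apply/eqP; rewrite eq_sym -subr_eq0; apply/negPn/negP => b0.
  have tE : t = ((b' - b)^-1 * (a - a'))%:A.
    by rewrite -scalerA E scalerA mulVf // scale1r.
  move: t_sqr; rewrite tE expr2 -scalerAl mul1r scalerA => /algA_inj h2.
  by have := delta_nsq ((b' - b)^-1 * (a - a')); rewrite -h2 eqxx.
split=> //; apply/eqP; move: E; rewrite bb subrr scale0r => /eqP.
by rewrite scaler_eq0 oner_eq0 orbF subr_eq0.
Qed.

Lemma coord1E a b : c1 (a%:A + b *: t) = a.
Proof. by case: (coord_uniq (esym (coordE (a%:A + b *: t)))). Qed.
Lemma coord2E a b : c2 (a%:A + b *: t) = b.
Proof. by case: (coord_uniq (esym (coordE (a%:A + b *: t)))). Qed.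

Lemma mul_coord a b a' b' : (a%:A + b *: t) * (a'%:A + b' *: t) =
  (a * a' + delta * (b * b'))%:A + (a * b' + b * a') *: t.
Proof.
have e1 : a%:A * a'%:A = (a * a')%:A :> L by rewrite -scalerAl mul1r scalerA.
have e2 : a%:A * (b' *: t) = (a * b') *: t by rewrite -scalerAl mul1r scalerA.
have e3 : (b *: t) * a'%:A = (b * a') *: t.
  by rewrite -scalerAl -scalerAr mulr1 scalerA.
have e4 : (b *: t) * (b' *: t) = (delta * (b * b'))%:A.
  by rewrite -scalerAl -scalerAr -expr2 t_sqr !scalerA mulrC mulrA.
by rewrite mulrDl !mulrDr e1 e2 e3 e4 !scalerDl [X in _ + X = _]addrC addrACA.
Qed.

Lemma coord1M x y : c1 (x * y) = c1 x * c1 y + delta * (c2 x * c2 y).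
Proof. by rewrite {1}(coordE x) {1}(coordE y) mul_coord coord1E. Qed.
Lemma coord2M x y : c2 (x * y) = c1 x * c2 y + c2 x * c1 y.
Proof. by rewrite {1}(coordE x) {1}(coordE y) mul_coord coord2E. Qed.
Lemma coord1D x y : c1 (x + y) = c1 x + c1 y.
Proof. by rewrite {1}(coordE x) {1}(coordE y) addrACA -!scalerDl coord1E. Qed.
Lemma coord2D x y : c2 (x + y) = c2 x + c2 y.
Proof. by rewrite {1}(coordE x) {1}(coordE y) addrACA -!scalerDl coord2E. Qed.
Lemma coord1A a : c1 a%:A = a.
Proof. by rewrite -[a%:A]addr0 -(scale0r t) coord1E. Qed.
Lemma coord2A a : c2 a%:A = 0.
Proof. by rewrite -[a%:A]addr0 -(scale0r t) coord2E. Qed.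

Lemma coord_eq0 x : (x == 0) = (c1 x == 0) && (c2 x == 0).
Proof.
apply/eqP/andP => [->|[/eqP h1 /eqP h2]]; last by rewrite (coordE x) h1 h2 !scale0r addr0.
by rewrite -(scale0r 1) coord1A coord2A eqxx.
Qed.

Definition qnorm x := c1 x ^+ 2 - delta * c2 x ^+ 2.

Lemma qnormM x y : qnorm (x * y) = qnorm x * qnorm y.
Proof. by rewrite /qnorm coord1M coord2M; ring. Qed.

Lemma qform_eq0 a b : (a ^+ 2 - delta * b ^+ 2 == 0) = (a == 0) && (b == 0).
Proof.
apply/idP/andP => [|[/eqP-> /eqP->]]; last by rewrite !expr0n mulr0 subrr.
rewrite subr_eq0 => /eqP h; have [b0|b0] := eqVneq b 0.
  by move: h; rewrite b0 expr0n mulr0 => /eqP; rewrite expf_eq0.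
have /negP[] := delta_nsq (a / b).
by rewrite expr_div_n h mulfK // expf_neq0.
Qed.

Lemma qnorm_eq0 x : (qnorm x == 0) = (x == 0).
Proof. by rewrite coord_eq0 qform_eq0. Qed.

Lemma qnormA a : qnorm a%:A = a ^+ 2.
Proof. by rewrite /qnorm coord1A coord2A expr0n mulr0 subr0. Qed.

Definition qconj x : L := (c1 x)%:A - c2 x *: t.

Lemma mul_qconj x : x * qconj x = (qnorm x)%:A.
Proof.
rewrite {1}(coordE x) /qconj -scaleNr mul_coord /qnorm.
rewrite (_ : c1 x * - c2 x + c2 x * c1 x = 0); last by ring.
by rewrite scale0r addr0; congr (_ *: _); ring.
Qed.

End Coordinates.

(** * Valuations above a place that does not split *)

Section Restriction.
Variables (K : fieldType) (L : fieldExtType K) (w : K -> int) (p : L -> int).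
Hypothesis wv : is_valuation w.

Lemma vge_sqr (a : K) m : vge w (a ^+ 2) m = vge w a ((m + 1) %/ 2)%Z.
Proof.
rewrite /vge expf_eq0 /=; have [//|a0] := eqVneq a 0.
by rewrite (valX wv) //; move: (w a) => u /=; lia.
Qed.

Hypothesis pv : is_valuation p.
Variable e : int.
Hypothesis e0 : 0 < e.
Hypothesis pw : forall a : K, a != 0 -> p a%:A = e * w a.
Implicit Types (x y : L) (a b c : K).

Lemma algA_eq0 a : (a%:A == 0 :> L) = (a == 0).
Proof. by rewrite scaler_eq0 oner_eq0 orbF. Qed.

Lemma vge_restrict a m : vge w a m -> vge p a%:A (e * m).
Proof.
have [->|a0] := eqVneq a 0; first by rewrite scale0r !vge_zero.
by rewrite !vgeE ?algA_eq0 // pw // ler_pM2l.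
Qed.

Lemma vge_restrict0 a : vge p a%:A 0 = vge w a 0.
Proof.
have [->|a0] := eqVneq a 0; first by rewrite scale0r !vge_zero.
by rewrite !vgeE ?algA_eq0 // pw // pmulr_rge0.
Qed.

Lemma vge_restrict1 a : vge p a%:A 1 = vge w a 1.
Proof.
have [->|a0] := eqVneq a 0; first by rewrite scale0r !vge_zero.
by rewrite !vgeE ?algA_eq0 // pw // -!gtz0_ge1 pmulr_rgt0.
Qed.

Variables (t : L) (delta : K) (c1 c2 : L -> K).
Hypothesis t_sqr : t ^+ 2 = delta%:A.
Hypothesis coordE : forall x, x = (c1 x)%:A + c2 x *: t.
Hypothesis delta_nsq : forall a, a ^+ 2 != delta.
Local Notation nrm := (qnorm delta c1 c2).

Lemma delta_neq0 : delta != 0.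
Proof. by have := delta_nsq 0; rewrite expr0n eq_sym. Qed.

Lemma t_neq0 : t != 0.
Proof.
apply/eqP => t0; move: t_sqr; rewrite t0 expr0n /= => /esym/eqP.
by rewrite algA_eq0; apply/negP; exact: delta_neq0.
Qed.

(* This holds exactly when w does not split, and makes w (nrm x) a valuation. *)
Hypothesis aniso : forall a b m, vge w (a ^+ 2 - delta * b ^+ 2) m ->
  vge w (a ^+ 2) m && vge w (delta * b ^+ 2) m.

Lemma nrm_valuation : is_valuation (fun x => w (nrm x)).
Proof.
split=> [x y x0 y0|x y x0 y0 xy0]; first by rewrite (qnormM t_sqr coordE delta_nsq) (valM wv) ?(qnorm_eq0 t_sqr coordE delta_nsq).
set m := Num.min _ _; rewrite -(vgeE w) ?(qnorm_eq0 t_sqr coordE delta_nsq) //.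
have [hx hy] : vge w (nrm x) m /\ vge w (nrm y) m.
  by rewrite !vgeE ?(qnorm_eq0 t_sqr coordE delta_nsq) // /m !ge_min !lexx orbT.
move: m hx hy => m hx hy.
have /andP[a1 b1] := aniso hx; have /andP[a2 b2] := aniso hy.
rewrite /qnorm (coord1D t_sqr coordE delta_nsq) (coord2D t_sqr coordE delta_nsq).
apply: (vgeB wv).
  by move: a1 a2; rewrite !vge_sqr; exact: (vgeD wv).
move: b1 b2; rewrite !(mulrC delta) => b1 b2.
have dl a : vge w (a * delta) m = vge w a (m - w delta).
  rewrite /vge mulf_eq0 (negbTE delta_neq0) orbF; have [//|a0] := eqVneq a 0.
  by rewrite (valM wv) ?delta_neq0 //= lerBlDr.
by move: b1 b2; rewrite !dl !vge_sqr; exact: (vgeD wv).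
Qed.

(* x and its conjugate both have valuation >= e w (nrm x) / 2, hence equality *)
Lemma aniso_place x : x != 0 -> 2 * p x = e * w (nrm x).
Proof.
move=> x0; have d0 := delta_neq0.
have nx0 : nrm x != 0 by rewrite (qnorm_eq0 t_sqr coordE delta_nsq).
pose m := w (nrm x); have /andP[h1 h2] : vge w (c1 x ^+ 2) m && vge w (delta * c2 x ^+ 2) m.
  by apply: aniso; exact: vge_val.
have p1 : vge p (c1 x)%:A ((e * m + 1) %/ 2)%Z.
  have [->|a0] := eqVneq (c1 x) 0; first by rewrite scale0r vge_zero.
  move: h1; rewrite vgeE ?expf_neq0 // (valX wv) // vgeE ?algA_eq0 // pw //.
  move: (w (c1 x)) => u hu; have : e * m <= 2 * (e * u) by rewrite mulrCA ler_pM2l.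
  by clear; move: (e * m) (e * u) => k l; lia.
have t0 := t_neq0.
have p2 : vge p (c2 x *: t) ((e * m + 1) %/ 2)%Z.
  have [->|b0] := eqVneq (c2 x) 0; first by rewrite scale0r vge_zero.
  have bt0 : c2 x *: t != 0 by rewrite scaler_eq0 (negbTE b0).
  have db0 : delta * c2 x ^+ 2 != 0 by rewrite mulf_neq0 ?expf_neq0.
  have E : 2 * p (c2 x *: t) = e * w (delta * c2 x ^+ 2).
    rewrite -pw // -(valX pv) //; congr (p _).
    by rewrite exprZn t_sqr scalerA mulrC.
  move: h2; rewrite vgeE // => h2.
  have : e * m <= e * w (delta * c2 x ^+ 2) by rewrite ler_pM2l.
  by rewrite -E vgeE //; move: (p _) => u; lia.
have hx : vge p x ((e * m + 1) %/ 2)%Z by rewrite (coordE x) (vgeD pv).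
have hy : vge p (qconj t c1 c2 x) ((e * m + 1) %/ 2)%Z by rewrite /qconj (vgeB pv).
have xy := mul_qconj t_sqr coordE x.
have y0 : qconj t c1 c2 x != 0.
  by apply: contraNneq nx0 => y0; rewrite -algA_eq0 -xy y0 mulr0.
have := congr1 (p : L -> int) xy; rewrite (valM pv) // pw //.
rewrite !vgeE // in hx hy; rewrite -/m.
by move: (p x) (p _) (e * m) hx hy => u v k; lia.
Qed.

(** With w(delta) equal to 0 or 1, w(delta b^2) >= 0 is equivalent to w(b) >= 0, so 1, t is an
    integral basis. *)
Lemma aniso_integral x : (w delta = 0 \/ w delta = 1) -> vge p x 0 <-> vge w (c1 x) 0 /\ vge w (c2 x) 0.
Proof.
move=> hd; have d0 := delta_neq0.
have -> : vge p x 0 = vge w (nrm x) 0.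
  rewrite /vge (qnorm_eq0 t_sqr coordE delta_nsq); have [//|x0] := eqVneq x 0.
  have := aniso_place x0; move: (p x) (w _) => u v /=; nia.
have dl a : vge w (delta * a ^+ 2) 0 = vge w a 0.
  rewrite /vge mulf_eq0 (negbTE delta_neq0) expf_eq0 /=; have [//|a0] := eqVneq a 0.
  rewrite (valM wv) ?expf_neq0 // (valX wv) //=.
  by move: (w a) (w delta) hd => u v; lia.
split=> [/aniso/andP[]|[h1 h2]]; first by rewrite dl vge_sqr.
by apply: (vgeB wv); rewrite ?dl // vge_sqr.
Qed.

Lemma coord_scale_t b : c1 (b *: t) = 0 /\ c2 (b *: t) = b.
Proof.
have E : b *: t = 0%:A + b *: t by rewrite scale0r add0r.
by rewrite E (coord1E t_sqr coordE delta_nsq) (coord2E t_sqr coordE delta_nsq).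
Qed.

Lemma qnorm_scale_t b : nrm (b *: t) = - (delta * b ^+ 2).
Proof. by rewrite /qnorm; have [-> ->] := coord_scale_t b; rewrite expr0n sub0r. Qed.

(** Here t lies in the maximal ideal, so the residue field is that of w. *)
Lemma aniso_ramified_residue x : w delta = 1 -> vge w (c2 x) 0 ->
  vge p (x - (c1 x)%:A) 1.
Proof.
move=> d1; have -> : x - (c1 x)%:A = c2 x *: t.
  by rewrite {1}(coordE x) addrAC subrr add0r.
have [->|b0] := eqVneq (c2 x) 0; first by rewrite scale0r !vge_zero.
have bt0 : c2 x *: t != 0 by rewrite scaler_eq0 negb_or b0 t_neq0.
have := aniso_place bt0; rewrite qnorm_scale_t (valN wv).
rewrite (valM wv) ?delta_neq0 ?expf_neq0 // (valX wv) // d1 !vgeE //.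
move: (w _) (p _) => u v h hu; have : 0 < 2 * v by rewrite h pmulr_rgt0 //; lia.
by lia.
Qed.

Lemma aniso_inert_vge x m : e = 1 -> w delta = 0 ->
  vge p x m <-> vge w (c1 x) m /\ vge w (c2 x) m.
Proof.
move=> e1 d0; have dn := delta_neq0.
have pE : vge p x m = vge w (nrm x) (m + m).
  rewrite /vge (qnorm_eq0 t_sqr coordE delta_nsq); have [//|x0] := eqVneq x 0.
  by have := aniso_place x0; rewrite e1; move: (p x) (w _) => u v /=; lia.
have sq a : vge w (a ^+ 2) (m + m) = vge w a m.
  by rewrite vge_sqr; congr vge; lia.
have dl a : vge w (delta * a ^+ 2) (m + m) = vge w a m.
  by rewrite (vgeMl wv) ?sq.
rewrite pE; split=> [/aniso/andP[]|[h1 h2]]; first by rewrite dl sq.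
by apply: (vgeB wv); rewrite ?dl // sq.
Qed.

(** By anisotropy the norm takes the smaller of the even values of its two terms. This allows the
    norm valuation to be halved at an inert place. *)
Lemma qnorm_even x : w delta = 0 -> x != 0 -> exists k, w (nrm x) = 2 * k.
Proof.
move=> d0 x0; have dn := delta_neq0.
have nx0 : nrm x != 0 by rewrite (qnorm_eq0 t_sqr coordE delta_nsq).
have /aniso/andP[] := vge_val w (nrm x).
rewrite (vgeMl wv) //.
have [a0|a0] := eqVneq (c1 x) 0.
  by exists (w (c2 x)); rewrite /qnorm a0 expr0n sub0r (valN wv) (valM wv) ?d0 ?add0r ?(valX wv) //;
  [|rewrite expf_neq0 //]; apply: contraNneq nx0 => b0; rewrite /qnorm a0 b0 !expr0n mulr0 subrr.
have [b0|b0] := eqVneq (c2 x) 0.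
  by exists (w (c1 x)); rewrite /qnorm b0 expr0n mulr0 subr0 (valX wv).
have f1 : c1 x ^+ 2 != 0 by rewrite expf_neq0.
have f2 : - (delta * c2 x ^+ 2) != 0 by rewrite oppr_eq0 mulf_neq0 ?expf_neq0.
have := wv.2 _ _ f1 f2 nx0; rewrite -/(nrm x).
rewrite (valN wv) (valM wv) ?expf_neq0 // d0 !vgeE ?expf_neq0 // !(valX wv) // ge_min.
move: (w (nrm x)) (w (c1 x)) (w (c2 x)) => k u v h1 h2 h3.
have [h|h] := lerP (2 * u) k; [exists u|exists v]; lia.
Qed.

End Restriction.

Definition decomposition (F : finFieldType) (L : fieldExtType {fraction {poly F}})
    (l : seq (place L)) (n : nat) (eps : int) : Prop :=
  [\/ eps = 1 /\ exists p1 p2, [/\ l = [:: p1; p2], place_degree p1 = n & place_degree p2 = n],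
      eps = 0 /\ exists p1, l = [:: p1] /\ place_degree p1 = n
    | eps = -1 /\ exists p1, l = [:: p1] /\ place_degree p1 = (2 * n)%N].

Section Above.
Variables (F : finFieldType) (L : fieldExtType {fraction {poly F}}).
Local Notation K := {fraction {poly F}}.
Implicit Types (p : place L) (x y : L) (a b c : K).
Variables (t : L) (delta : K) (c1 c2 : L -> K).
Hypothesis t_sqr : t ^+ 2 = delta%:A.
Hypothesis coordE : forall x, x = (c1 x)%:A + c2 x *: t.
Hypothesis delta_nsq : forall a, a ^+ 2 != delta.
Variables (w : K -> int) (n : nat).
Hypothesis w_kplace : is_kplace w n.
Local Notation nrm := (qnorm delta c1 c2).

Let wv : is_valuation w. Proof. by case: w_kplace. Qed.
Let A0 a : (a%:A == 0 :> L) = (a == 0). Proof. by rewrite scaler_eq0 oner_eq0 orbF. Qed.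

Let c1A := coord1A t_sqr coordE delta_nsq.
Let c2A := coord2A t_sqr coordE delta_nsq.
Let c1E := coord1E t_sqr coordE delta_nsq.
Let c2E := coord2E t_sqr coordE delta_nsq.

(* The list l consists of the places above w; eps is 1, 0 or -1 according to
   whether w is split, ramified or inert in L. *)
Definition places_above (l : seq (place L)) (eps : int) : Prop :=
  [/\ uniq l,
      forall p, p \in l <-> exists2 e : int, 0 < e & forall a, a != 0 -> p a%:A = e * w a,
      forall x, x != 0 -> \sum_(p <- l) (place_degree p)%:Z * p x = n%:Z * w (nrm x),
      forall x, (forall p, p \in l -> vge p x 0) <-> vge w (c1 x) 0 /\ vge w (c2 x) 0
    & decomposition l n eps].

Lemma w_poly (s : {poly F}) : (size s <= n)%N -> s != 0 -> w s%:F = 0.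
Proof. by case: w_kplace => _ _ _ h _; exact: h. Qed.

Lemma poly_rep_uniq (r s : {poly F}) : (size r <= n)%N -> (size s <= n)%N ->
  vge w (r%:F - s%:F) 1 -> r = s.
Proof.
move=> sr ss h; apply/eqP; rewrite -subr_eq0; apply/negPn/negP => rs0.
have : (size (r - s)%R <= n)%N.
  by rewrite (leq_trans (size_polyD _ _)) // size_polyN geq_max sr.
move/w_poly => /(_ rs0) w0; move: h.
by rewrite -tofracB vgeE ?tofrac_eq0 // w0.
Qed.

Definition poly_of_ffun m (c : {ffun 'I_m -> F}) : {poly F} := \sum_(i < m) c i *: 'X^i.

Lemma size_poly_of_ffun m (c : {ffun 'I_m -> F}) : (size (poly_of_ffun c) <= m)%N.
Proof.
rewrite /poly_of_ffun; apply: leq_trans (size_sum _ _ _) _.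
by apply/bigmax_leqP => i _; rewrite (leq_trans (size_scale_leq _ _)) // size_polyXn ltn_ord.
Qed.

Lemma coef_poly_of_ffun m (c : {ffun 'I_m -> F}) (i : 'I_m) : (poly_of_ffun c)`_i = c i.
Proof.
rewrite /poly_of_ffun coef_sum (bigD1 i) //= coefZ coefXn eqxx mulr1 big1 ?addr0 //.
by move=> j ji; rewrite coefZ coefXn eq_sym (negbTE (ji : (j : nat) != i)) mulr0.
Qed.

Lemma poly_of_ffun_inj m : injective (@poly_of_ffun m).
Proof. by move=> c c' h; apply/ffunP => i; rewrite -!coef_poly_of_ffun h. Qed.

Lemma poly_of_ffun_surj m (s : {poly F}) : (size s <= m)%N -> exists c : {ffun 'I_m -> F}, s = poly_of_ffun c.
Proof.
move=> sm; exists [ffun i : 'I_m => s`_i]; apply/polyP => j.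
have [jm|jm] := ltnP j m; first by rewrite (coef_poly_of_ffun _ (Ordinal jm)) ffunE.
by rewrite !nth_default ?(leq_trans sm) // (leq_trans (size_poly_of_ffun _)).
Qed.

Lemma poly_of_ffunA m (c : {ffun 'I_m -> F}) y :
  \sum_(i < m) const L (c i) * (('X^i)%:F%:A * y) = (poly_of_ffun c)%:F%:A * y.
Proof.
rewrite /poly_of_ffun rmorph_sum scaler_suml mulr_suml; apply: eq_bigr => i _.
by rewrite -mul_polyC rmorphM /= mulrA /const -!scalerAl !mul1r -!scalerAl !mul1r scalerA.
Qed.

(** The last hypothesis says that the residue field does not grow, so 1, T, ..., T^(n-1) still
    represent a basis. *)
Lemma degree_residue_K p (e : int) : 0 < e -> (forall a, a != 0 -> p a%:A = e * w a) ->
  (forall x, vge p x 0 -> exists2 a, vge w a 0 & vge p (x - a%:A) 1) -> place_degree p = n.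
Proof.
move=> e0 h hx; apply: (@place_degreeE _ _ _ _ (fun i : 'I_n => ('X^i)%:F%:A)).
have pv := pval_valuation p.
have sE (c : {ffun 'I_n -> F}) :
    \sum_(i < n) const L (c i) * ('X^i)%:F%:A = (poly_of_ffun c)%:F%:A.
  rewrite -[RHS]mulr1 -poly_of_ffunA; apply: eq_bigr => i _.
  by rewrite mulr1.
split=> [i|x /valuation_ringE/hx[a a0 xa]].
  apply/valuation_ringE; rewrite vgeE ?A0 ?tofrac_eq0 -?size_poly_gt0 ?size_polyXn // h.
    by rewrite w_poly ?mulr0 // ?size_polyXn // -size_poly_gt0 size_polyXn.
  by rewrite tofrac_eq0 -size_poly_gt0 size_polyXn.
have [_ _ _ _ /(_ a a0)[s ss as1]] := w_kplace.
have xs : vge p (x - s%:F%:A) 1.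
  by rewrite -[x](subrK a%:A) -addrA -scalerBl (vgeD pv) // (vge_restrict1 e0 h).
have [c sc] := poly_of_ffun_surj ss.
exists c; split=> [|c' /maximal_idealE]; first by apply/maximal_idealE; rewrite sE -sc.
rewrite sE => h2; apply: poly_of_ffun_inj; rewrite -sc.
apply: poly_rep_uniq => //; first exact: size_poly_of_ffun.
rewrite -(vge_restrict1 e0 h) scalerBl.
have -> : s%:F%:A - (poly_of_ffun c')%:F%:A = (x - (poly_of_ffun c')%:F%:A) - (x - s%:F%:A).
  by rewrite opprB [RHS]addrC addrA subrK.
exact: (vgeB pv).
Qed.

Hypothesis aniso : forall a b m, vge w (a ^+ 2 - delta * b ^+ 2) m ->
  vge w (a ^+ 2) m && vge w (delta * b ^+ 2) m.

(** The equation between m, e0 and n is the identity e f = 2, with f = m / n. No other place lies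
    above w, since [aniso_place] makes each of them proportional to the norm valuation. *)
Lemma above_aniso p (e0 : int) m eps : 0 < e0 -> (forall a, a != 0 -> p a%:A = e0 * w a) ->
  (w delta = 0 \/ w delta = 1) -> place_degree p = m -> m%:Z * e0 = 2 * n%:Z ->
  (eps = 0 /\ m = n) \/ (eps = -1 /\ m = (2 * n)%N) -> places_above [:: p] eps.
Proof.
move=> e0p hpA dd dp me0 hm.
have pl x : x != 0 -> 2 * p x = e0 * w (nrm x).
  exact: (aniso_place wv (pval_valuation p) e0p hpA t_sqr coordE delta_nsq aniso).
have int x := aniso_integral wv (pval_valuation p) e0p hpA t_sqr coordE delta_nsq aniso x dd.
split=> //.
- move=> p'; rewrite inE; split=> [/eqP->|[e ep he]]; first by exists e0.
  apply/eqP/esym; apply: (@place_proportional _ _ p p' e e0) => // x x0.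
  have := aniso_place wv (pval_valuation p') ep he t_sqr coordE delta_nsq aniso x0.
  by have := pl x x0; move: (p x) (p' x) (w _) => u v k; nia.
- move=> x x0; rewrite big_seq1 dp.
  by have := pl x x0; move: (p x) (w _) => u v; nia.
- move=> x; rewrite -int.
  by split=> [h|h p']; [apply: h; rewrite inE|rewrite inE => /eqP->].
case: hm => -[-> mE]; [apply: Or32|apply: Or33]; split=> //; exists p; by rewrite dp mE.
Qed.

Lemma const_algA (c : F) : const L c = (c%:P)%:F%:A. Proof. by []. Qed.

Lemma w_const (c : F) : c != 0 -> (c%:P)%:F != 0 :> K /\ w (c%:P)%:F = 0.
Proof.
move=> c0; rewrite tofrac_eq0 polyC_eq0; split=> //.
by rewrite w_poly ?polyC_eq0 // size_polyC c0; case: w_kplace.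
Qed.

(** The place is w of the norm, already normalised because t has norm -delta. *)
Lemma above_ramified : w delta = 1 -> exists l, places_above l 0.
Proof.
move=> d1; have [p hp] : exists p, forall x, x != 0 -> p x = w (nrm x).
  apply: place_build.
  - exact: (nrm_valuation wv t_sqr coordE delta_nsq aniso).
  - move=> c c0; have [cn0 wc] := w_const c0.
    by rewrite const_algA (qnormA t_sqr coordE delta_nsq) (valX wv) ?cn0 // wc mulr0.
  exists t; first exact: (t_neq0 t_sqr delta_nsq).
  rewrite -[t]scale1r (qnorm_scale_t t_sqr coordE delta_nsq).
  by rewrite expr1n mulr1 (valN wv).
have hpA a : a != 0 -> p a%:A = 2 * w a.
  by move=> a0; rewrite hp ?algA_eq0 // (qnormA t_sqr coordE delta_nsq) (valX wv).
have e2 : 0 < 2 :> int by [].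
have dp : place_degree p = n.
  apply: (degree_residue_K e2 hpA) => x hx.
  have [h1 h2] := iffLR (aniso_integral wv (pval_valuation p) e2 hpA t_sqr coordE delta_nsq aniso x (or_intror d1)) hx.
  exists (c1 x) => //.
  exact: (aniso_ramified_residue wv (pval_valuation p) e2 hpA t_sqr coordE delta_nsq aniso).
exists [:: p]; apply: (above_aniso e2 hpA) dp _ _; [by right| |by left].
by rewrite mulrC.
Qed.

(** The place is half of w of the norm. Integrality and congruence are read off coordinate by
    coordinate, so the T^i and the T^i t with i < n represent a residue basis. *)
Lemma above_inert : w delta = 0 -> exists l, places_above l (-1).
Proof.
move=> d0.
have [p hp] : exists p, forall x, x != 0 -> 2 * p x = w (nrm x).
  pose u x := (w (nrm x) %/ 2)%Z.
  have uE x : x != 0 -> 2 * u x = w (nrm x).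
    move=> x0; have [k] := qnorm_even wv ltr01 t_sqr coordE delta_nsq aniso d0 x0.
    by rewrite /u => ->; lia.
  have [vM vD] := nrm_valuation wv t_sqr coordE delta_nsq aniso.
  suff [p hp] : exists p, forall x, x != 0 -> p x = u x.
    by exists p => x x0; rewrite hp // uE.
  apply: place_build.
  - split=> x y x0 y0.
      have := vM x y x0 y0; rewrite -!uE ?mulf_neq0 //.
      by move: (u _) (u x) (u y) => a b c; lia.
    move=> xy0; have := vD x y x0 y0 xy0; rewrite -!uE // !ge_min.
    by move: (u _) (u x) (u y) => a b c; lia.
  - move=> c c0; have [cn0 wc] := w_const c0.
    have h : 2 * u (const L c) = 0.
      by rewrite uE ?const_algA ?algA_eq0 ?cn0 // (qnormA t_sqr coordE delta_nsq) (valX wv) ?cn0 // wc mulr0.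
    by move: h; move: (u _) => a; lia.
  have [_ _ [a a0 wa] _ _] := w_kplace.
  exists a%:A; first by rewrite algA_eq0.
  have h : 2 * u a%:A = 2.
    by rewrite uE ?algA_eq0 // (qnormA t_sqr coordE delta_nsq) (valX wv) // wa.
  by move: h; move: (u _) => k; lia.
have hpA a : a != 0 -> p a%:A = 1 * w a.
  move=> a0; have := hp a%:A; rewrite algA_eq0 (qnormA t_sqr coordE delta_nsq) => /(_ a0).
  by rewrite (valX wv) //; move: (p _) (w a) => u v; lia.
have vge2 x m := aniso_inert_vge wv (pval_valuation p) (ltr01) hpA t_sqr coordE delta_nsq aniso x m erefl d0.
have pv := pval_valuation p.
pose e (i : 'I_(n + n)) : L :=
  match fintype.split i with inl j => ('X^j)%:F%:A | inr j => ('X^j)%:F *: t end.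
pose f1 (c : {ffun 'I_(n + n) -> F}) := [ffun j => c (lshift n j)].
pose f2 (c : {ffun 'I_(n + n) -> F}) := [ffun j => c (rshift n j)].
have sE (c : {ffun 'I_(n + n) -> F}) : \sum_(i < n + n) const L (c i) * e i =
    (poly_of_ffun (f1 c))%:F%:A + (poly_of_ffun (f2 c))%:F *: t.
  rewrite big_split_ord; congr (_ + _).
    rewrite -[RHS]mulr1 -poly_of_ffunA; apply: eq_bigr => i _.
    by rewrite /e -/(unsplit (inl i)) unsplitK ffunE mulr1.
  rewrite -[t]mul1r scalerAl -poly_of_ffunA; apply: eq_bigr => i _.
  rewrite /e -/(unsplit (inr i)) unsplitK ffunE; congr (_ * _).
  by rewrite -scalerAl mul1r.
have dp : place_degree p = (n + n)%N.
  apply: (@place_degreeE _ _ _ _ e); split=> [i|x /valuation_ringE/vge2[a0 b0]].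
    apply/valuation_ringE/vge2; rewrite /e.
    have wX j : (j < n)%N -> vge w ('X^j)%:F 0.
      move=> jn; rewrite /vge w_poly ?size_polyXn ?lexx ?orbT //.
      by rewrite -size_poly_gt0 size_polyXn.
    case: (fintype.split i) => j.
      by rewrite c1A c2A vge_zero wX.
    by have [-> ->] := coord_scale_t t_sqr coordE delta_nsq ('X^j)%:F; rewrite vge_zero wX.
  have [_ _ _ _ res] := w_kplace.
  have [s1 ss1 as1] := res _ a0; have [s2 ss2 bs2] := res _ b0.
  have [f1' f1E] := poly_of_ffun_surj ss1; have [f2' f2E] := poly_of_ffun_surj ss2.
  have cong (c : {ffun 'I_(n + n) -> F}) : maximal_ideal p (x - \sum_(i < n + n) const L (c i) * e i) <->
      vge w (c1 x - (poly_of_ffun (f1 c))%:F) 1 /\ vge w (c2 x - (poly_of_ffun (f2 c))%:F) 1.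
    rewrite maximal_idealE sE vge2.
    have -> : x - ((poly_of_ffun (f1 c))%:F%:A + (poly_of_ffun (f2 c))%:F *: t) =
        (c1 x - (poly_of_ffun (f1 c))%:F)%:A + (c2 x - (poly_of_ffun (f2 c))%:F) *: t.
      by rewrite {1}(coordE x) opprD addrACA -!scalerBl.
    by rewrite c1E c2E.
  pose c0 : {ffun 'I_(n + n) -> F} := [ffun i => match fintype.split i with inl j => f1' j | inr j => f2' j end].
  have f10 : f1 c0 = f1'.
    by apply/ffunP => j; rewrite !ffunE -/(unsplit (inl j)) unsplitK.
  have f20 : f2 c0 = f2'.
    by apply/ffunP => j; rewrite !ffunE -/(unsplit (inr j)) unsplitK.
  exists c0; split=> [|c' /cong[h1 h2]]; first by apply/cong; rewrite f10 f20 -f1E -f2E.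
  have g1 : f1 c' = f1'.
    apply: poly_of_ffun_inj; rewrite -f1E.
    apply: poly_rep_uniq => //; first exact: size_poly_of_ffun.
    by have := vgeB wv as1 h1; rewrite opprB addrC addrA subrK -(vgeN wv) opprB.
  have g2 : f2 c' = f2'.
    apply: poly_of_ffun_inj; rewrite -f2E.
    apply: poly_rep_uniq => //; first exact: size_poly_of_ffun.
    by have := vgeB wv bs2 h2; rewrite opprB addrC addrA subrK -(vgeN wv) opprB.
  apply/ffunP => i; rewrite ffunE -[i]splitK; case: (fintype.split i) => j.
    by rewrite unsplitK -g1 ffunE.
  by rewrite unsplitK -g2 ffunE.
exists [:: p]; apply: (above_aniso ltr01 hpA) dp _ _; [by left| |by right; rewrite mul2n addnn].
by rewrite mulr1; lia.
Qed.

End Above.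

(** * Split places *)

Section SplitAbstract.
Variables (K : fieldType) (L : fieldExtType K) (w : K -> int).
Hypothesis wv : is_valuation w.
Implicit Types (x y : L) (a b c : K).

Lemma vge_large a (M : int) : exists k0 : nat, forall k z, (k0 <= k)%N ->
  vge w z k%:Z -> vge w (a * z) M.
Proof.
have [->|a0] := eqVneq a 0; first by exists 0%N => k z _ _; rewrite mul0r vge_zero.
exists `|M - w a|%N => k z hk hz.
apply: vge_le (vgeM wv (vge_val w a) hz).
by move: hk; move: (w a) => u; lia.
Qed.

Variables (t : L) (delta : K) (c1 c2 : L -> K).
Hypothesis t_sqr : t ^+ 2 = delta%:A.
Hypothesis coordE : forall x, x = (c1 x)%:A + c2 x *: t.
Hypothesis delta_nsq : forall a, a ^+ 2 != delta.
Hypothesis d0 : w delta = 0.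
Hypothesis two0 : (2 : K) != 0.
Hypothesis w2 : w 2 = 0.
Local Notation nrm := (qnorm delta c1 c2).
(* In the completion at w, beta converges to a square root of delta; the place is
   obtained as the eventual value of w (c1 x + c2 x * beta k). *)
Variable beta : nat -> K.
Hypothesis beta_sqr : forall k, vge w (beta k ^+ 2 - delta) k%:Z.
Hypothesis beta_cauchy : forall k l, (k <= l)%N -> vge w (beta l - beta k) k%:Z.

Lemma beta_unit k : (0 < k)%N -> beta k != 0 /\ w (beta k) = 0.
Proof.
move=> k0; have dn := delta_neq0 delta_nsq.
have h : vge w (beta k ^+ 2 - delta) (w delta + 1).
  by apply: vge_le (beta_sqr k); rewrite d0; lia.
have := val_mod wv dn (y := beta k ^+ 2); rewrite -(vgeN wv) opprB => /(_ h)[b0].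
rewrite expf_eq0 /= in b0; rewrite (valX wv) // d0 => wb.
by split=> //; move: wb; move: (w _) => u; lia.
Qed.

Definition ev k x := c1 x + c2 x * beta k.

Lemma ev_qnorm k x : ev k x * (c1 x - c2 x * beta k) =
  nrm x - c2 x ^+ 2 * (beta k ^+ 2 - delta).
Proof. by rewrite /ev /qnorm; ring. Qed.

(** The product with the conjugate evaluation approaches the nonzero norm, and the conjugate is
    bounded below in valuation. So the valuations of [ev k x] are bounded above, while the changes
    in [ev k x] become arbitrarily small: the valuation freezes. *)
Lemma ev_stable x : x != 0 -> exists m : int, exists k0 : nat, forall k, (k0 <= k)%N ->
  ev k x != 0 /\ w (ev k x) = m.
Proof.
move=> x0; have n0 : nrm x != 0 by rewrite (qnorm_eq0 t_sqr coordE delta_nsq).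
pose m0 := w (nrm x).
have [k1 hk1] := vge_large (c2 x ^+ 2) (m0 + 1).
have [mu hmu] : exists mu, forall k, (0 < k)%N -> vge w (c1 x - c2 x * beta k) mu.
  have c0 a b (u : int) : exists mu, vge w a mu /\ vge w b mu.
    exists (Num.min (w a) (w b)).
    by rewrite /vge !ge_min !lexx ?orbT.
  have [mu [h1 h2]] := c0 (c1 x) (c2 x) 0; exists mu => k k0.
  apply: (vgeB wv) => //; rewrite -[mu]addr0; apply: (vgeM wv) => //.
  by have [bn wb] := beta_unit k0; rewrite vgeE // wb.
have [k2 hk2] := vge_large (c2 x) (m0 - mu + 1).
pose k0 := maxn 1 (maxn k1 k2).
have bnd k : (k0 <= k)%N -> ev k x != 0 /\ w (ev k x) <= m0 - mu.
  move=> hk; have k_gt0 : (0 < k)%N by rewrite /k0 in hk; lia.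
  have k_gt1 : (k1 <= k)%N by rewrite /k0 in hk; lia.
  have := val_addr wv n0 (y := - (c2 x ^+ 2 * (beta k ^+ 2 - delta))).
  rewrite (vgeN wv) => /(_ (hk1 k _ k_gt1 (beta_sqr k))).
  rewrite -ev_qnorm mulf_eq0 negb_or => -[/andP[e0 f0]].
  rewrite (valM wv) // => E; split=> //.
  by have := hmu k k_gt0; rewrite vgeE // /m0 -E; move: (w _) (w (ev k x)) => u v; lia.
exists (w (ev k0 x)), k0 => k hk; have [e0 eb] := bnd _ (leqnn k0).
apply: (val_mod wv) => //.
have -> : ev k0 x - ev k x = - (c2 x * (beta k - beta k0)) by rewrite /ev; ring.
rewrite (vgeN wv); apply: vge_le (hk2 k0 _ _ (beta_cauchy hk)); first by lia.
by rewrite /k0; lia.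
Qed.

Definition split_value (u : L -> int) := forall x, x != 0 -> exists k0 : nat,
  forall k, (k0 <= k)%N -> ev k x != 0 /\ w (ev k x) = u x.

Lemma split_value_ex : exists u, split_value u.
Proof.
pose P x (m : int) := x != 0 -> exists k0 : nat, forall k, (k0 <= k)%N ->
  ev k x != 0 /\ w (ev k x) = m.
have : forall x, exists m, P x m.
  move=> x; have [->|x0] := eqVneq x 0; first by exists 0; rewrite /P eqxx.
  by have [m hm] := ev_stable x0; exists m.
by move=> /choice[u hu]; exists u.
Qed.

Variable u : L -> int.
Hypothesis hu : split_value u.

Lemma split_valuation : is_valuation u.
Proof.
split=> x y x0 y0.
  have [k1 h1] := hu x0; have [k2 h2] := hu y0; have [k3 h3] := hu (mulf_neq0 x0 y0).
  have [k4 h4] := vge_large (- (c2 x * c2 y)) (u x + u y + 1).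
  pose k := maxn (maxn k1 k2) (maxn k3 k4).
  have [|ex wx] := h1 k; first by rewrite /k; lia.
  have [|ey wy] := h2 k; first by rewrite /k; lia.
  have [|exy wxy] := h3 k; first by rewrite /k; lia.
  have e0 : ev k x * ev k y != 0 by rewrite mulf_neq0.
  (* [ev k] is multiplicative only up to a multiple of beta_k^2 - delta, which is negligible for
     large k. *)
  have := val_addr wv e0 (y := - (c2 x * c2 y) * (beta k ^+ 2 - delta)).
  have -> : ev k x * ev k y + - (c2 x * c2 y) * (beta k ^+ 2 - delta) = ev k (x * y).
    by rewrite /ev (coord1M t_sqr coordE delta_nsq) (coord2M t_sqr coordE delta_nsq); ring.
  rewrite (valM wv) // wx wy wxy => H.
  by have [] := H (h4 k _ _ (beta_sqr k)); rewrite // /k; lia.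
move=> xy0; have [k1 h1] := hu x0; have [k2 h2] := hu y0; have [k3 h3] := hu xy0.
pose k := maxn (maxn k1 k2) k3.
have [|ex wx] := h1 k; first by rewrite /k; lia.
have [|ey wy] := h2 k; first by rewrite /k; lia.
have [|exy wxy] := h3 k; first by rewrite /k; lia.
have E : ev k (x + y) = ev k x + ev k y.
  by rewrite /ev (coord1D t_sqr coordE delta_nsq) (coord2D t_sqr coordE delta_nsq); ring.
rewrite -wx -wy -wxy E; apply: wv.2 => //; by rewrite -E.
Qed.

Lemma ev_algA k a : ev k a%:A = a.
Proof. by rewrite /ev (coord1A t_sqr coordE delta_nsq) (coord2A t_sqr coordE delta_nsq) mul0r addr0. Qed.

Lemma split_valueA a : a != 0 -> u a%:A = w a.
Proof.
move=> a0; have aA : a%:A != 0 :> L by rewrite algA_eq0.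
by have [k0 /(_ _ (leqnn k0))] := hu aA; rewrite ev_algA => -[].
Qed.

(* a + b t is congruent to a + b beta_k *)
Lemma split_value_ev x (M : int) : exists k0 : nat, forall k, (k0 <= k)%N ->
  vge u (x - (ev k x)%:A) M.
Proof.
have [k1 h1] := vge_large (c2 x) M; exists k1 => k hk.
have [->|y0] := eqVneq (x - (ev k x)%:A) 0; first exact: vge_zero.
have [k2 h2] := hu y0; pose l := maxn k2 k.
have [|el wl] := h2 l; first by rewrite /l; lia.
rewrite vgeE // -wl -(vgeE w) //.
have -> : ev l (x - (ev k x)%:A) = c2 x * (beta l - beta k).
  rewrite /ev -scaleNr (coord1D t_sqr coordE delta_nsq) (coord2D t_sqr coordE delta_nsq).
  by rewrite (coord1A t_sqr coordE delta_nsq) (coord2A t_sqr coordE delta_nsq) /ev; ring.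
by apply: h1 hk _; apply: beta_cauchy; rewrite /l; lia.
Qed.

Lemma split_value_residue x : vge u x 0 -> exists2 a, vge w a 0 & vge u (x - a%:A) 1.
Proof.
move=> hx; have [->|x0] := eqVneq x 0.
  by exists 0; rewrite ?vge_zero // scale0r subr0 vge_zero.
have [k1 h1] := hu x0; have [k2 h2] := split_value_ev x 1.
pose k := maxn k1 k2; exists (ev k x); last by apply: h2; rewrite /k; lia.
have [|e0 we] := h1 k; first by rewrite /k; lia.
by rewrite vgeE // we -(vgeE u).
Qed.

Section Unique.
Variables (p : L -> int) (e : int).
Hypothesis pv : is_valuation p.
Hypothesis e0 : 0 < e.
Hypothesis pw : forall a : K, a != 0 -> p a%:A = e * w a.

(** The hypothesis says that t is the limit of [beta] at p, so x and [ev k x] have the same value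
    for large k. *)
Lemma split_value_unique : (forall k, (0 < k)%N -> vge p (t - (beta k)%:A) k%:Z) ->
  forall x, x != 0 -> p x = e * u x.
Proof.
move=> ht x x0; have [k1 h1] := hu x0.
have [k2 h2] : exists k0 : nat, forall k, (k0 <= k)%N -> (0 < k)%N ->
    vge p (c2 x *: (t - (beta k)%:A)) (e * u x + 1).
  have [->|b0] := eqVneq (c2 x) 0; first by exists 0%N => k _ _; rewrite scale0r vge_zero.
  exists `|(e * u x + 1 - p (c2 x)%:A)%R|%N => k hk k0.
  rewrite -[t - _]mul1r scalerAl.
  apply: vge_le (vgeM pv (vge_val p (c2 x)%:A) (ht k k0)).
  by move: hk; move: (p _) => v; lia.
pose k := maxn 1 (maxn k1 k2).
have [|ex wx] := h1 k; first by rewrite /k; lia.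
have E : x = (ev k x)%:A + c2 x *: (t - (beta k)%:A).
  by rewrite {1}(coordE x) /ev scalerBr scalerDl scalerA [c2 x *: t - _]addrC addrA addrK.
have pe : p (ev k x)%:A = e * u x by rewrite pw // wx.
have ae0 : (ev k x)%:A != 0 :> L by rewrite algA_eq0.
have := val_addr pv ae0 (y := c2 x *: (t - (beta k)%:A)); rewrite pe -E.
by case=> //; apply: h2; rewrite /k; lia.
Qed.

(* p (t - beta k) + p (t + beta k) >= k, and both cannot be positive. *)
Lemma split_dichotomy : (forall k, (0 < k)%N -> vge p (t - (beta k)%:A) k%:Z) \/
  (forall k, (0 < k)%N -> vge p (t + (beta k)%:A) k%:Z).
Proof.
have t0 := t_neq0 t_sqr delta_nsq; have dn := delta_neq0 delta_nsq.
have pt : p t = 0.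
  have := pw dn; rewrite -t_sqr (valX pv) // d0 mulr0; move: (p t) => v; lia.
have pb k : (0 < k)%N -> vge p (beta k)%:A 0.
  by move=> k0; have [b0 wb] := beta_unit k0; rewrite vgeE ?algA_eq0 // pw // wb mulr0.
have pm k : (0 < k)%N -> vge p (t - (beta k)%:A) 0.
  by move=> k0; apply: (vgeB pv) (pb k k0); rewrite vgeE // pt.
have pp k : (0 < k)%N -> vge p (t + (beta k)%:A) 0.
  by move=> k0; apply: (vgeD pv) (pb k k0); rewrite vgeE // pt.
have prod k : (t - (beta k)%:A) * (t + (beta k)%:A) = (delta - beta k ^+ 2)%:A.
  by rewrite -subr_sqr t_sqr scalerBl expr2 -scalerAl mul1r scalerA.
have pr k : (0 < k)%N -> vge p ((t - (beta k)%:A) * (t + (beta k)%:A)) k%:Z.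
  move=> k0; rewrite prod; apply: vge_le (vge_restrict e0 pw (m := k%:Z) _).
    by nia.
  by rewrite -(vgeN wv) opprB.
have nboth k : (0 < k)%N -> vge p (t - (beta k)%:A) 1 -> vge p (t + (beta k)%:A) 1 -> False.
  move=> k0 h1 h2; have [b0 wb] := beta_unit k0.
  have := vgeB pv h2 h1; have -> : t + (beta k)%:A - (t - (beta k)%:A) = (2 * beta k)%:A.
    by rewrite opprB [_%:A - t]addrC addrACA subrr add0r -scalerDl mulr_natl mulr2n.
  by rewrite vgeE ?algA_eq0 ?mulf_neq0 // pw ?mulf_neq0 // (valM wv) // w2 wb mulr0.
have one k : (0 < k)%N -> vge p (t - (beta k)%:A) k%:Z \/ vge p (t + (beta k)%:A) k%:Z.
  move=> k0; have := pr k k0; have [-> _|m0] := eqVneq (t - (beta k)%:A) 0.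
    by left; rewrite vge_zero.
  have [-> _|p0] := eqVneq (t + (beta k)%:A) 0; first by right; rewrite vge_zero.
  have := nboth k k0; have := pm k k0; have := pp k k0.
  rewrite !vgeE ?mulf_neq0 // (valM pv) //.
  move: (p (t - (beta k)%:A)) (p (t + (beta k)%:A)) => v v' h1 h2 h3 h4.
  have [g1|g1] := lerP 1 v; last by right; lia.
  by have [g2|g2] := lerP 1 v'; [case: (h3 g1 g2)|left; lia].
have d k : (0 < k)%N -> vge p ((beta k)%:A - (beta 1%N)%:A) 1.
  by move=> k0; rewrite -scalerBl (vge_restrict1 e0 pw) beta_cauchy.
have [h|h] := one 1%N isT; [left|right] => k k0; have [g|g] := one k k0 => //.
  case: (nboth k k0) => //; last by apply: vge_le g; lia.
  have -> : t - (beta k)%:A = (t - (beta 1%N)%:A) - ((beta k)%:A - (beta 1%N)%:A).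
    by rewrite opprB addrA subrK.
  exact: (vgeB pv) (d k k0).
case: (nboth k k0) => //; first by apply: vge_le g; lia.
have -> : t + (beta k)%:A = (t + (beta 1%N)%:A) + ((beta k)%:A - (beta 1%N)%:A).
  by rewrite -addrA [_ + (_ - _)]addrC subrK.
exact: (vgeD pv) (d k k0).
Qed.

End Unique.
End SplitAbstract.

Section SplitPair.
Variables (K : fieldType) (L : fieldExtType K) (w : K -> int).
Hypothesis wv : is_valuation w.
Variables (t : L) (delta : K) (c1 c2 : L -> K).
Hypothesis t_sqr : t ^+ 2 = delta%:A.
Hypothesis coordE : forall x, x = (c1 x)%:A + c2 x *: t.
Hypothesis delta_nsq : forall a, a ^+ 2 != delta.
Hypothesis d0 : w delta = 0.
Hypothesis two0 : (2 : K) != 0.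
Hypothesis w2 : w 2 = 0.
Local Notation nrm := (qnorm delta c1 c2).
Variable beta : nat -> K.
Hypothesis bs : forall k, vge w (beta k ^+ 2 - delta) k%:Z.
Hypothesis bc : forall k l, (k <= l)%N -> vge w (beta l - beta k) k%:Z.
Let beta' k := - beta k.
Variables u1 u2 : L -> int.
Hypothesis h1 : split_value w c1 c2 beta u1.
Hypothesis h2 : split_value w c1 c2 beta' u2.

(** The evaluations at beta_k and -beta_k multiply to the norm up to a term that is negligible for
    large k. *)
Lemma split_sum x : x != 0 -> u1 x + u2 x = w (nrm x).
Proof.
move=> x0; have [k1 g1] := h1 x0; have [k2 g2] := h2 x0.
have [k3 g3] := vge_large wv (- c2 x ^+ 2) (w (nrm x) + 1).
pose k := maxn k1 (maxn k2 k3).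
have [|e1 w1] := g1 k; first by rewrite /k; lia.
have [|e2 wp2] := g2 k; first by rewrite /k; lia.
have n0 : nrm x != 0 by rewrite (qnorm_eq0 t_sqr coordE delta_nsq).
have [|_ <-] := val_addr wv n0 (y := - c2 x ^+ 2 * (beta k ^+ 2 - delta)).
  by apply: (g3 k _ _ (bs k)); rewrite !leq_max leqnn !orbT.
rewrite -w1 -wp2 -(valM wv) //; congr w; rewrite mulNr -ev_qnorm.
by rewrite /ev mulrN.
Qed.

(** The sum and difference of the two evaluations are 2 c1 and 2 beta_k c2, where 2 and beta_k are
    units. *)
Lemma split_integral x : vge u1 x 0 && vge u2 x 0 = vge w (c1 x) 0 && vge w (c2 x) 0.
Proof.
have [->|x0] := eqVneq x 0.
  have := coord_eq0 t_sqr coordE delta_nsq (0 : L); rewrite eqxx => /esym/andP[/eqP-> /eqP->].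
  by rewrite !vge_zero.
have [k1 g1] := h1 x0; have [k2 g2] := h2 x0.
pose k := maxn 1 (maxn k1 k2).
have [|e1 w1] := g1 k; first by rewrite /k; lia.
have [|e2 wp2] := g2 k; first by rewrite /k; lia.
have [bn wb] : beta k != 0 /\ w (beta k) = 0.
  by apply: (beta_unit wv delta_nsq d0 two0 w2 bs); rewrite /k; lia.
rewrite (vgeE u1 _ x0) (vgeE u2 _ x0) -w1 -wp2 -(vgeE w _ e1) -(vgeE w _ e2); apply/andP/andP => -[ga gb].
  have := vgeD wv ga gb; have := vgeB wv ga gb.
  have -> : ev c1 c2 beta k x + ev c1 c2 beta' k x = 2 * c1 x by rewrite /ev /beta'; ring.
  have -> : ev c1 c2 beta k x - ev c1 c2 beta' k x = 2 * (beta k * c2 x).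
    by rewrite /ev /beta'; ring.
  by rewrite !(vgeMl wv _ _ two0 w2) (vgeMl wv _ _ bn wb).
have bb : vge w (c2 x * beta k) 0 by rewrite mulrC (vgeMl wv _ _ bn wb).
by rewrite /ev /beta' mulrN (vgeD wv) // (vgeB wv).
Qed.

(** The element t - beta_1 has positive value where t tends to [beta], and value 0 where t tends to
    -beta, since 2 beta_1 is a unit. *)
Lemma split_neq : exists2 x, x != 0 & u1 x <> u2 x.
Proof.
have [b1n wb1] := beta_unit wv delta_nsq d0 two0 w2 bs (ltn0Sn 0).
pose x := t - (beta 1%N)%:A.
have [xa xb] : c1 x = - beta 1%N /\ c2 x = 1.
  have -> : x = (- beta 1%N)%:A + 1 *: t by rewrite scaleNr scale1r addrC.
  by rewrite (coord1E t_sqr coordE delta_nsq) (coord2E t_sqr coordE delta_nsq).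
have x0 : x != 0.
  by rewrite (coord_eq0 t_sqr coordE delta_nsq) xb oner_eq0 andbF.
exists x => // u12.
have [k1 g1] := h1 x0; have [k2 g2] := h2 x0.
pose k := maxn 1 (maxn k1 k2).
have [|e1 w1] := g1 k; first by rewrite /k; lia.
have [|e2 wp2] := g2 k; first by rewrite /k; lia.
have c1k : vge w (ev c1 c2 beta k x) 1.
  by rewrite /ev xa xb mul1r addrC; apply: (bc (k := 1%N)); rewrite /k; lia.
have b2 : - (2 * beta 1%N) != 0 by rewrite oppr_eq0 mulf_neq0.
have wb2 : w (- (2 * beta 1%N)) = 0 by rewrite (valN wv) (valM wv) // w2 wb1.
have [|_] := val_addr wv b2 (y := - (beta k - beta 1%N)).
  by rewrite (vgeN wv) wb2; apply: (bc (k := 1%N)); rewrite /k; lia.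
have -> : - (2 * beta 1%N) - (beta k - beta 1%N) = ev c1 c2 beta' k x.
  by rewrite /ev xa xb /beta'; ring.
by rewrite wb2 wp2 -u12 -w1; move: c1k; rewrite vgeE // => + E; rewrite E.
Qed.

End SplitPair.

(** * Newton iteration for a square root *)

Section Newton.
Variables (K : fieldType) (w : K -> int).
Hypothesis wv : is_valuation w.
Variable delta : K.
Hypothesis d0 : w delta = 0.
Hypothesis two0 : (2 : K) != 0.
Hypothesis w2 : w 2 = 0.

(** A Newton step replaces the error b^2 - delta by the square of the correction, which is as small
    as the error because 2 b is a unit. One more digit per step is all that is retained. *)
Lemma newton_sequence b0 : b0 != 0 -> w b0 = 0 -> vge w (b0 ^+ 2 - delta) 1 ->
  exists beta : nat -> K, (forall k, vge w (beta k ^+ 2 - delta) k%:Z) /\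
    (forall k l, (k <= l)%N -> vge w (beta l - beta k) k%:Z).
Proof.
move=> b00 wb0 h0; pose eta b := (b ^+ 2 - delta) / (2 * b).
pose beta k := iter k (fun b => b - eta b) b0.
have etaP b k : b != 0 -> w b = 0 -> vge w (b ^+ 2 - delta) k -> vge w (eta b) k.
  move=> bn wb h; rewrite -[k]addr0; apply: (vgeM wv h).
  by rewrite vgeE ?invr_eq0 ?mulf_neq0 // (valV wv) ?mulf_neq0 // (valM wv) // w2 wb.
have inv k : [/\ beta k != 0, w (beta k) = 0 & vge w (beta k ^+ 2 - delta) k.+1%:Z].
  elim: k => [|k [bn wb hb]]; first by [].
  have he := etaP _ _ bn wb hb.
  have [b'0 wb'] : beta k.+1 != 0 /\ w (beta k.+1) = w (beta k).
    apply: (val_addr wv) => //; rewrite (vgeN wv) wb; apply: vge_le he; lia.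
  split=> //; first by rewrite wb'.
  have -> : beta k.+1 ^+ 2 - delta = eta (beta k) * eta (beta k).
    rewrite [beta k.+1]/(beta k - eta (beta k)).
    have E : beta k ^+ 2 - delta = eta (beta k) * (2 * beta k).
      by rewrite divfK // mulf_neq0.
    move: (beta k) (eta _) E => b h E.
    have -> : (b - h) ^+ 2 - delta = (b ^+ 2 - delta) - h * (2 * b) + h * h by ring.
    by rewrite E subrr add0r.
  by apply: vge_le (vgeM wv he he); lia.
exists beta; split=> [k|k l]; first by have [_ _ h] := inv k; apply: vge_le h; lia.
move/subnK <-; elim: (l - k)%N => [|m IH]; first by rewrite add0n subrr vge_zero.
have [bn wb hb] := inv (m + k)%N.
rewrite addSn [beta _.+1]/(beta (m + k)%N - eta (beta (m + k)%N)) addrAC.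
apply: (vgeB wv) IH _; apply: etaP => //; apply: vge_le hb; lia.
Qed.

End Newton.

Section AboveSplit.
Variables (F : finFieldType) (L : fieldExtType {fraction {poly F}}).
Local Notation K := {fraction {poly F}}.
Implicit Types (p : place L) (x y : L) (a b c : K).
Variables (t : L) (delta : K) (c1 c2 : L -> K).
Hypothesis t_sqr : t ^+ 2 = delta%:A.
Hypothesis coordE : forall x, x = (c1 x)%:A + c2 x *: t.
Hypothesis delta_nsq : forall a, a ^+ 2 != delta.
Variables (w : K -> int) (n : nat).
Hypothesis w_kplace : is_kplace w n.
Hypothesis q_odd : odd #|F|.
Hypothesis d0 : w delta = 0.

Let wv : is_valuation w. Proof. by case: w_kplace. Qed.

Lemma two_unit : (2 : K) != 0 /\ w 2 = 0.
Proof.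
have := w_const w_kplace (char_odd q_odd).
by have -> : ((2 : F)%:P)%:F = 2 :> K by rewrite polyCMn tofracMn polyC1 tofrac1.
Qed.

Lemma split_place (beta : nat -> K) :
  (forall k, vge w (beta k ^+ 2 - delta) k%:Z) ->
  (forall k l, (k <= l)%N -> vge w (beta l - beta k) k%:Z) ->
  exists p, split_value w c1 c2 beta p /\ place_degree p = n.
Proof.
move=> bs bc; have [two0 w2] := two_unit.
have [u hu] := split_value_ex wv t_sqr coordE delta_nsq d0 two0 w2 bs bc.
have uA := split_valueA t_sqr coordE delta_nsq hu.
have [p hp] : exists p, forall x, x != 0 -> p x = u x.
  apply: place_build.
  - exact: (split_valuation wv t_sqr coordE delta_nsq d0 two0 w2 bs hu).
  - by move=> c c0; have [cn0 wc] := w_const w_kplace c0; rewrite const_algA uA.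
  by have [_ _ [a a0 wa] _ _] := w_kplace; exists a%:A; rewrite ?uA ?algA_eq0.
have pu x m : vge p x m = vge u x m.
  by rewrite /vge; have [//|x0] := eqVneq x 0; rewrite hp.
exists p; split; first by move=> x x0; rewrite hp //; exact: hu.
apply: (degree_residue_K w_kplace ltr01); first by move=> a a0; rewrite hp ?algA_eq0 // uA // mul1r.
move=> x; rewrite pu => /(split_value_residue wv t_sqr coordE delta_nsq d0 two0 w2 bc hu)[a a0 ha].
by exists a => //; rewrite pu.
Qed.

(** The two sequences of approximate roots [beta] and -[beta] give two places, and [split_dichotomy]
    leaves no third. *)
Lemma above_split b0 : vge w (b0 ^+ 2 - delta) 1 ->
  exists l, places_above delta c1 c2 w n l 1.
Proof.
move=> h0; have [two0 w2] := two_unit; have dn := delta_neq0 delta_nsq.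
have [b00 wb0] : b0 != 0 /\ w b0 = 0.
  have h : vge w (delta - b0 ^+ 2) (w delta + 1) by rewrite -(vgeN wv) opprB d0.
  have [] := val_mod wv dn h; rewrite expf_eq0 /= => b00; rewrite (valX wv) // d0.
  by split=> //; lia.
have [beta [bs bc]] := newton_sequence wv d0 two0 w2 b00 wb0 h0.
pose beta' k := - beta k.
have bs' k : vge w (beta' k ^+ 2 - delta) k%:Z by rewrite /beta' sqrrN; exact: bs.
have bc' k l : (k <= l)%N -> vge w (beta' l - beta' k) k%:Z.
  by move=> kl; rewrite /beta' -opprD (vgeN wv) bc.
have [p1 [h1 dp1]] := split_place bs bc.
have [p2 [h2 dp2]] := split_place bs' bc'.
have p1A := split_valueA t_sqr coordE delta_nsq h1.
have p2A := split_valueA t_sqr coordE delta_nsq h2.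
have p1v := pval_valuation p1; have p2v := pval_valuation p2.
have sum x (x0 : x != 0) := split_sum wv t_sqr coordE delta_nsq d0 two0 w2 bs h1 h2 x0.
have int x := split_integral wv t_sqr coordE delta_nsq d0 two0 w2 bs h1 h2 x.
exists [:: p1; p2]; split=> //.
- rewrite /= inE andbT; apply/eqP => p12.
  have [x _] := split_neq wv t_sqr coordE delta_nsq d0 two0 w2 bs bc h1 h2.
  by rewrite p12.
- move=> p; rewrite !inE; split=> [/orP[]/eqP->|[e e0 he]].
  + by exists 1 => // a a0; rewrite p1A // mul1r.
  + by exists 1 => // a a0; rewrite p2A // mul1r.
  have pv := pval_valuation p.
  case: (split_dichotomy wv t_sqr delta_nsq d0 two0 w2 bs bc pv e0 he) => H; apply/orP; [left|right]; apply/eqP.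
    have U := split_value_unique coordE d0 two0 w2 h1 pv e0 he H.
    by apply: (@place_proportional _ _ p p1 1 e) => // x x0; rewrite mul1r U.
  have H' k : (0 < k)%N -> vge p (t - (beta' k)%:A) k%:Z.
    by move=> k0; rewrite /beta' scaleNr opprK H.
  have U := split_value_unique coordE d0 two0 w2 h2 pv e0 he H'.
  by apply: (@place_proportional _ _ p p2 1 e) => // x x0; rewrite mul1r U.
- by move=> x x0; rewrite big_cons big_seq1 dp1 dp2 -mulrDr sum.
- move=> x; split=> [h|[ha hb] p].
    by apply/andP; rewrite -int !h // !inE eqxx ?orbT.
  have /andP[i1 i2] : vge p1 x 0 && vge p2 x 0 by rewrite int ha.
  by rewrite !inE => /orP[]/eqP->.
by apply: Or31; split=> //; exists p1, p2.
Qed.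

End AboveSplit.

Lemma sqr_scale (K : fieldType) (a x y : K) : x != 0 -> a ^+ 2 = y / x ^+ 2 ->
  (a * x) ^+ 2 = y.
Proof. by move=> x0 E; rewrite exprMn E divfK // expf_neq0. Qed.

Lemma qform_scale (K : fieldType) (b x y : K) : x != 0 ->
  y / x ^+ 2 * (b * x) ^+ 2 = y * b ^+ 2.
Proof. by move=> x0; rewrite exprMn mulrCA divfK ?expf_neq0 // mulrC. Qed.

Lemma one_sub_div (K : fieldType) (x y r : K) : x != 0 -> y = x + r ->
  1 - y / x = - r / x.
Proof. by move=> x0 ->; rewrite mulrDl divff // opprD addrA subrr add0r mulNr. Qed.

Section RestrictionToBase.
Variables (K : fieldType) (L : fieldExtType K) (p : L -> int).
Hypothesis pv : is_valuation p.

Lemma restrict_valuation : is_valuation (fun a : K => p a%:A).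
Proof.
split=> [a b a0 b0|a b a0 b0 ab0].
  have -> : (a * b)%:A = a%:A * b%:A :> L by rewrite -scalerAl mul1r scalerA.
  by rewrite (valM pv) ?algA_eq0.
by rewrite scalerDl; apply: pv.2; rewrite -?scalerDl algA_eq0.
Qed.

Variables (t : L) (delta : K) (c1 c2 : L -> K).
Hypothesis t_sqr : t ^+ 2 = delta%:A.
Hypothesis coordE : forall x, x = (c1 x)%:A + c2 x *: t.
Hypothesis delta_nsq : forall a, a ^+ 2 != delta.

(* x divides its norm in the valuation ring, the cofactor being 2 c1 x - x *)
Lemma restrict_nontrivial x : x != 0 -> p x = 1 -> exists2 a : K, a != 0 & p a%:A != 0.
Proof.
move=> x0 px; apply: contrapT => /forall2NP nv.
have tr a : a != 0 -> p a%:A = 0.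
  by move=> a0; have [/(_ a0)//|/negP] := nv a; rewrite negbK => /eqP.
have x1 : vge p x 1 by rewrite vgeE // px.
have nx : qnorm delta c1 c2 x != 0 by rewrite (qnorm_eq0 t_sqr coordE delta_nsq).
have E : (qnorm delta c1 c2 x)%:A = x * ((2 * c1 x)%:A - x).
  rewrite -(mul_qconj t_sqr coordE); congr (_ * _).
  apply: (addIr x); rewrite subrK [X in _ + X]coordE /qconj addrACA addNr addr0.
  by rewrite -scalerDl mulr_natl mulr2n.
have y0 : vge p ((2 * c1 x)%:A - x) 0.
  apply: (vgeB pv); last by apply: vge_le x1.
  have [->|c0] := eqVneq (2 * c1 x) 0; first by rewrite scale0r vge_zero.
  by rewrite vgeE ?algA_eq0 // tr.
have := vgeM pv x1 y0; rewrite -E addr0 vgeE ?algA_eq0 //.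
by rewrite tr.
Qed.

End RestrictionToBase.

(** * When a^2 - delta b^2 admits no cancellation *)

Section AnisotropicCriteria.
Variables (K : fieldType) (w : K -> int) (delta : K).
Hypothesis wv : is_valuation w.
Hypothesis dn : delta != 0.

Lemma aniso_neq a b m : a != 0 -> b != 0 -> 2 * w a != w delta + 2 * w b ->
  vge w (a ^+ 2 - delta * b ^+ 2) m -> vge w (a ^+ 2) m && vge w (delta * b ^+ 2) m.
Proof.
move=> a0 b0 ab; have a2 : a ^+ 2 != 0 by rewrite expf_neq0.
have b2 : - (delta * b ^+ 2) != 0 by rewrite oppr_eq0 mulf_neq0 ?expf_neq0.
have wb : w (- (delta * b ^+ 2)) = w delta + 2 * w b.
  by rewrite (valN wv) (valM wv) ?expf_neq0 // (valX wv).
have wa : w (a ^+ 2) = 2 * w a by rewrite (valX wv).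
rewrite -(vgeN wv (delta * _)) (vgeE w _ a2) (vgeE w _ b2) wa wb.
move: ab wa wb; move: (2 * w a) (w delta + 2 * w b) => u v; rewrite neq_lt => /orP[] uv wa wb.
  have [|s0 sE] := vge_neq wv a2 b2; first by rewrite wa wb.
  by rewrite (vgeE w _ s0) sE wa => mu; rewrite mu (le_trans mu) ?ltW.
have [|s0 sE] := vge_neq wv b2 a2; first by rewrite wa wb.
by rewrite addrC (vgeE w _ s0) sE wb => mv; rewrite mv (le_trans mv) ?ltW.
Qed.

Lemma aniso_zero a b m : a = 0 \/ b = 0 ->
  vge w (a ^+ 2 - delta * b ^+ 2) m -> vge w (a ^+ 2) m && vge w (delta * b ^+ 2) m.
Proof.
case=> ->; first by rewrite expr0n sub0r (vgeN wv) vge_zero.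
by rewrite expr0n mulr0 subr0 vge_zero andbT.
Qed.

(** The two terms have values of different parity. *)
Lemma aniso_odd a b m : w delta = 1 -> vge w (a ^+ 2 - delta * b ^+ 2) m ->
  vge w (a ^+ 2) m && vge w (delta * b ^+ 2) m.
Proof.
move=> d1; have [a0|a0] := eqVneq a 0; first by apply: aniso_zero; left.
have [b0|b0] := eqVneq b 0; first by apply: aniso_zero; right.
by apply: aniso_neq => //; rewrite d1; move: (w a) (w b) => u v; lia.
Qed.

(** Cancellation requires w(a) = w(b), and then c = a / b would be a square root of [delta] modulo
    the maximal ideal. *)
Lemma aniso_nonsquare a b m : w delta = 0 -> (forall c, ~~ vge w (c ^+ 2 - delta) 1) ->
  vge w (a ^+ 2 - delta * b ^+ 2) m ->
  vge w (a ^+ 2) m && vge w (delta * b ^+ 2) m.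
Proof.
move=> d0 nsq; have [a0|a0] := eqVneq a 0; first by apply: aniso_zero; left.
have [b0|b0] := eqVneq b 0; first by apply: aniso_zero; right.
have [e|ab] := eqVneq (w a) (w b); last first.
  by apply: aniso_neq => //; rewrite d0 add0r; apply: contraNneq ab; move: (w a) (w b) => u v; lia.
rewrite (vgeE w _ (expf_neq0 2 a0)) (vgeMl wv _ _ dn d0) (vgeE w _ (expf_neq0 2 b0)) => h.
rewrite !(valX wv) // e andbb.
have E : a ^+ 2 - delta * b ^+ 2 = b ^+ 2 * ((a / b) ^+ 2 - delta).
  by rewrite mulrBr -exprMn [b * (_ / _)]mulrC divfK // [delta * _]mulrC.
have := nsq (a / b); rewrite /vge negb_or => /andP[c0 cl].
move: h; rewrite E vgeE ?mulf_neq0 ?expf_neq0 // (valM wv) ?expf_neq0 // (valX wv) //.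
by move: cl; move: (w (_ - _)) (w b) => v u; lia.
Qed.

End AnisotropicCriteria.

(** * The extension generated by the square root of (-1)^d P *)

Section Extension.
Variables (F : finFieldType) (P : {poly F}) (L : fieldExtType {fraction {poly F}}) (s : L).
Local Notation K := {fraction {poly F}}.
Local Notation d := (pdeg P).
Hypothesis q_odd : odd #|F|.
Hypotheses (P_monic : P \is monic) (P_irr : irreducible_poly P).
Let D : {poly F} := (-1) ^+ d * P.
Hypothesis s_sqr : s ^+ 2 = (D%:F)%:A.
Hypothesis L_gen : <<1%VS; s>>%VS = {:L}%VS.

Let P0 : P != 0 := monic_neq0 P_monic.
Let mP : mirr P. Proof. by apply/andP; split=> //; apply/irreducibleP. Qed.
Let D0 : D != 0. Proof. by rewrite mulf_neq0 // expf_neq0 // oppr_eq0 oner_neq0. Qed.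

Lemma ord_disc Q : mirr Q -> ord Q D = (Q == P).
Proof.
move=> mQ; have [_ iQ] := mirrP mQ.
rewrite /D ordM ?expf_neq0 ?oppr_eq0 ?oner_neq0 // (ord_mirr mQ mP).
suff -> : ord Q ((-1) ^+ d) = 0%N by [].
apply: (ord0 iQ); rewrite -signr_odd; case: odd; rewrite ?expr1 ?expr0 ?dvdpNr dvdp1;
by case: iQ; case: size => [|[]].
Qed.

(** The P-adic value of D is 1, which is odd. *)
Lemma disc_nsq (a : K) : a ^+ 2 != D%:F.
Proof.
have vv := vord_valuation P_irr; have DF : D%:F != 0 :> K by rewrite tofrac_eq0.
apply/eqP => h; have a0 : a != 0 by apply: contraNneq DF => a0; rewrite -h a0 expr0n.
have := congr1 (vord P) h; rewrite (valX vv) // vord_poly // ord_disc // eqxx.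
by move: (vord P a) => u; lia.
Qed.

Lemma coord_exists : exists c1 c2 : L -> K, forall x, x = (c1 x)%:A + c2 x *: s.
Proof.
suff H x : exists ab : K * K, x = ab.1%:A + ab.2 *: s.
  by have [f hf] := choice H; exists (fun x => (f x).1), (fun x => (f x).2).
have hD (y z : L) : (exists ab : K * K, y = ab.1%:A + ab.2 *: s) ->
   (exists ab : K * K, z = ab.1%:A + ab.2 *: s) ->
   exists ab : K * K, y + z = ab.1%:A + ab.2 *: s.
  move=> [[a b] /= ->] [[a' b'] /= ->]; exists (a + a', b + b') => /=.
  by rewrite !scalerDl addrACA.
have hs n : exists ab : K * K, s ^+ n = ab.1%:A + ab.2 *: s.
  elim: n => [|n [[a b] /= IH]].
    by exists (1, 0) => /=; rewrite expr0 scale1r scale0r addr0.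
  exists (D%:F * b, a) => /=; rewrite exprSr IH mulrDl -!scalerAl mul1r -expr2 s_sqr.
  by rewrite scalerA mulrC addrC.
have : x \in <<1%VS; s>>%VS by rewrite L_gen memvf.
case/Fadjoin_polyP => p /polyOverP pK ->; rewrite horner_coef.
elim/big_ind: _ => [|y z|i _]; [|exact: hD|].
  by exists (0, 0) => /=; rewrite !scale0r addr0.
have /vlineP[k ->] := pK i; have [[a b] /= ->] := hs i.
by exists (k * a, k * b) => /=; rewrite mulrDr -!scalerAl !mul1r !scalerA.
Qed.

(** The splitting symbol of L. At oo an odd degree ramifies, while for even d the polynomial D = P
    is monic, hence a square in the completion. *)
Definition eps (i : option {poly F}) : int :=
  if i is Some Q then legendre P Q else if odd d then 0 else 1.

Section WithCoordinates.
Variables c1 c2 : L -> K.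
Hypothesis coordE : forall x, x = (c1 x)%:A + c2 x *: s.

Lemma above_finite Q : mirr Q -> exists l,
  places_above D%:F c1 c2 (vord Q) (pdeg Q) l (legendre P Q).
Proof.
move=> mQ; have [mo iQ] := mirrP mQ; have kp := vord_kplace mQ.
have wv := vord_valuation iQ.
have wD : vord Q D%:F = (Q == P) by rewrite vord_poly // ord_disc.
have dn := delta_neq0 disc_nsq.
have [QP|QP] := eqVneq Q P.
  have w1 : vord Q D%:F = 1 by rewrite wD QP eqxx.
  rewrite legendre0; last by rewrite QP.
  by apply: (above_ramified s_sqr coordE disc_nsq kp _ w1) => a b m; exact: (aniso_odd wv dn).
rewrite (negbTE QP) in wD.
have QD : ~~ (Q %| D) by rewrite -(ord_gt0 iQ) // ord_disc // (negbTE QP).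
have rec : legendre P Q = legendre Q D.
  by rewrite reciprocity // eq_sym.
have := legendre_square mo iQ q_odd QD; rewrite -rec => sq.
have [hb|nb] := pselect (exists b, Q %| b ^+ 2 - D).
  have l1 := iffRL sq hb; case: hb => b hb; rewrite l1.
  apply: (above_split s_sqr coordE disc_nsq kp q_odd wD (b0 := b%:F)).
  by rewrite -tofracXn -tofracB -[1]/(1%N%:Z) vge_vord // expr1.
have -> : legendre P Q = -1.
  move: sq; rewrite rec /legendre (negbTE QD); case: ifP => // _ sq.
  by case: nb; apply: (iffLR sq).
apply: (above_inert s_sqr coordE disc_nsq kp _ wD) => a b m.
(* The criterion concerns all c in F(T), but [nb] only polynomials: such a c would be integral at Q,
   hence congruent to a polynomial. *)
apply: (aniso_nonsquare wv dn wD) => c; apply/negP => hc; apply: nb.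
have [_ _ _ _ res] := kp.
have c0 : vge (vord Q) c 0.
  have h2 : vge (vord Q) (c ^+ 2) 0.
    have dge : vge (vord Q) D%:F 0 by rewrite /vge wD lexx orbT.
    by rewrite -[c ^+ 2](subrK D%:F) (vgeD wv) // (vge_le _ hc).
  by rewrite (vge_sqr wv) in h2.
have [f _ cf] := res c c0; exists f.
have h3 : vge (vord Q) (f%:F ^+ 2 - D%:F) 1.
  have f0 : vge (vord Q) f%:F 0 by rewrite -[0]/(0%N%:Z) vge_vord // expr0 dvd1p.
  have -> : f%:F ^+ 2 - D%:F = (c ^+ 2 - D%:F) - (c - f%:F) * (c + f%:F) by ring.
  apply: (vgeB wv) => //; rewrite -[1]addr0; apply: (vgeM wv) => //.
  exact: (vgeD wv).
by move: h3; rewrite -tofracXn -tofracB -[1]/(1%N%:Z) vge_vord // expr1.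
Qed.

Local Notation h := (uphalf d).
Local Notation X := ('X%:F : K).

(* s is rescaled by T^h so that its square is a unit or a uniformiser at oo. *)
Lemma above_infinite : exists l,
  places_above (D%:F / X ^+ h ^+ 2) c1 (fun x => c2 x * X ^+ h) (@vinf F) 1 l
    (if odd d then 0 else 1).
Proof.
have X0 : X != 0 by rewrite tofrac_eq0 polyX_eq0.
have Xh0 : X ^+ h != 0 by rewrite expf_neq0.
have vv := @vinf_valuation F; have kp := @vinf_kplace F.
pose t := (X ^+ h)^-1 *: s.
have t_sqr : t ^+ 2 = (D%:F / X ^+ h ^+ 2)%:A.
  by rewrite /t exprZn s_sqr scalerA mulrC exprVn.
have coordE' x : x = (c1 x)%:A + (c2 x * X ^+ h) *: t.
  by rewrite /t scalerA mulfK // -coordE.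
have nsq a : a ^+ 2 != D%:F / X ^+ h ^+ 2.
  by apply/eqP => /(sqr_scale Xh0); apply/eqP; exact: disc_nsq.
have DF0 : D%:F != 0 :> K by rewrite tofrac_eq0.
have vX : vinf X = -1 by rewrite vinf_poly ?polyX_eq0 // /pdeg size_polyX.
have pD : pdeg D = d.
  by rewrite /D -signr_odd; case: odd; rewrite ?expr1 ?expr0 ?mul1r ?mulN1r /pdeg ?size_polyN.
have vd : vinf (D%:F / X ^+ h ^+ 2) = (odd d)%:Z.
  rewrite (val_divX vv 2 Xh0 DF0) (valX vv h X0) vX (vinf_poly D0) pD.
  by rewrite uphalf_half; move: (odd_double_half d); case: (odd d); move: (d)./2 (d) => k u; clear; lia.
case: ifP => od; rewrite od in vd.
  apply: (above_ramified t_sqr coordE' nsq kp _ vd) => a b m.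
  exact: (aniso_odd vv (delta_neq0 nsq)).
(* D is monic of degree 2 [h], so D / T^(2h) is congruent to 1 at oo. *)
apply: (above_split t_sqr coordE' nsq kp q_odd vd (b0 := 1)).
have DP : D = P by rewrite /D -signr_odd od expr0 mul1r.
have hd : (h * 2 = d)%N by rewrite uphalf_half od add0n muln2 -[RHS]odd_double_half od.
have := monic_in_monics P_monic; move=> /mapP[r _ Pr].
rewrite expr1n -exprM hd DP.
have -> : 1 - P%:F / X ^+ d = - (polyn r)%:F / X ^+ d.
  apply: (one_sub_div (expf_neq0 d X0)).
  by rewrite {1}Pr tofracD tofracXn.
have [->|r0] := eqVneq (polyn r) 0; first by rewrite tofrac0 oppr0 mul0r vge_zero.
have rF0 : - (polyn r)%:F != 0 :> K by rewrite oppr_eq0 tofrac_eq0.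
rewrite /vge; apply/orP; right.
rewrite (val_divX vv d X0 rF0) (valN vv) (vinf_poly r0) vX.
have := size_npoly r; move: r0; rewrite -size_poly_gt0 [pdeg (polyn r)]/pdeg.
by move: (size (polyn r)) => u; clear; move: (pdeg P) => v; lia.
Qed.

(** At oo the integral basis is 1, T^(-h) s, whence the factor T^h on the second coordinate. *)
Definition kintegral (i : option {poly F}) x :=
  if i is Some Q then vge (vord Q) (c1 x) 0 && vge (vord Q) (c2 x) 0
  else vge (@vinf F) (c1 x) 0 && vge (@vinf F) (c2 x * X ^+ h) 0.

Local Notation nrm := (qnorm D%:F c1 c2).

(** [places_above] in the single basis 1, s for all i; the rescaling at oo survives only inside
    [kintegral]. *)
Definition lies_over i (l : seq (place L)) : Prop :=
  [/\ uniq l,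
      forall p, p \in l <-> exists2 e : int, 0 < e & forall a : K, a != 0 -> p a%:A = e * kw i a,
      forall x, x != 0 -> \sum_(p <- l) (place_degree p)%:Z * p x = (kd i)%:Z * kw i (nrm x),
      forall x, (forall p, p \in l -> vge p x 0) <-> kintegral i x
    & decomposition l (kd i) (eps i)].

Definition lies_above (above : option {poly F} -> seq (place L)) : Prop :=
  forall i, kidx i -> lies_over i (above i).

Lemma lies_above_exists : exists above, lies_above above.
Proof.
suff H i : exists l, kidx i -> lies_over i l by have [f hf] := choice H; exists f.
case: i => [Q|].
  have [mQ|nQ] := boolP (mirr Q); last by exists [::]; rewrite /= (negbTE nQ).
  have [l [l1 l2 l3 l4 l5]] := above_finite mQ; exists l => _; split=> //.
  by move=> x; rewrite l4 /=; split=> [[-> ->]|/andP].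
have [l [l1 l2 l3 l4 l5]] := above_infinite; exists l => _; split=> //.
  move=> x x0; rewrite l3 //; congr (_ * vinf _).
  rewrite /qnorm; congr (_ - _).
  by rewrite qform_scale // expf_neq0 // tofrac_eq0 polyX_eq0.
by move=> x; rewrite l4 /=; split=> [[-> ->]|/andP].
Qed.

Variable above : option {poly F} -> seq (place L).
Hypothesis aboveP : lies_above above.

Lemma nrm_neq0 x : x != 0 -> nrm x != 0.
Proof. by move=> x0; rewrite (qnorm_eq0 s_sqr coordE disc_nsq). Qed.

(** The restriction of p to F(T) is a nontrivial valuation, to which the classification applies. *)
Lemma place_over (p : place L) : exists2 i, kidx i & p \in above i.
Proof.
have pv := pval_valuation p.
pose v (a : K) := p a%:A.
have vv : is_valuation v := restrict_valuation pv.
have [x x0 px] := pval_surj p.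
have [a a0 va] := restrict_nontrivial pv s_sqr coordE disc_nsq x0 px.
have [||i [e [ki e0 ve]]] := kval_classification vv.
- by move=> c c0; rewrite /v -const_algA pval_const.
- by exists a.
by exists i => //; have [_ -> _ _ _] := aboveP ki; exists e.
Qed.

Lemma place_over_uniq (p : place L) i j : kidx i -> kidx j ->
  p \in above i -> p \in above j -> i = j.
Proof.
move=> ki kj; have [_ hi _ _ _] := aboveP ki; have [_ hj _ _ _] := aboveP kj.
move=> /hi[e e0 he] /hj[e' e'0 he']; apply: (kval_unique ki kj e0 e'0) => a a0.
by rewrite -he // he'.
Qed.

End WithCoordinates.
End Extension.

(** * Divisors, cardinalities and divisor classes *)

Section Divisors.
Variables (F : finFieldType) (L : fieldExtType {fraction {poly F}}).
Implicit Types (D E : place L -> int) (v : place L) (S : seq (place L)).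

Definition supported D S := forall v, D v != 0 -> v \in S.

Lemma is_divisorP D : is_divisor D <-> exists2 S, uniq S & supported D S.
Proof.
split=> [|[S _ h]].
  case/finite_seqP => S SE; exists (undup S); first exact: undup_uniq.
  by move=> v Dv; rewrite mem_undup; have : [set v | D v != 0]%classic v by []; rewrite SE.
by apply: sub_finite_set (finite_seq S) => v /h.
Qed.

Lemma divisor_degree_seq D S : uniq S -> supported D S ->
  divisor_degree D = \sum_(v <- S) D v * (place_degree v)%:Z.
Proof.
move=> uS h; rewrite fsbig_seq //; apply/esym/fsbig_widen => // v [_ /= vS].
by have [->|/h hv] := eqVneq (D v) 0; [rewrite mul0r|case: vS].
Qed.

Lemma supported_catl D S S' : supported D S -> supported D (undup (S ++ S')).
Proof. by move=> h v /h vS; rewrite mem_undup mem_cat vS. Qed.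

Lemma supported_catr D S S' : supported D S' -> supported D (undup (S ++ S')).
Proof. by move=> h v /h vS; rewrite mem_undup mem_cat vS orbT. Qed.

Lemma supported_lin D E S (f : int -> int -> int) : f 0 0 = 0 ->
  supported D S -> supported E S -> supported (fun v => f (D v) (E v)) S.
Proof.
move=> f0 hD hE v; have [->|/hD//] := eqVneq (D v) 0.
by have [->|/hE//] := eqVneq (E v) 0; rewrite f0 eqxx.
Qed.

Lemma divisor_common D E : is_divisor D -> is_divisor E ->
  exists S, [/\ uniq S, supported D S & supported E S].
Proof.
move=> /is_divisorP[S uS hS] /is_divisorP[S' uS' hS'].
exists (undup (S ++ S')); split; first exact: undup_uniq.
  exact: supported_catl.
exact: supported_catr.
Qed.

Lemma divisorD D E : is_divisor D -> is_divisor E ->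
  is_divisor (fun v => D v + E v) /\
  divisor_degree (fun v => D v + E v) = divisor_degree D + divisor_degree E.
Proof.
move=> hD hE; have [S [uS sD sE]] := divisor_common hD hE.
have sDE : supported (fun v => D v + E v) S.
  exact: (@supported_lin D E S (fun a b => a + b)).
split; first by apply/is_divisorP; exists S.
rewrite !(divisor_degree_seq uS) // -big_split /=.
by apply: eq_bigr => v _; rewrite mulrDl.
Qed.

Lemma divisorN D : is_divisor D ->
  is_divisor (fun v => - D v) /\ divisor_degree (fun v => - D v) = - divisor_degree D.
Proof.
move=> /is_divisorP[S uS sD].
have sN : supported (fun v => - D v) S by move=> v; rewrite oppr_eq0; exact: sD.
split; first by apply/is_divisorP; exists S.
rewrite !(divisor_degree_seq uS) // -sumrN.
by apply: eq_bigr => v _; rewrite mulNr.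
Qed.

Lemma divisorB D E : is_divisor D -> is_divisor E ->
  is_divisor (fun v => D v - E v) /\
  divisor_degree (fun v => D v - E v) = divisor_degree D - divisor_degree E.
Proof.
move=> hD /divisorN[hE dE]; have [h1 h2] := divisorD hD hE.
by split=> //; rewrite h2 dE.
Qed.

Lemma divisor_scaled_place v (n : int) :
  is_divisor (fun u => if u == v then n else 0) /\
  divisor_degree (fun u => if u == v then n else 0) = n * (place_degree v)%:Z.
Proof.
have s1 : supported (fun u => if u == v then n else 0) [:: v].
  by move=> u; rewrite inE; case: (u == v).
split; first by apply/is_divisorP; exists [:: v].
by rewrite (@divisor_degree_seq _ [:: v]) // big_seq1 eqxx.
Qed.

Lemma divisor_degree_ge0 D : is_divisor D -> (forall v, 0 <= D v) -> 0 <= divisor_degree D.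
Proof.
move=> /is_divisorP[S uS sD] h; rewrite (divisor_degree_seq uS) //.
by apply: sumr_ge0 => v _; rewrite mulr_ge0.
Qed.

End Divisors.

(** * Finite cardinalities and F-subspaces *)

Section Cardinality.
Implicit Types T : eqType.

(** Subsets of infinite types are counted by a duplicate-free enumeration, which also records
    finiteness. *)
Definition has_card (T : eqType) (Q : T -> Prop) (n : nat) : Prop :=
  exists S : seq T, [/\ uniq S, forall x, x \in S <-> Q x & size S = n].

Lemma has_card_uniq T (Q : T -> Prop) m n : has_card Q m -> has_card Q n -> m = n.
Proof.
move=> [S [uS hS <-]] [S' [uS' hS' <-]]; apply: perm_size; apply: uniq_perm => // x.
by apply/idP/idP => [/hS/hS'|/hS'/hS].
Qed.

Lemma has_card_ext T (Q Q' : T -> Prop) n : (forall x, Q x <-> Q' x) ->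
  has_card Q n -> has_card Q' n.
Proof. by move=> h [S [u hS sS]]; exists S; split=> // x; rewrite hS. Qed.

Lemma has_card_sub T (Q Q' : T -> Prop) n : (forall x, Q x -> Q' x) ->
  has_card Q' n -> exists k, has_card Q k.
Proof.
move=> h [S [u hS sS]]; exists (size [seq x <- S | `[< Q x >]]), [seq x <- S | `[< Q x >]].
split=> //; first exact: filter_uniq.
by move=> x; rewrite mem_filter; split=> [/andP[/asboolP]//|Qx]; rewrite asboolT //=; apply/hS/h.
Qed.

Lemma has_card_image T (T' : eqType) (Q : T -> Prop) (Q' : T' -> Prop) (f : T -> T') n :
  (forall x y, Q x -> Q y -> f x = f y -> x = y) ->
  (forall y, Q' y <-> exists2 x, Q x & y = f x) -> has_card Q n -> has_card Q' n.
Proof.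
move=> fi hQ' [S [u hS sS]]; exists [seq f x | x <- S]; split; last by rewrite size_map.
  rewrite map_inj_in_uniq // => x y /hS Qx /hS Qy; exact: fi.
move=> y; rewrite hQ'; split=> [/mapP[x /hS Qx ->]|[x /hS xS ->]]; first by exists x.
exact: map_f.
Qed.

Lemma sum_count (C : finType) T (S : seq T) (phi : T -> C) :
  (\sum_(c : C) count (fun x => phi x == c) S)%N = size S.
Proof.
elim: S => [|x S IH] /=; first by rewrite big1.
rewrite big_split /= IH -add1n; congr (_ + _)%N.
by rewrite (bigD1 (phi x)) //= eqxx big1 // => c /negbTE; rewrite eq_sym => ->.
Qed.

Lemma size_fibres_le (C : finType) T (S : seq T) (phi : T -> C) k :
  (forall x, x \in S -> (count (fun y => phi y == phi x) S <= k)%N) ->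
  (size S <= #|C| * k)%N.
Proof.
move=> h; rewrite -(sum_count S phi) -sum_nat_const; apply: leq_sum => c _.
have [/hasP[x xS /eqP <-]|] := boolP (has (fun x => phi x == c) S); first exact: h.
by rewrite has_count -leqNgt leqn0 => /eqP->.
Qed.

Lemma size_sum_fibres (T T' : eqType) (S : seq T) (S' : seq T') (phi : T -> T') :
  uniq S' -> (forall x, x \in S -> phi x \in S') ->
  size S = (\sum_(y <- S') count (fun x => phi x == y) S)%N.
Proof.
move=> uS'; elim: S => [|x S IH] hS /=; first by rewrite big1.
rewrite big_split /= -IH; last by move=> z zS; apply: hS; rewrite inE zS orbT.
rewrite -add1n; congr (_ + _)%N; rewrite (bigD1_seq (phi x)) ?hS ?inE ?eqxx //=.
by rewrite big1 // => c /negbTE; rewrite eq_sym => ->.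
Qed.

Lemma size_fibres_eq (T T' : eqType) (S : seq T) (S' : seq T') (phi : T -> T') k :
  uniq S' -> (forall x, x \in S -> phi x \in S') ->
  (forall y, y \in S' -> count (fun x => phi x == y) S = k) -> size S = (size S' * k)%N.
Proof.
move=> uS' hS h; rewrite (size_sum_fibres uS' hS).
rewrite big_seq (eq_bigr (fun _ => k)); last by move=> y /h.
by rewrite -big_seq big_const_seq count_predT iter_addn_0 mulnC.
Qed.

(** F acts on L only through [const], so the scalar action is a parameter that comes with its
    axioms. *)
Lemma vector_card (F : finFieldType) (V : zmodType) (sc : F -> V -> V) (Q : V -> Prop) n :
  (forall c x y, sc c (x + y) = sc c x + sc c y) ->
  (forall c c' x, sc (c + c') x = sc c x + sc c' x) ->
  (forall c c' x, sc c (sc c' x) = sc (c * c') x) ->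
  (forall x, sc 1 x = x) ->
  Q 0 -> (forall x y, Q x -> Q y -> Q (x + y)) -> (forall c x, Q x -> Q (sc c x)) ->
  has_card Q n -> exists k, n = (#|F| ^ k)%N.
Proof.
move=> scDr scDl scM sc1 Q0 QD QZ hn.
have sc0 c : sc c 0 = 0 by apply: (addrI (sc c 0)); rewrite -scDr !addr0.
have sc0l x : sc 0 x = 0 by apply: (addrI (sc 0 x)); rewrite -scDl !addr0.
have scN c x : sc c (- x) = - sc c x.
  by apply: (addrI (sc c x)); rewrite -scDr !subrr sc0.
have scNl c x : sc (- c) x = - sc c x.
  by apply: (addrI (sc c x)); rewrite -scDl !subrr sc0l.
have q1 := card_finNzRing_gt1 F.
(* a subspace of size q ^ j which is not everything extends to one of size q ^ j.+1 *)
suff H j : (exists k, n = (#|F| ^ k)%N) \/ exists W : V -> Prop,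
   [/\ W 0, forall x y, W x -> W y -> W (x + y), forall c x, W x -> W (sc c x),
      forall x, W x -> Q x & has_card W (#|F| ^ j)%N].
  (* After n extensions a subspace of q^n elements would sit in a set of n elements, although n <
     q^n. *)
  have [//|[W [_ _ _ WQ hW]]] := H n.
  have le : (#|F| ^ n <= n)%N.
    case: hn => S [uS hS sS]; case: hW => S' [uS' hS' sS'].
    rewrite -sS' -sS.
    by apply: uniq_leq_size => // x /hS'/WQ/hS.
  by have := ltn_expl n q1; rewrite ltnNge le.
elim: j => [|j [|[W [W0 WD WZ WQ [S [uS hS sS]]]]]]; [right| by left|].
  exists (fun x => x = 0); split=> //; first by move=> x y -> ->; rewrite addr0.
  - by move=> c x ->.
  - by move=> x ->.
  by exists [:: 0]; split=> // x; rewrite inE; split=> [/eqP|->].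
have [[x Qx nWx]|nx] := pselect (exists2 x, Q x & ~ W x); last first.
  left; exists j; apply: has_card_uniq hn _; exists S; split=> // x; rewrite hS.
  by split=> [/WQ //|Qx]; apply: contrapT => nW; apply: nx; exists x.
right; exists (fun y => exists2 cw : F * V, W cw.2 & y = sc cw.1 x + cw.2); split.
- by exists (0, 0) => //=; rewrite sc0l addr0.
- move=> y z [[c w] /= Ww ->] [[c' w'] /= Ww' ->]; exists (c + c', w + w') => /=.
    exact: WD.
  by rewrite scDl addrACA.
- move=> c y [[c' w] /= Ww ->]; exists (c * c', sc c w) => /=; first exact: WZ.
  by rewrite scDr scM.
- by move=> y [[c w] /= Ww ->]; apply: QD (QZ _ _ Qx) (WQ _ Ww).
exists [seq sc c x + w | c <- enum F, w <- S]; split; last first.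
- by rewrite size_allpairs -cardE sS expnS.
- move=> y; split=> [/allpairsP[[c w] /= [_ /hS Ww ->]]|[[c w] /= /hS Ww ->]].
    by exists (c, w).
  by apply: allpairs_f => //; rewrite mem_enum.
apply: allpairs_uniq => //; first exact: enum_uniq.
move=> [c w] [c' w'] /allpairsP[[c1 w1] [_ /= /hS W1 [-> ->]]].
move=> /allpairsP[[c2 w2] [_ /= /hS W2 [-> ->]]] /= e.
have e2 : sc (c1 - c2) x = w2 - w1.
  rewrite scDl scNl; apply/eqP; rewrite subr_eq addrAC -[w2 + _]addrC.
  by rewrite -e addrK.
have [cc|cc] := eqVneq c1 c2.
  by move: e; rewrite cc => /addrI ->.
have n0 : c1 - c2 != 0 by rewrite subr_eq0.
case: nWx; rewrite -[x]sc1 -(mulVf n0) -scM e2; apply: (WZ); apply: (WD) => //.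
by rewrite -[w1]sc1 -scNl; apply: (WZ).
Qed.

End Cardinality.

(** * Sums of a multiplicative function over monic divisors *)

Section DivisorSums.
Variable F : finFieldType.
Implicit Types (f g Q : {poly F}).

Definition monic_divisors f : seq {poly F} :=
  [seq g <- flatten [seq monics F j | j <- iota 0 (size f)] | g %| f].

Lemma mem_monic_divisors f g : f != 0 -> (g \in monic_divisors f) = (g \is monic) && (g %| f).
Proof.
move=> f0; rewrite mem_filter andbC; have [gf|] := boolP (g %| f); last by rewrite !andbF.
rewrite !andbT; apply/flatten_mapP/idP => [[j _ /monicsP[]//]|mg].
exists (pdeg g); last exact: monic_in_monics.
rewrite mem_iota /= add0n; apply: leq_trans (dvdp_leq f0 gf).
by rewrite /pdeg prednK // size_poly_gt0 monic_neq0.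
Qed.

Lemma monic_divisors_uniq f : uniq (monic_divisors f).
Proof.
apply: filter_uniq; move: (size f) 0%N; elim=> // n IH m /=.
rewrite cat_uniq monics_uniq IH andbT /=; apply/hasPn => g /flatten_mapP[j].
rewrite mem_iota => /andP[mj _] /monicsP[_ _ ej].
by apply/negP => /monicsP[_ _ em]; rewrite -ej em ltnn in mj.
Qed.

Variable w : {poly F} -> int.
Hypothesis wM : forall f g, w (f * g) = w f * w g.
Hypothesis w1 : w 1 = 1.

Definition divisor_sum f := \sum_(g <- monic_divisors f) w g.

Lemma wX f n : w (f ^+ n) = w f ^+ n.
Proof. by elim: n => [|n IH]; rewrite ?expr0 // !exprS wM IH. Qed.

Lemma divisor_sum1 : divisor_sum 1 = 1.
Proof.
rewrite /divisor_sum (perm_big [:: 1]) ?big_seq1 //; apply: uniq_perm => //.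
  exact: monic_divisors_uniq.
move=> g; rewrite mem_monic_divisors ?oner_neq0 // inE dvdp1.
apply/andP/eqP => [[mg /size_poly1P[c c0 gc]]|->]; last by rewrite monic1 size_poly1.
by move: mg; rewrite gc monicE lead_coefC => /eqP->.
Qed.

(** The monic divisors of Q^n g are the Q^j h with j <= n and h a monic divisor of g, each once. *)
Lemma divisor_sum_mul Q n g : mirr Q -> g != 0 -> ~~ (Q %| g) ->
  divisor_sum (Q ^+ n * g) = (\sum_(j < n.+1) w Q ^+ j) * divisor_sum g.
Proof.
move=> mQ g0 Qg; have [mo iQ] := mirrP mQ; have Q0 := mirr_neq0 mQ.
have f0 : Q ^+ n * g != 0 by rewrite mulf_neq0 ?expf_neq0.
rewrite /divisor_sum (perm_big [seq Q ^+ j * h | j <- iota 0 n.+1, h <- monic_divisors g]).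
  rewrite big_allpairs_dep mulr_suml -[iota 0 n.+1]/(index_iota 0 n.+1) big_mkord.
  apply: eq_bigr => j _; rewrite mulr_sumr; apply: eq_bigr => h _.
  by rewrite wM wX.
have oh h : h \in monic_divisors g -> ord Q h = 0%N /\ h != 0.
  rewrite mem_monic_divisors // => /andP[mh hg]; rewrite monic_neq0 //; split=> //.
  by apply: ord0 => //; apply: contra Qg => /dvdp_trans; apply.
have oj j h : h \in monic_divisors g -> ord Q (Q ^+ j * h) = j.
  move=> hg; apply: (@ord_eq _ _ iQ _ _ h) => //; have [o h0] := oh h hg.
  by rewrite -(ord_gt0 iQ) // o.
apply: uniq_perm; first exact: monic_divisors_uniq.
  apply: allpairs_uniq; [exact: iota_uniq|exact: monic_divisors_uniq|].
  move=> [j h] [j' h'] /allpairsP[[a b] [_ bg [-> ->]]] /allpairsP[[a' b'] [_ bg' [-> ->]]] e.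
  rewrite /= in bg bg' e *.
  have ja : a = a' by rewrite -(oj a b bg) e oj.
  by move: e; rewrite ja => /(mulfI (expf_neq0 a' Q0)) ->.
move=> h; rewrite mem_monic_divisors //; apply/andP/allpairsP => [[mh hf]|[[j b] [jn bg hE]]].
  have h0 := monic_neq0 mh; have [h' hE Qh] := ordP iQ h0.
  have h'g : h' %| g.
    have : h' %| Q ^+ n * g by apply: dvdp_trans hf; rewrite [in X in _ %| X]hE dvdp_mull.
    rewrite Gauss_dvdpr // coprimep_expr // coprimep_sym irreducible_poly_coprime //.
  exists (ord Q h, h'); split=> //.
    rewrite -[(_, _).1]/(ord Q h) mem_iota add0n ltnS leq0n andTb.
    have : Q ^+ ord Q h %| Q ^+ n * g by apply: dvdp_trans hf; rewrite {2}hE dvdp_mulr.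
    rewrite dvdp_ord //; last by case: iQ.
    by rewrite (ord_eq iQ erefl Qg).
  by rewrite -[(_, _).2]/h' mem_monic_divisors // h'g andbT; move: mh; rewrite {1}hE monicMl ?monic_exp.
have {}hE : h = Q ^+ j * b := hE.
have {}jn : j \in iota 0 n.+1 := jn.
have {}bg : b \in monic_divisors g := bg.
rewrite hE; have [o b0] := oh b bg; move: bg; rewrite mem_monic_divisors // => /andP[mb bg].
rewrite monicMl ?monic_exp //; split=> //.
by apply: dvdp_mul => //; apply: dvdp_exp2l; move: jn; rewrite mem_iota add0n ltnS => /andP[].
Qed.

(** A monic g of degree j divides exactly q^(m-j) monic polynomials of degree m. *)
Lemma sum_divisor_sum m : \sum_(f <- monics F m) divisor_sum f =
  \sum_(j < m.+1) (\sum_(g <- monics F j) w g) * (#|F| ^ (m - j))%N%:Z.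
Proof.
transitivity (\sum_(f <- monics F m) \sum_(j < m.+1) \sum_(g <- monics F j | g %| f) w g).
  rewrite big_seq [RHS]big_seq; apply: eq_bigr => f fm.
  rewrite /divisor_sum big_filter big_flatten big_map.
  move: fm; rewrite mem_monics => /andP[_ /eqP->].
  by rewrite -[iota 0 m.+1]/(index_iota 0 m.+1) big_mkord.
rewrite exchange_big; apply: eq_bigr => j _ /=.
under eq_bigr do rewrite big_mkcond.
rewrite exchange_big mulr_suml big_seq [RHS]big_seq; apply: eq_bigr => g gj /=.
rewrite -big_mkcond (sum_monics_mul _ gj) /=; last by rewrite -ltnS.
by rewrite big_const_seq count_predT size_monics iter_addr_0 -mulr_natr natz.
Qed.

End DivisorSums.

Lemma scale_invX (K : fieldType) (L : fieldExtType K) (a : K) (x : L) m : a != 0 ->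
  (a ^+ m)^-1 *: x = (a%:A ^+ m)^-1 * x.
Proof.
move=> a0; have am0 : a ^+ m != 0 by rewrite expf_neq0.
have E : a%:A ^+ m = (a ^+ m)%:A :> L by rewrite exprZn expr1n.
have n0 : a%:A ^+ m != 0 :> L by rewrite E algA_eq0.
apply: (mulfI n0); rewrite mulVKf // E -scalerAl mul1r scalerA.
by rewrite mulfV // scale1r.
Qed.

Lemma has_card_prod (T T' : eqType) (Q : T -> Prop) (Q' : T' -> Prop) m n :
  has_card Q m -> has_card Q' n -> has_card (fun z : T * T' => Q z.1 /\ Q' z.2) (m * n).
Proof.
move=> [S [uS hS <-]] [S' [uS' hS' <-]]; exists [seq (x, y) | x <- S, y <- S'].
split; last exact: size_allpairs.
  by apply: allpairs_uniq => // -[a b] [c e].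
move=> [x y]; split=> [/allpairsP[[a b] /= [/hS Sa /hS' Sb [-> ->]]]//|[/= /hS Sx /hS' Sy]].
by apply/allpairsP; exists (x, y).
Qed.

Lemma has_card_union (I T : eqType) (W : seq I) (R : I -> T -> Prop) (c : I -> nat) :
  uniq W -> (forall i, i \in W -> has_card (R i) (c i)) ->
  (forall i j x, R i x -> R j x -> i = j) ->
  has_card (fun x => exists2 i, i \in W & R i x) (\sum_(i <- W) c i).
Proof.
move=> + + disj; elim: W => [_ _|i W IH /= /andP[iW uW] h].
  by rewrite big_nil; exists [::]; split=> // x; split=> // -[].
have [|S [uS hS sS]] := IH uW; first by move=> j jW; apply: h; rewrite inE jW orbT.
have [T0 [uT hT sT]] := h i (mem_head _ _).
exists (T0 ++ S); rewrite big_cons size_cat sS sT; split=> //.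
  rewrite cat_uniq uT uS andbT; apply/hasPn => x /hS[j jW Rj].
  by apply: contra iW => /hT Ri; rewrite (disj i j x).
move=> x; rewrite mem_cat; split=> [/orP[/hT Ri|/hS[j jW Rj]]|[j]].
- by exists i; rewrite ?mem_head.
- by exists j; rewrite // inE jW orbT.
rewrite inE => /orP[/eqP->|jW] Rj; apply/orP; first by left; apply/hT.
by right; apply/hS; exists j.
Qed.

Section Classes.
Variables (F : finFieldType) (L : fieldExtType {fraction {poly F}}).
Implicit Types (D E : place L -> int) (x y : L).

Lemma linearly_equivalent_refl D : linearly_equivalent D D.
Proof.
exists 1; first exact: oner_neq0.
by move=> v; rewrite subrr (val1 (pval_valuation v)).
Qed.

Lemma linearly_equivalent_sym D E : linearly_equivalent D E -> linearly_equivalent E D.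
Proof.
move=> [x x0 h]; exists x^-1; first exact: invr_neq0.
by move=> v; rewrite (valV (pval_valuation v)) // -h opprB.
Qed.

Lemma linearly_equivalent_trans D E D' :
  linearly_equivalent D E -> linearly_equivalent E D' -> linearly_equivalent D D'.
Proof.
move=> [x x0 h] [y y0 g]; exists (x * y); first exact: mulf_neq0 x0 y0.
by move=> v; rewrite (valM (pval_valuation v)) // -h -g addrA subrK.
Qed.

Lemma eq_divisor_class D E : is_divisor D ->
  (divisor_class D = divisor_class E <-> linearly_equivalent D E).
Proof.
move=> hD; split=> [e|de].
  have : divisor_class D D by split=> //; exact: linearly_equivalent_refl.
  by rewrite e => -[].
apply/seteqP; split=> D' [hD' e]; split=> //; first exact: linearly_equivalent_trans e de.
exact: linearly_equivalent_trans e (linearly_equivalent_sym de).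
Qed.

Lemma class_number_card n : has_card (@divisor_classes0 F L) n -> divisor_class_number L = n.
Proof.
move=> [S [uS hS <-]].
have fin : finite_set (@divisor_classes0 F L).
  by apply/finite_seqP; exists S; apply/seteqP; split=> c /hS.
apply: perm_size; apply: uniq_perm => //.
move=> c; rewrite in_fset_set //; apply/idP/idP; first by rewrite inE => /hS.
by move/hS => ?; rewrite inE.
Qed.

End Classes.

Section QuadraticExtension.
Variables (F : finFieldType) (P : {poly F}) (L : fieldExtType {fraction {poly F}}) (s : L).
Local Notation K := {fraction {poly F}}.
Local Notation d := (pdeg P).
Local Notation D := ((-1) ^+ d * P).
Local Notation q := #|F|.
Hypothesis q_odd : odd q.
Hypotheses (P_monic : P \is monic) (P_irr : irreducible_poly P).
Hypothesis s_sqr : s ^+ 2 = (D%:F)%:A.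
Variables c1 c2 : L -> K.
Hypothesis coordE : forall x, x = (c1 x)%:A + c2 x *: s.
Local Notation nrm := (qnorm D%:F c1 c2).
Local Notation h := (uphalf d).
Local Notation emb f := ((f%:F)%:A : L).
Local Notation dg v := (place_degree v).
Variable above : option {poly F} -> seq (place L).
Hypothesis aboveP : lies_above P c1 c2 above.
Implicit Types (p v : place L) (x y : L) (i : option {poly F}).
Implicit Types (E : place L -> int) (f g Q : {poly F}).

Definition idx p := xget None [set i | kidx i /\ p \in above i]%classic.

Lemma idxP p : kidx (idx p) /\ p \in above (idx p).
Proof.
have [i ki pi] := place_over q_odd P_monic P_irr s_sqr coordE aboveP p.
by apply: (@xgetPex _ None [set i | kidx i /\ p \in above i]%classic); exists i.
Qed.

Lemma idxE p i : kidx i -> p \in above i -> idx p = i.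
Proof.
have [k1 h1] := idxP p => ki hi.
exact: (place_over_uniq aboveP k1 ki h1 hi).
Qed.

Lemma kd_gt0 i : kidx i -> (0 < kd i)%N.
Proof. by move/kplaceP; case. Qed.

Lemma place_degree_gt0 p : (0 < place_degree p)%N.
Proof.
have [ki hi] := idxP p; have k0 := kd_gt0 ki.
have [_ _ _ _] := aboveP ki; case=> [[_ [p1 [p2 [E d1 d2]]]]|[_ [p1 [E d1]]]|[_ [p1 [E d1]]]].
- by move: hi; rewrite E !inE => /orP[]/eqP pE; rewrite {1}pE ?d1 ?d2.
- by move: hi; rewrite E inE => /eqP pE; rewrite {1}pE d1.
by move: hi; rewrite E inE => /eqP pE; rewrite {1}pE d1 muln_gt0.
Qed.

Definition above_seq (ws : seq (option {poly F})) := flatten [seq above i | i <- ws].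

Lemma mem_above_seq ws p : all (@kidx F) ws -> (p \in above_seq ws) = (idx p \in ws).
Proof.
move=> /allP kw; apply/flatten_mapP/idP => [[i iw pi]|h].
  by rewrite (idxE (kw _ iw) pi).
by exists (idx p) => //; case: (idxP p).
Qed.

Lemma above_seq_uniq ws : all (@kidx F) ws -> uniq ws -> uniq (above_seq ws).
Proof.
elim: ws => //= i ws IH /andP[ki kws] /andP[iw uw].
rewrite cat_uniq -/(above_seq ws) IH // andbT; have [-> _ _ _ _] := aboveP ki.
apply/hasPn => p; rewrite mem_above_seq //.
by apply: contraTN => pi; rewrite (idxE ki pi).
Qed.

Lemma sum_above_seq (V : nmodType) (f : place L -> V) ws :
  \sum_(v <- above_seq ws) f v = \sum_(i <- ws) \sum_(v <- above i) f v.
Proof. by rewrite big_flatten big_map. Qed.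

Definition with_oo (Qs : seq {poly F}) := None :: [seq Some Q | Q <- Qs].

Lemma with_oo_uniq Qs : uniq (with_oo Qs) = uniq Qs.
Proof.
rewrite /= map_inj_uniq; last by move=> ? ? [].
by rewrite andb_idl // => _; apply/mapP => -[].
Qed.

Lemma with_oo_kidx Qs : all (@kidx F) (with_oo Qs) = all (@mirr F) Qs.
Proof. by rewrite /= all_map. Qed.

Lemma mem_with_oo Q Qs : (Some Q \in with_oo Qs) = (Q \in Qs).
Proof. by rewrite inE /= mem_map // => ? ? []. Qed.

Lemma vord_support (a : K) : exists2 Qs0 : seq {poly F}, all (@mirr F) Qs0 &
  forall Q, mirr Q -> Q \notin Qs0 -> vge (vord Q) a 0.
Proof.
have [a0|a0] := eqVneq a 0; first by exists [::] => // Q _ _; rewrite a0 vge_zero.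
have [Qs0 mQ h] := product_formula a0; exists (undup Qs0).
  by apply/allP => Q; rewrite mem_undup; apply/allP.
move=> Q mq Qn; have [||hv _] := h (undup Qs0) (undup_uniq _).
- by apply/allP => Q'; rewrite mem_undup; apply/allP.
- by move=> Q'; rewrite mem_undup.
by rewrite /vge hv // lexx orbT.
Qed.

(** The values above [idx p], weighted by positive degrees, sum to 0 and are nonnegative. *)
Lemma support_place x p : x != 0 -> kw (idx p) (nrm x) = 0 ->
  (forall v, v \in above (idx p) -> vge v x 0) -> p x = 0.
Proof.
have [ki hi] := idxP p => x0 w0 h; have [_ _ hs _ _] := aboveP ki.
have := hs x x0; rewrite w0 mulr0 big_seq => /eqP.
rewrite psumr_eq0 => [/allP /(_ p hi)|v vi]; last first.
  by have := h v vi; rewrite (vgeE v 0 x0) => v0; rewrite mulr_ge0.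
rewrite hi /= mulf_eq0 => /orP[]/eqP //.
by have := place_degree_gt0 p; case: place_degree.
Qed.

(** The degree is that of the divisor of the norm, which is 0 by the product formula. Outside [Qs]
    both coordinates are integral and the norm is a unit, so x has value 0 there. *)
Lemma principal_divisor x : x != 0 ->
  is_divisor (fun p => p x) /\ divisor_degree (fun p => p x) = 0.
Proof.
move=> x0; have n0 := nrm_neq0 q_odd P_monic P_irr s_sqr coordE x0.
have [Q1 m1 h1] := vord_support (c1 x); have [Q2 m2 h2] := vord_support (c2 x).
have [Q3 m3 h3] := product_formula n0.
pose Qs := undup (Q1 ++ Q2 ++ Q3).
have uQ : uniq Qs by exact: undup_uniq.
have mQ : all (@mirr F) Qs.
  apply/allP => Q; rewrite mem_undup !mem_cat => /or3P[]; by [exact: (allP m1)|exact: (allP m2)|exact: (allP m3)].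
have [|h4 h5] := h3 Qs uQ mQ; first by move=> Q; rewrite mem_undup !mem_cat => ->; rewrite !orbT.
have kws : all (@kidx F) (with_oo Qs) by rewrite with_oo_kidx.
have uws : uniq (above_seq (with_oo Qs)) by rewrite above_seq_uniq // with_oo_uniq.
have sup : supported (fun p => p x) (above_seq (with_oo Qs)).
  move=> p; apply: contraNT; rewrite mem_above_seq // => pn; apply/eqP.
  have [ki hi] := idxP p; apply: support_place => //.
    move: ki pn; case: (idx p) => [Q|//]; rewrite mem_with_oo => mq Qn /=.
    exact: h4.
  have [_ _ _ hint _] := aboveP ki; apply/hint; move: ki pn; clear hi hint.
  case: (idx p) => [Q|//]; rewrite mem_with_oo => mq Qn /=.
  move: Qn; rewrite mem_undup !mem_cat !negb_or => /and3P[n1 n2 n3].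
  by rewrite h1 // h2.
split; first by apply/is_divisorP; exists (above_seq (with_oo Qs)).
rewrite (divisor_degree_seq uws sup) sum_above_seq.
rewrite big_seq (eq_bigr (fun i => (kd i)%:Z * kw i (nrm x))); last first.
  move=> i iw; have [_ _ <- // _ _] := aboveP (allP kws i iw).
  by apply: eq_bigr => v _; rewrite mulrC.
rewrite -big_seq big_cons big_map /= mul1r addrC; exact: h5.
Qed.

(** * Riemann's inequality *)

Definition RR E x := forall v, vge v x (- E v).

Lemma RR0 E : RR E 0. Proof. by move=> v; rewrite vge_zero. Qed.

Lemma RRD E x y : RR E x -> RR E y -> RR E (x + y).
Proof. by move=> hx hy v; apply: (vgeD (pval_valuation v)). Qed.

Lemma RRZ E (c : F) x : RR E x -> RR E (const L c * x).
Proof.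
move=> hx v; have [->|c0] := eqVneq c 0.
  by rewrite /const polyC0 tofrac0 scale0r mul0r vge_zero.
have cn0 : const L c != 0 by rewrite /const algA_eq0 tofrac_eq0 polyC_eq0.
by rewrite (vgeMl (pval_valuation v)) ?pval_const.
Qed.

Lemma const1 : const L 1 = 1. Proof. by rewrite /const polyC1 tofrac1 scale1r. Qed.
Lemma constD (a b : F) : const L (a + b) = const L a + const L b.
Proof. by rewrite /const polyCD tofracD scalerDl. Qed.
Lemma constM (a b : F) : const L (a * b) = const L a * const L b.
Proof. by rewrite /const polyCM tofracM -scalerAl mul1r scalerA. Qed.

Lemma RR_power E n : has_card (RR E) n -> exists k, n = (q ^ k)%N.
Proof.
apply: (@vector_card F L (fun c x => const L c * x)).
- by move=> c x y; rewrite mulrDr.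
- by move=> c c' x; rewrite constD mulrDl.
- by move=> c c' x; rewrite mulrA constM.
- by move=> x; rewrite const1 mul1r.
- exact: RR0.
- exact: RRD.
- exact: RRZ.
Qed.

(** A positive [place_degree] is not the default of [xget], so it comes from a basis. *)
Lemma place_basis v : exists e : 'I_(place_degree v) -> L, residue_basis v e.
Proof.
have := place_degree_gt0 v.
by rewrite {1}/place_degree; case: xgetP => // n -> he.
Qed.

Lemma place_surj v (N : int) : exists2 y, y != 0 & v y = N.
Proof.
have vv := pval_valuation v; have [x x0 vx] := pval_surj v.
case: N => n; first by exists (x ^+ n); rewrite ?expf_neq0 // (valX vv) // vx mulr1.
exists (x ^+ n.+1)^-1; first by rewrite invr_eq0 expf_neq0.
by rewrite (valV vv) ?expf_neq0 // (valX vv) // vx mulr1.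
Qed.

Definition add_place E v := fun u => E u + (if u == v then 1 else 0).

(* x |-> the residue at v of x y, with v y = E v + 1, has kernel RR E *)
Lemma RR_step E v n k : has_card (RR (add_place E v)) n -> has_card (RR E) k ->
  (n <= k * q ^ place_degree v)%N.
Proof.
move=> [S [uS hS <-]] [T [uT hT <-]]; have vv := pval_valuation v.
have [y y0 vy] := place_surj v (E v + 1); have [e [ei eu]] := place_basis v.
have ex x : exists c : {ffun 'I_(place_degree v) -> F}, x \in S ->
    maximal_ideal v (x * y - \sum_(i < place_degree v) const L (c i) * e i).
  have [xS|//] := boolP (x \in S); last by exists [ffun=> 0].
  have /hS/(_ v) hx := xS; rewrite /add_place eqxx in hx.
  have /eu[c [hc _]] : valuation_ring v (x * y).
    apply/valuation_ringE; have := vgeM vv hx (vge_val v y).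
    by rewrite vy addNr.
  by exists c.
have [phi hphi] := choice ex.
rewrite mulnC -[(q ^ _)%N](_ : #|{ffun 'I_(place_degree v) -> F}| = _); last first.
  by rewrite card_ffun card_ord.
apply: (size_fibres_le (phi := phi)) => x xS; rewrite -size_filter.
have -> : size [seq z <- S | phi z == phi x] = size [seq z - x | z <- S & phi z == phi x].
  by rewrite size_map.
apply: uniq_leq_size; first by rewrite map_inj_uniq ?filter_uniq // => a b /addIr.
move=> z /mapP[a]; rewrite mem_filter => /andP[/eqP pax aS] ->; apply/hT => u.
have hx := iffLR (hS x) xS u; have ha := iffLR (hS a) aS u.
have := vgeB (pval_valuation u) ha hx; rewrite /add_place.
case: (eqVneq u v) => [->|_]; last by rewrite addr0.
move=> _; have h1 := iffLR (maximal_idealE v _) (hphi a aS).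
have h2 := iffLR (maximal_idealE v _) (hphi x xS).
have := vgeB vv h1 h2; rewrite pax opprB addrA subrK -mulrBl => h3.
rewrite -[a - x](mulfK y0).
have := vgeM vv h3 (vge_val v y^-1); rewrite (valV vv) // vy.
by rewrite opprD addrCA subrr addr0.
Qed.

Lemma emb_neq0 f : f != 0 -> emb f != 0.
Proof. by move=> f0; rewrite algA_eq0 tofrac_eq0. Qed.

Lemma place_emb v f : vge v (emb f) 0 || (idx v == None).
Proof.
have [ki] := idxP v.
move: ki; case: (idx v) => [Q mQ|]; last by rewrite orbT.
have [_ hm _ _ _] := aboveP (i := Some Q) mQ.
move=> /hm[e e0 he]; rewrite orbF (vge_restrict0 e0 he) /=.
by rewrite -[0]/(0%N%:Z) vge_vord // expr0 dvd1p.
Qed.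

Lemma place_emb_ge0 v f : idx v != None -> f != 0 -> 0 <= v (emb f).
Proof.
move=> iv f0; have := place_emb v f; rewrite (negbTE iv) orbF vgeE //.
exact: emb_neq0.
Qed.

Lemma place_emb_prime v Q : idx v = Some Q -> 1 <= v (emb Q).
Proof.
have [ki] := idxP v.
move=> + E; rewrite E in ki *; have [_ hm _ _ _] := aboveP ki.
move=> /hm[e e0 he]; have Q0 := mirr_neq0 ki.
rewrite -(vgeE v) ?emb_neq0 // (vge_restrict1 e0 he) /=.
by rewrite -[1]/(1%N%:Z) vge_vord // expr1.
Qed.

Lemma place_emb_X v : idx v = None -> v (emb 'X) <= -1.
Proof.
have [ki] := idxP v.
move=> + E; rewrite E in ki *; have [_ hm _ _ _] := aboveP ki.
move=> /hm[e e0 he]; rewrite he ?tofrac_eq0 ?polyX_eq0 //= vinf_poly ?polyX_eq0 //.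
by rewrite /pdeg size_polyX /=; lia.
Qed.

(* m times the divisor of poles of T *)
Definition pole_divisor m v : int := if idx v == None then - (m%:Z * v (emb 'X)) else 0.

Lemma pole_divisor_supported m : supported (pole_divisor m) (above None).
Proof.
move=> v; rewrite /pole_divisor; have [E _|//] := eqVneq (idx v) None.
by rewrite -{1}E; case: (idxP v).
Qed.

(** The norm of T is T^2, with a pole of order 2 at oo. *)
Lemma pole_divisor_degree m :
  is_divisor (pole_divisor m) /\ divisor_degree (pole_divisor m) = (2 * m)%:Z.
Proof.
have [uN _ hs _ _] := aboveP (i := None) isT; have sup := @pole_divisor_supported m.
split; first by apply/is_divisorP; exists (above None).
rewrite (divisor_degree_seq uN sup).
have X0 : emb 'X != 0 by apply: emb_neq0; rewrite polyX_eq0.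
have XK0 : 'X%:F != 0 :> K by rewrite tofrac_eq0 polyX_eq0.
rewrite big_seq (eq_bigr (fun v => - m%:Z * ((place_degree v)%:Z * v (emb 'X)))).
  rewrite -big_seq -mulr_sumr hs //= (qnormA s_sqr coordE (disc_nsq q_odd P_monic P_irr)).
  rewrite (valX (@vinf_valuation F) _ XK0) vinf_poly ?polyX_eq0 // /pdeg size_polyX.
  by lia.
move=> v vN; rewrite /pole_divisor (idxE (i := None)) // eqxx; ring.
Qed.

Let nsq := disc_nsq q_odd P_monic P_irr.

Lemma coordZ (a : K) x : c1 (a *: x) = a * c1 x /\ c2 (a *: x) = a * c2 x.
Proof.
have -> : a *: x = a%:A * x by rewrite -scalerAl mul1r.
rewrite (coord1M s_sqr coordE nsq) (coord2M s_sqr coordE nsq).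
by rewrite (coord1A s_sqr coordE nsq) (coord2A s_sqr coordE nsq) !mul0r mulr0 !addr0.
Qed.

Local Notation X := ('X%:F : K).

Let X0 : X != 0. Proof. by rewrite tofrac_eq0 polyX_eq0. Qed.

Lemma vinf_X : vinf X = -1.
Proof. by rewrite vinf_poly ?polyX_eq0 // /pdeg size_polyX. Qed.

Lemma vge_shift m (f : {poly F}) : vge (@vinf F) ((X ^+ m)^-1 * f%:F) 0 = (size f <= m.+1)%N.
Proof.
have [->|f0] := eqVneq f 0; first by rewrite tofrac0 mulr0 vge_zero size_poly0.
have fF0 : f%:F != 0 :> K by rewrite tofrac_eq0.
have vv := @vinf_valuation F; have Xm0 : X ^+ m != 0 := expf_neq0 m X0.
rewrite vgeE; last exact: mulf_neq0 (invr_neq0 Xm0) fF0.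
rewrite (valM vv (invr_neq0 Xm0) fF0) (valV vv Xm0) (valX vv m X0) vinf_X (vinf_poly f0).
move: f0; rewrite -size_poly_gt0 /pdeg; move: (size f) => u; clear; lia.
Qed.

Lemma kintegral_poly x f g m : (h <= m)%N -> c1 x = f%:F -> c2 x = g%:F ->
  kintegral P c1 c2 None ((X ^+ m)^-1 *: x) = (size f <= m.+1)%N && (size g <= (m - h).+1)%N.
Proof.
move=> hm xf xg; have [e1 e2] := coordZ (X ^+ m)^-1 x.
rewrite /kintegral e1 e2 xf xg vge_shift -mulrA; congr (_ && _).
rewrite -(tofracXn h 'X) -tofracM vge_shift.
have [->|g0] := eqVneq g 0; first by rewrite mul0r size_poly0.
by rewrite size_mulXn //; move: (uphalf _) hm => k; move: (size g) => u; clear; lia.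
Qed.

(** Division by T^m turns the bound above oo into integrality, which [lies_above] describes by
    coordinates. *)
Lemma pole_vge m x : RR (pole_divisor m) x <->
  (forall Q, mirr Q -> kintegral P c1 c2 (Some Q) x) /\ kintegral P c1 c2 None ((X ^+ m)^-1 *: x).
Proof.
have eX0 : emb 'X != 0 by apply: emb_neq0; rewrite polyX_eq0.
have shift v : vge v ((X ^+ m)^-1 *: x) 0 = vge v x (m%:Z * v (emb 'X)).
  have vv := pval_valuation v; have E := scale_invX x m X0.
  have y0 : (emb 'X ^+ m)^-1 != 0 := invr_neq0 (expf_neq0 m eX0).
  rewrite E; have [->|x0] := eqVneq x 0; first by rewrite mulr0 !vge_zero.
  rewrite (vgeE v _ (mulf_neq0 y0 x0)) (vgeE v _ x0) (valM vv y0 x0).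
  rewrite (valV vv (expf_neq0 m eX0)) (valX vv m eX0).
  by rewrite addrC subr_ge0.
split=> [hx|[hf hi] v].
  split=> [Q mQ|].
    have [_ _ _ hint _] := aboveP (i := Some Q) mQ; apply/hint => p hp.
    by have := hx p; rewrite /pole_divisor (idxE (i := Some Q) mQ hp) /= oppr0.
  have [_ _ _ hint _] := aboveP (i := None) isT; apply/hint => p hp.
  by have := hx p; rewrite /pole_divisor (idxE (i := None) isT hp) /= opprK shift.
have [ki hv] := idxP v.
rewrite /pole_divisor; move: ki hv; case: (idx v) => [Q mQ hv|_ hv] /=.
  have [_ _ _ hint _] := aboveP (i := Some Q) mQ.
  by rewrite oppr0; exact: (iffRL (hint x) (hf Q mQ)).
have [_ _ _ hint _] := aboveP (i := None) isT.
by rewrite opprK -shift; exact: (iffRL (hint _) hi).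
Qed.

(** Integrality at all finite places makes the coordinates polynomials; the condition at oo bounds
    their degrees by m and m - h, the offset coming from the basis 1, T^(-h) s. *)
Lemma RR_pole m x : (h <= m)%N -> RR (pole_divisor m) x <->
  exists2 fg : {poly_m.+1 F} * {poly_(m - h).+1 F}, True &
    x = emb (polyn fg.1) + (polyn fg.2)%:F *: s.
Proof.
move=> hm; rewrite pole_vge; split=> [[hf hi]|[[f g] _ xE]]; last rewrite /= in xE.
  have [f fE] : exists f, c1 x = f%:F.
    by apply: fraction_integral => Q mQ; have /andP[] := hf Q mQ.
  have [g gE] : exists g, c2 x = g%:F.
    by apply: fraction_integral => Q mQ; have /andP[] := hf Q mQ.
  move: hi; rewrite (kintegral_poly hm fE gE) => /andP[sf sg].
  exists (NPoly sf, NPoly sg) => //=.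
  by rewrite {1}(coordE x) fE gE.
have e1 : c1 x = (polyn f)%:F by rewrite xE (coord1E s_sqr coordE nsq).
have e2 : c2 x = (polyn g)%:F by rewrite xE (coord2E s_sqr coordE nsq).
split=> [Q mQ|]; last by rewrite (kintegral_poly hm e1 e2) !size_npoly.
by rewrite /= e1 e2 -[0]/(0%N%:Z) !vge_vord // expr0 !dvd1p.
Qed.

Lemma RR_pole_card m : (h <= m)%N ->
  has_card (RR (pole_divisor m)) (q ^ (m.+1 + (m - h).+1)).
Proof.
move=> hm; apply: (@has_card_image _ _ (fun _ => True) _
  (fun fg : {poly_m.+1 F} * {poly_(m - h).+1 F} => emb (polyn fg.1) + (polyn fg.2)%:F *: s)).
- move=> [f g] [f' g'] _ _ /= /(coord_uniq s_sqr nsq)[].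
  by move=> /eqP + /eqP; rewrite !tofrac_eq => /eqP/val_inj-> /eqP/val_inj->.
- by move=> y; exact: RR_pole.
exists (enum {: {poly_m.+1 F} * {poly_(m - h).+1 F}}); split; first exact: enum_uniq.
  by move=> y; rewrite mem_enum.
by rewrite -cardE card_prod !card_npoly expnD.
Qed.

(** Induction on a bound for deg E, removing from E one place v where it is positive. By [RR_step]
    each such v costs at most a factor q^(deg v), and for E = 0 the space is known exactly. *)
Lemma RR_lower m E : (h <= m)%N -> is_divisor E -> (forall v, 0 <= E v) ->
  exists k, has_card (RR (fun v => pole_divisor m v - E v)) k /\
    (q ^ (m.+1 + (m - h).+1) <= k * q ^ `|divisor_degree E|)%N.
Proof.
move=> hm; pose deg E := `|divisor_degree E|%N.
have [n le] : exists n, (deg E <= n)%N by exists (deg E).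
elim: n E le => [|n IH] E le hE E0.
  all: have dE := divisor_degree_ge0 hE E0.
  all: have [[v Ev]|nE] := pselect (exists v, 0 < E v); last first.
  1,3: have Ez v : E v = 0 by apply/eqP; rewrite eq_le E0 andbT leNgt; apply/negP => ?; apply: nE; exists v.
  1,2: exists (q ^ (m.+1 + (m - h).+1))%N; split;
    [|by rewrite leq_pmulr // expn_gt0 ltnW // card_finNzRing_gt1].
  1,2: apply: has_card_ext (RR_pole_card hm) => x;
    by split=> hx v; have := hx v; rewrite Ez subr0.
all: have [hv dv] := divisor_scaled_place v 1.
all: have [hE' dE'] := divisorB hE hv.
all: pose E' u : int := E u - (if u == v then 1 else 0).
all: have E'0 u : 0 <= E' u by rewrite /E'; case: eqVneq => [->|_]; [move: Ev; move: (E v) => w; clear; lia|rewrite subr0].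
all: have dE'0 := divisor_degree_ge0 hE' E'0.
all: have dvp := place_degree_gt0 v.
  exfalso; move: le dE'0 dE dE' dv dvp; rewrite /deg.
  by rewrite -/E'; move: (divisor_degree E) (divisor_degree E') (divisor_degree _) (dg v) => a b c u; clear; lia.
have [|k' [hk' lk']] := IH E' _ hE' E'0.
  move: le dE'0 dE dE' dv dvp; rewrite /deg -/E'.
  by move: (divisor_degree E) (divisor_degree E') (divisor_degree _) (dg v) => a b c u; clear; lia.
have sub x : RR (fun u => pole_divisor m u - E u) x ->
    RR (fun u => pole_divisor m u - E' u) x.
  move=> hx u; apply: vge_le (hx u); rewrite /E'.
  by move: (pole_divisor _ _) (E u) => a b; case: (u == v); clear; lia.
have [k hk] := has_card_sub sub hk'.
exists k; split=> //; apply: leq_trans lk' _.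
have st : has_card (RR (add_place (fun u => pole_divisor m u - E u) v)) k'.
  have e u : add_place (fun u => pole_divisor m u - E u) v u = pole_divisor m u - E' u.
    by rewrite /add_place /E' opprB addrA addrAC.
  by apply: has_card_ext hk' => x; split=> hx u; have := hx u; rewrite e.
have := RR_step st hk.
have -> : (`|divisor_degree E| = dg v + `|divisor_degree E'|)%N.
  move: dE'0 dE dE' dv dvp; rewrite -/E'.
  by move: (divisor_degree E) (divisor_degree E') (divisor_degree _) (dg v) => a b c u; clear; lia.
by move=> hh; rewrite expnD mulnA leq_mul2r hh orbT.
Qed.

(* Multiplying by a polynomial reduces Riemann's inequality to divisors bounded by
   a pole_divisor m, for which the space is explicit. *)
Lemma kill_finite E : is_divisor E -> exists2 f : {poly F}, f != 0 &
  forall v, idx v != None -> E v <= v (emb f).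
Proof.
move=> /is_divisorP[S uS sE].
pose g v : {poly F} := if idx v is Some Q then Q ^+ `|E v| else 1.
have g0 v : g v != 0.
  have [ki _] := idxP v.
  rewrite /g; move: ki; case: (idx v) => [Q mQ|_]; last exact: oner_neq0.
  by rewrite expf_neq0 // mirr_neq0.
exists (\prod_(v <- S) g v).
  by rewrite prodf_seq_neq0; apply/allP => v _; rewrite /= g0.
move=> v iv; have vv := pval_valuation v.
have embM f f' : emb (f * f') = emb f * emb f'.
  by rewrite tofracM -scalerAl mul1r scalerA.
have embX f n : emb (f ^+ n) = emb f ^+ n.
  by rewrite tofracXn exprZn expr1n.
have [Ev|Ev] := eqVneq (E v) 0.
  rewrite Ev; apply: (place_emb_ge0) => //.
  by rewrite prodf_seq_neq0; apply/allP => u _; rewrite /= g0.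
rewrite (bigD1_seq v) ?sE //= embM.
set r := \prod_(_ <- _ | _) _.
have r0 : r != 0 by rewrite prodf_seq_neq0; apply/allP => u _; rewrite g0 implybT.
rewrite (valM vv) ?emb_neq0 //.
have := place_emb_ge0 iv r0.
rewrite {1}/g; case vQ : (idx v) iv => [Q|//] _.
have := place_emb_prime vQ.
have Q0 : Q != 0.
  by have [ki _] := idxP v; rewrite vQ in ki; exact: mirr_neq0 ki.
rewrite embX (valX vv) ?emb_neq0 //.
by move: (v (emb Q)) (v (emb r)) (E v) => a b c; clear; nia.
Qed.

Lemma RR_mul E (y : L) k : y != 0 -> has_card (RR (fun v => E v - v y)) k -> has_card (RR E) k.
Proof.
move=> y0; apply: (@has_card_image _ _ _ _ (fun x => x * y^-1)).
  by move=> x x' _ _; apply: mulIf; rewrite invr_eq0.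
have yi0 : y^-1 != 0 by rewrite invr_eq0.
move=> x; split=> [hx|[z hz ->] v].
  exists (x * y); last by rewrite mulfK.
  move=> v; have := vgeM (pval_valuation v) (hx v) (vge_val v y).
  by rewrite opprB addrC.
have vv := pval_valuation v.
have := vgeM vv (hz v) (vge_val v y^-1); rewrite (valV vv) //.
by rewrite opprB addrAC subrr add0r.
Qed.

(* Riemann's inequality: h is the genus of L plus 1. *)
Lemma RR_card E : is_divisor E -> exists l : nat, has_card (RR E) (q ^ l)%N /\
  divisor_degree E + 2 - h%:Z <= l%:Z.
Proof.
move=> hE; have [f f0 hf] := kill_finite hE.
have y0 : emb f != 0 := emb_neq0 f0.
have [hy dy] := principal_divisor y0.
have [hE' dE'] := divisorB hE hy.
pose E' v := E v - v (emb f).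
have [m hm hmE] : exists2 m, (h <= m)%N & forall v, E' v <= pole_divisor m v.
  (* Above oo the divisor of poles of T has multiplicity at least 1, so m >= b dominates [E']
     there. *)
  pose b := (\sum_(v <- above None) `|E' v|)%N.
  exists (h + b)%N; first exact: leq_addr.
  move=> v; rewrite /pole_divisor; have [iv|iv] := eqVneq (idx v) None; last first.
    by rewrite subr_le0 hf.
  have vN : v \in above None.
    by rewrite -iv; case: (idxP v).
  have le : (`|E' v| <= b)%N by rewrite /b (bigD1_seq v) ?leq_addr //=; case: (aboveP (i := None) isT).
  have := place_emb_X iv.
  move: le; move: (E' v) (v (emb 'X)) b (uphalf _) => a c b' u; clear; nia.
have [hp dp] := pole_divisor_degree m.
have [hB dB] := divisorB hp hE'.
have B0 v : 0 <= pole_divisor m v - E' v by rewrite subr_ge0.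
have dB0 := divisor_degree_ge0 hB B0.
have [k [hk lk]] := RR_lower hm hB B0.
have hk' : has_card (RR E) k.
  apply: (RR_mul y0); apply: has_card_ext hk => x.
  by split=> hx v; have := hx v; rewrite subKr.
have [l kl] := RR_power hk'; exists l; rewrite -kl; split=> //.
(* Comparison of exponents: 2 m + 2 - h <= l + (2 m - deg E). *)
move: lk dB0; rewrite kl -expnD leq_exp2l ?card_finNzRing_gt1 // dB dp dE' dy subr0.
move: (divisor_degree E) hm => a; move: (uphalf _) => u; clear; lia.
Qed.

(** * Counting effective divisors *)

(** The degree of the part of E above i. *)
Definition weight E i : int := \sum_(v <- above i) (dg v)%:Z * E v.

Definition local_divisor i (k : nat) E : Prop :=
  [/\ forall v, 0 <= E v, forall v, v \notin above i -> E v = 0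
    & weight E i = (kd i * k)%:Z].

Lemma geometric_count (e : int) (k : nat) : e = 0 \/ e = -1 ->
  \sum_(j < k.+1) e ^+ j = ((e == 0) || ~~ odd k)%:Z.
Proof.
case=> ->; elim: k => [|k IH]; rewrite big_ord_recr /=; [by rewrite big_ord0| |by rewrite big_ord0|].
  by rewrite IH expr0n addr0.
rewrite IH /= -signr_odd /=; by case: odd.
Qed.

(* The local factor of the zeta function of L at i. *)
Lemma local_count i k : kidx i -> exists2 c, has_card (local_divisor i k) c &
  c%:Z = \sum_(j < k.+1) eps P i ^+ j.
Proof.
move=> ki; have k0 := kd_gt0 ki; have [uA _ _ _] := aboveP ki.
case=> [[e1 [p1 [p2 [aE d1 d2]]]]|[e0 [p1 [aE d1]]]|[em [p1 [aE d1]]]].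
- rewrite aE /= inE andbT in uA.
  exists k.+1; last first.
    by rewrite e1; under eq_bigr do rewrite expr1n; rewrite sumr_const card_ord natz.
  pose fE (a : 'I_k.+1) v : int := if v == p1 then a%:Z else if v == p2 then (k - a)%N%:Z else 0.
  have fE1 a : fE a p1 = a by rewrite /fE eqxx.
  have fE2 a : fE a p2 = (k - a)%N by rewrite /fE eq_sym (negbTE uA) eqxx.
  apply: (@has_card_image _ _ (fun _ => True) _ fE k.+1).
  + by move=> a b _ _ /(congr1 (@^~ p1)); rewrite !fE1 => -[] /val_inj.
  + move=> E; rewrite /local_divisor /weight aE big_cons big_seq1 d1 d2.
    split=> [[Epos Eoff]|[a _ ->]].
      rewrite -mulrDr PoszM => /mulfI; rewrite eqz_nat -lt0n => /(_ k0) Es.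
      have := Epos p1; have := Epos p2 => e2p e1p.
      have lt : (`|E p1| < k.+1)%N by move: Es e2p e1p; move: (E p1) (E p2) => u v; clear; lia.
      exists (Ordinal lt) => //; apply: funext => v; rewrite /fE /=.
      have [->|v1] := eqVneq v p1; first by rewrite gez0_abs.
      have [->|v2] := eqVneq v p2; last by rewrite Eoff // !inE negb_or v1.
      by move: Es e2p e1p; move: (E p1) (E p2) => u w; clear; lia.
    rewrite fE1 fE2; have := ltn_ord a; split=> //.
    * by move=> v; rewrite /fE; case: ifP => // _; case: ifP.
    * by move=> v; rewrite !inE negb_or /fE => /andP[/negbTE-> /negbTE->].
    by rewrite -mulrDr PoszM; congr (_ * _); lia.
  exists (enum 'I_k.+1); split; [exact: enum_uniq|by move=> a; rewrite mem_enum|by rewrite size_enum_ord].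
- exists 1%N; last by rewrite geometric_count ?e0; [rewrite eqxx|left].
  exists [:: fun v => if v == p1 then k%:Z else 0]; split=> // E.
  rewrite inE /local_divisor /weight aE big_seq1 d1; split=> [/eqP->|[Epos Eoff]].
    split=> [v|v|]; [by case: ifP|by rewrite inE => /negbTE->|by rewrite eqxx PoszM].
  rewrite PoszM => /mulfI; rewrite eqz_nat -lt0n => /(_ k0) Es.
  apply/eqP/funext => v; have [->//|v1] := eqVneq v p1.
  by rewrite Eoff // inE.
exists (~~ odd k : nat); last by rewrite geometric_count ?em; [|right].
have [ok|ek] := boolP (odd k); last first.
  exists [:: fun v => if v == p1 then (k./2)%:Z else 0]; split=> // E.
  have kE : k = (2 * k./2)%N by rewrite mul2n -[LHS]odd_double_half (negbTE ek).
  rewrite inE /local_divisor /weight aE big_seq1 d1; split=> [/eqP->|[Epos Eoff]].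
    split=> [v|v|]; [by case: ifP|by rewrite inE => /negbTE->|].
    by rewrite eqxx -PoszM [X in _ = Posz (_ * X)]kE; congr Posz; rewrite mulnAC mulnC.
  rewrite [X in _ = Posz (_ * X)]kE => Es.
  have {}Es : E p1 = k./2.
    have : (kd i)%:Z * (2 * E p1) = (kd i)%:Z * (2 * (k./2)%:Z).
      by move: Es; move: (E p1) (k./2) (kd i) => u w z; clear; lia.
    by move/mulfI; rewrite eqz_nat -lt0n => /(_ k0) /mulfI -> //.
  apply/eqP/funext => v; have [->//|v1] := eqVneq v p1.
  by rewrite Eoff // inE.
exists [::]; split=> // E; split=> // -[Epos _].
rewrite /weight aE big_seq1 d1 => Es; exfalso.
have : (kd i)%:Z * (2 * E p1) = (kd i)%:Z * k%:Z.
  by move: Es; move: (E p1) (kd i) => u z Es; clear - Es; lia.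
move/mulfI; rewrite eqz_nat -lt0n => /(_ k0) Ek.
have := Epos p1; move: (E p1) ok Ek => u ok Ek up; clear - ok Ek; lia.
Qed.

(* E is effective with norm the divisor of f plus k times the place at oo *)
Definition norm_divisor f k E : Prop :=
  [/\ forall v, 0 <= E v, weight E None = k%:Z
    & forall Q, mirr Q -> weight E (Some Q) = (pdeg Q * ord Q f)%N%:Z].

Lemma weight0 E i : (forall v, 0 <= E v) -> weight E i = 0 ->
  forall v, v \in above i -> E v = 0.
Proof.
move=> E0 /eqP; rewrite /weight big_seq psumr_eq0 => [/allP h v vi|v _]; last by rewrite mulr_ge0.
have := h v vi; rewrite vi /= mulf_eq0 => /orP[|/eqP//].
by have := place_degree_gt0 v; case: place_degree.
Qed.

Lemma norm_divisor_one k E : norm_divisor 1 k E <-> local_divisor None k E.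
Proof.
have o1 Q : mirr Q -> ord Q (1 : {poly F}) = 0%N.
  move=> /mirrP[_ iQ]; apply: ord0 => //; rewrite dvdp1.
  by case: iQ; case: size => [|[]].
split=> [[E0 ek hQ]|[E0 Eoff ek]].
  split=> //; last by rewrite mul1n.
  move=> v vN; have [ki vi] := idxP v; move: ki vi; case ie : (idx v) => [Q|] mQ vi; last by rewrite vi in vN.
  by apply: (weight0 E0 _ vi); rewrite hQ // o1 // muln0.
split=> //; first by rewrite ek mul1n.
move=> Q mQ; rewrite o1 // muln0 /weight big_seq big1 // => v vQ.
rewrite Eoff ?mulr0 //; apply/negP => vN.
by have := idxE (i := Some Q) mQ vQ; rewrite (idxE (i := None) isT vN).
Qed.

(** E is cut into its part above Q and the rest; g is prime to Q, so the two have disjoint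
    supports. *)
Lemma norm_divisor_mul Q n g k E : mirr Q -> g != 0 -> ~~ (Q %| g) ->
  norm_divisor (Q ^+ n * g) k E <->
  exists2 z : (place L -> int) * (place L -> int),
    norm_divisor g k z.1 /\ local_divisor (Some Q) n z.2 & E = (fun v => z.1 v + z.2 v).
Proof.
move=> mQ g0 Qg; have [_ iQ] := mirrP mQ; have Q0 := mirr_neq0 mQ.
have oQ : ord Q (Q ^+ n * g) = n by exact: (ord_eq iQ erefl Qg).
have oQ' Q' : mirr Q' -> Q' != Q -> ord Q' (Q ^+ n * g) = ord Q' g.
  move=> mQ' QQ'; have [_ iQ'] := mirrP mQ'.
  rewrite ordM ?expf_neq0 // (ord0 iQ' (f := Q ^+ n)) ?add0n //.
  apply/negP => h; case/negP: QQ'; apply/eqP; apply: mirr_dvd => //.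
  rewrite -(ord_gt0 iQ') // ; move: h; elim: (n) => [|m IH].
    by rewrite expr0 dvdp1; case: iQ'; case: size => [|[]].
  by rewrite exprS irr_dvdM // => /orP[|/IH //]; rewrite ord_gt0.
have above_disj i j v : kidx i -> kidx j -> v \in above i -> v \in above j -> i = j.
  exact: place_over_uniq aboveP v i j.
split=> [[E0 ek hQ]|[[E1 E2] [[/= E10 ek hQ1] [E20 E2off wE2]] EE]].
  exists (fun v => if v \in above (Some Q) then 0 else E v,
          fun v => if v \in above (Some Q) then E v else 0) => /=; last first.
    by apply: funext => v; case: ifP; rewrite ?add0r ?addr0.
  split; split.
  - by move=> v; case: ifP.
  - rewrite -ek /weight big_seq [RHS]big_seq; apply: eq_bigr => v vN.
    by case: ifP => // vQ; have := above_disj None (Some Q) v isT mQ vN vQ.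
  - move=> Q' mQ'; have [->|QQ'] := eqVneq Q' Q.
      rewrite (ord0 iQ Qg) muln0 /weight big_seq big1 // => v vQ.
      by rewrite vQ mulr0.
    rewrite -oQ' // -hQ // /weight big_seq [RHS]big_seq; apply: eq_bigr => v vQ'.
    case: ifP => // vQ; have [e] := above_disj (Some Q') (Some Q) v mQ' mQ vQ' vQ.
    by rewrite e eqxx in QQ'.
  - by move=> v; case: ifP.
  - by move=> v /negbTE->.
  rewrite /= -{1}oQ -hQ // /weight big_seq [RHS]big_seq; apply: eq_bigr => v vQ.
  by rewrite vQ.
rewrite /= in EE E20 E2off wE2.
have w2 i : kidx i -> i != Some Q -> weight E i = weight E1 i.
  move=> ki iQ'; rewrite EE /weight big_seq [RHS]big_seq; apply: eq_bigr => v vi.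
  rewrite E2off ?addr0 //; apply/negP => vQ.
  by move: iQ'; rewrite (above_disj _ _ _ ki (mQ : kidx (Some Q)) vi vQ) eqxx.
split; first by move=> v; rewrite EE addr_ge0.
  by rewrite w2.
move=> Q' mQ'; have [->|QQ'] := eqVneq Q' Q; last first.
  by rewrite w2 ?hQ1 ?oQ' //; apply: contra QQ' => /eqP[->].
rewrite oQ -wE2 EE /weight big_seq [RHS]big_seq; apply: eq_bigr => v vQ.
by rewrite (weight0 E10 _ vQ) ?add0r // hQ1 // (ord0 iQ Qg) muln0.
Qed.

(** The Euler product, coefficient by coefficient: induction removes the full power of one prime Q,
    whose local count is the factor of [divisor_sum] at Q. The case f = 1 leaves the factor at
    oo. *)
Lemma norm_divisor_count f k : f \is monic -> exists2 c, has_card (norm_divisor f k) c &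
  c%:Z = (\sum_(j < k.+1) eps P None ^+ j) * divisor_sum (legendre P) f.
Proof.
have lM := legendreM P_monic P_irr q_odd.
have l1 : legendre P 1 = 1 by exact: (legendre_one P_monic P_irr).
move: {2}(size f) (leqnn (size f)) => n; elim: n f => [|n IH] f.
  by rewrite size_poly_leq0 => /eqP->; rewrite monicE lead_coef0 eq_sym oner_eq0.
move=> sf mf; have f0 := monic_neq0 mf; have [f1|f1] := leqP (size f) 1.
  have -> : f = 1.
    have /eqP/size_poly1P[c c0 fc] : size f = 1%N by apply/eqP; rewrite eqn_leq f1 size_poly_gt0.
    by move: mf; rewrite fc monicE lead_coefC => /eqP->.
  have [c hc cE] := local_count k (i := None) isT.
  exists c; last by rewrite divisor_sum1 // mulr1.
  by apply: has_card_ext hc => E; rewrite norm_divisor_one.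
have [Q mQ Qf] := exists_mirr f1; have [mo iQ] := mirrP mQ.
have [g fE Qg] := ordP iQ f0; have o1 : (0 < ord Q f)%N by rewrite ord_gt0.
have g0 : g != 0 by apply: contraNneq Qg => ->; rewrite dvdp0.
have mg : g \is monic by move: mf; rewrite fE monicMl ?monic_exp.
have Q0 := mirr_neq0 mQ.
have sg : (size g <= n)%N.
  rewrite -ltnS (leq_trans _ sf) // {1}fE size_monicM ?monic_exp //.
  have := size_exp Q (ord Q f); have [sQ _] := iQ; move: sQ o1 g0.
  have : (0 < size (Q ^+ ord Q f)%R)%N by rewrite size_poly_gt0 expf_neq0.
  rewrite -size_poly_gt0; move: (size (Q ^+ ord Q f)%R) => a.
  by move: (size Q) (size g) (ord Q f) => b c u; clear; nia.
have [c hc cE] := IH g sg mg.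
have [c' hc' cE'] := local_count (ord Q f) (i := Some Q) mQ.
exists (c * c')%N; last first.
  by rewrite fE divisor_sum_mul // PoszM cE cE' /= mulrCA mulrC !mulrA.
apply: (has_card_image (f := fun z v => z.1 v + z.2 v) _ _ (has_card_prod hc hc')).
  move=> [E1 E2] [E1' E2'] [/= h1 [E20 E2off _]] [/= h1' [E20' E2off' _]] /= EE.
  have z v : v \in above (Some Q) -> E1 v = 0 /\ E1' v = 0.
    case: h1 h1' => [E10 _ hQ] [E10' _ hQ'] vQ.
    by split; [apply: (weight0 E10 _ vQ)|apply: (weight0 E10' _ vQ)];
    rewrite ?hQ ?hQ' // (ord0 iQ Qg) muln0.
  have e v : E1 v = E1' v /\ E2 v = E2' v.
    have /= := congr1 (fun h => h v) EE; have [vQ|vQ] := boolP (v \in above (Some Q)).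
      by have [-> ->] := z v vQ; rewrite !add0r.
    by rewrite E2off // E2off' // !addr0.
  by congr pair; apply: funext => v; case: (e v).
by move=> E; rewrite {1}fE norm_divisor_mul.
Qed.

Definition effective_of_degree n E : Prop :=
  [/\ is_divisor E, forall v, 0 <= E v & divisor_degree E = n%:Z].

Lemma divisor_degree_weight E Qs : uniq Qs -> all (@mirr F) Qs ->
  (forall v, E v != 0 -> idx v \in with_oo Qs) ->
  is_divisor E /\ divisor_degree E = weight E None + \sum_(Q <- Qs) weight E (Some Q).
Proof.
move=> uQ mQ h; have kws : all (@kidx F) (with_oo Qs) by rewrite with_oo_kidx.
have uws : uniq (above_seq (with_oo Qs)).
  by rewrite (above_seq_uniq) // with_oo_uniq.
have sup : supported E (above_seq (with_oo Qs)).
  by move=> v /h; rewrite (mem_above_seq).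
split; first by apply/is_divisorP; exists (above_seq (with_oo Qs)).
rewrite (divisor_degree_seq uws sup) sum_above_seq big_cons big_map.
congr (_ + _); first by apply: eq_bigr => v _; rewrite mulrC.
by apply: eq_bigr => Q _; apply: eq_bigr => v _; rewrite mulrC.
Qed.

Lemma norm_divisor_degree f k E : f != 0 -> norm_divisor f k E ->
  is_divisor E /\ divisor_degree E = (k + pdeg f)%N%:Z.
Proof.
move=> f0 [E0 ek hQ]; pose Qs := undup (primes_of f).
have mQs : all (@mirr F) Qs.
  by apply/allP => Q; rewrite mem_undup mem_primes_of // => /andP[].
have [|hE dE] := @divisor_degree_weight E Qs (undup_uniq _) mQs.
  move=> v Ev; have [ki vi] := idxP v; move: ki vi.
  case: (idx v) => [Q|//] mQ vQ; rewrite mem_with_oo mem_undup mem_primes_of // -[mirr Q]/(kidx (Some Q)) mQ.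
  have [_ iQ] := mirrP mQ; rewrite -ord_gt0 // lt0n; apply: contraNneq Ev => o0.
  by rewrite (weight0 E0 _ vQ) // hQ // o0 muln0.
split=> //; rewrite dE ek PoszD; congr (_ + _).
rewrite -(sum_ord f0 (undup_uniq (primes_of f)) mQs) => [|Q]; last by rewrite mem_undup.
rewrite (big_morph Posz PoszD erefl) big_seq [RHS]big_seq.
by apply: eq_bigr => Q QQs; rewrite hQ //; exact: (allP mQs).
Qed.

Lemma ord_prod (Qs : seq {poly F}) (n : {poly F} -> nat) Q : mirr Q -> uniq Qs -> all (@mirr F) Qs ->
  ord Q (\prod_(R <- Qs) R ^+ n R) = if Q \in Qs then n Q else 0%N.
Proof.
move=> mQ; have [_ iQ] := mirrP mQ; elim: Qs => [_ _|R Qs IH /= /andP[RQ uQ] /andP[mR mQs]].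
  rewrite big_nil; apply: ord0 => //; rewrite dvdp1.
  by case: iQ; case: size => [|[]].
have [moR iR] := mirrP mR; have R0 := mirr_neq0 mR.
have p0 : \prod_(R' <- Qs) R' ^+ n R' != 0.
  by rewrite prodf_seq_neq0; apply/allP => R' /(allP mQs)/mirr_neq0 h; rewrite /= expf_neq0.
rewrite big_cons ordM ?expf_neq0 // IH // inE.
have oX m : ord Q (R ^+ m) = (m * (Q == R))%N.
  elim: m => [|m IHm]; last by rewrite exprS ordM ?expf_neq0 // IHm ord_mirr // mulSn.
  by rewrite expr0 mul0n; apply: ord0 => //; rewrite dvdp1; case: iQ; case: size => [|[]].
rewrite oX; have [->|_] := eqVneq Q R; first by rewrite (negbTE RQ) muln1 addn0.
by rewrite muln0 add0n.
Qed.

Lemma weight_multiple E i : kidx i -> (forall v, 0 <= E v) ->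
  exists m : nat, weight E i = (kd i * m)%N%:Z.
Proof.
move=> ki E0; rewrite /weight; have [_ _ _ _] := aboveP ki.
have nn p : E p = `|E p|%N by rewrite gez0_abs.
case=> [[_ [p1 [p2 [-> d1 d2]]]]|[_ [p1 [-> d1]]]|[_ [p1 [-> d1]]]].
- exists (`|E p1| + `|E p2|)%N; rewrite big_cons big_seq1 d1 d2 {1}(nn p1) {1}(nn p2).
  by rewrite mulnDr PoszD !PoszM.
- by exists `|E p1|%N; rewrite big_seq1 d1 {1}(nn p1) PoszM.
by exists (2 * `|E p1|)%N; rewrite big_seq1 d1 {1}(nn p1) mulnCA mulnA PoszM.
Qed.

(** The weight above each place is a multiple of the degree of that place, and the quotients are the
    exponents in f and the integer k. *)
Lemma effective_norm E : is_divisor E -> (forall v, 0 <= E v) ->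
  exists f k, f \is monic /\ norm_divisor f k E.
Proof.
move=> /is_divisorP[S uS sE] E0.
have ex Q : exists m : nat, mirr Q -> weight E (Some Q) = (pdeg Q * m)%N%:Z.
  have [mQ|//] := boolP (mirr Q); last by exists 0%N.
  by have [m hm] := @weight_multiple E (Some Q) mQ E0; exists m.
have [n hn] := choice ex.
have [k hk] := @weight_multiple E None isT E0.
pose Qs := undup (pmap id [seq idx v | v <- S]).
have mQs : all (@mirr F) Qs.
  apply/allP => Q; rewrite mem_undup mem_pmap map_id => /mapP[v _ vE].
  by have [] := idxP v; rewrite -vE.
exists (\prod_(R <- Qs) R ^+ n R), k; split.
  rewrite big_seq; apply: monic_prod => R RQs; rewrite monic_exp //.
  by case: (mirrP (allP mQs R RQs)).
split=> //; first by rewrite hk mul1n.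
move=> Q mQ; rewrite ord_prod ?undup_uniq //; case: ifP => [_|QQs]; first exact: hn.
rewrite muln0 /weight big_seq big1 // => v vQ.
suff -> : E v = 0 by rewrite mulr0.
apply/eqP; apply: contraFT QQs => /sE vS.
rewrite mem_undup mem_pmap map_id; apply/mapP; exists v => //.
by rewrite (idxE (i := Some Q)).
Qed.

Lemma norm_divisor_inj f g k l E : f \is monic -> g \is monic ->
  norm_divisor f k E -> norm_divisor g l E -> f = g /\ k = l.
Proof.
move=> mf mg [_ ek hf] [_ el hg]; split; last by move: el; rewrite ek => -[].
have oo Q : mirr Q -> ord Q f = ord Q g.
  move=> mQ; have := hg Q mQ; rewrite hf // => -[] /eqP.
  by rewrite eqn_pmul2l ?mirr_pdeg // => /eqP.
have f0 := monic_neq0 mf; have g0 := monic_neq0 mg.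
by apply/eqP; rewrite -eqp_monic // /eqp !dvdp_ordP // => Q mQ; rewrite oo.
Qed.

(** Effective divisors are sorted by their norm, given by k at oo and a monic f with k + deg f =
    n. *)
Lemma effective_count n : exists2 A, has_card (effective_of_degree n) A &
  A%:Z = \sum_(k < n.+1) (\sum_(j < k.+1) eps P None ^+ j) *
           \sum_(j < (n - k).+1) legendre_sum P j * (q ^ (n - k - j))%N%:Z.
Proof.
pose W := [seq (k, f) | k <- iota 0 n.+1, f <- monics F (n - k)].
have uW : uniq W.
  apply: allpairs_uniq_dep; [exact: iota_uniq|by move=> k _; exact: monics_uniq|].
  by move=> [k f] [k' f'] _ _ [-> ->].
have memW k f : (k, f) \in W -> (k < n.+1)%N /\ f \in monics F (n - k).
  case/allpairsPdep => a [b [ain bin [-> ->]]]; split=> //.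
  by move: ain; rewrite mem_iota.
have ex (z : nat * {poly F}) : exists c : nat, z.2 \is monic ->
   has_card (norm_divisor z.2 z.1) c /\
   c%:Z = (\sum_(j < z.1.+1) eps P None ^+ j) * divisor_sum (legendre P) z.2.
  have [mz|_] := boolP (z.2 \is monic); last by exists 0%N.
  by have [c hc cE] := norm_divisor_count z.1 mz; exists c.
have [c hc] := choice ex.
exists (\sum_(z <- W) c z)%N.
  apply: has_card_ext (has_card_union (R := fun z E => z.2 \is monic /\ norm_divisor z.2 z.1 E) uW _ _).
  - move=> E; split=> [[[k f] zW [/= mf hE]]|[hE E0 dE]].
      have [kn /monicsP[_ f0 df]] := memW _ _ zW.
      have [dv dE] := norm_divisor_degree f0 hE; split=> //; first by case: hE.
      by rewrite dE df subnKC.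
    have [f [k [mf hf]]] := effective_norm hE E0.
    have [_] := norm_divisor_degree (monic_neq0 mf) hf; rewrite dE => -[nE].
    exists (k, f) => //; apply/allpairsPdep; exists k, f; split=> //.
      by rewrite mem_iota /= add0n nE ltnS leq_addr.
    by rewrite nE addKn; exact: monic_in_monics.
  - move=> [k f] zW; have [_ /monicsP[mf _ _]] := memW _ _ zW.
    by have [h _] := hc (k, f) mf; apply: has_card_ext h => E; split=> [?|[]].
  by move=> [k f] [l g] E [/= mf hf] [/= mg hg]; have [-> ->] := norm_divisor_inj mf mg hf hg.
rewrite (big_morph Posz PoszD erefl) big_allpairs_dep.
rewrite -[iota 0 n.+1]/(index_iota 0 n.+1) big_mkord; apply: eq_bigr => k _.
rewrite -sum_divisor_sum mulr_sumr big_seq [RHS]big_seq.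
by apply: eq_bigr => f /monicsP[mf _ _]; have [_ ->] := hc (nat_of_ord k, f) mf.
Qed.

(** * Counting effective divisors by classes *)

(** Integrality everywhere makes both coordinates polynomials. At oo the first is constant, and the
    second vanishes because its product with T^h, h > 0, is constant. *)
Lemma trivial_divisor_const x : x != 0 -> (forall v, v x = 0) ->
  exists2 c : F, c != 0 & x = const L c.
Proof.
move=> x0 vx; have vge0 v : vge v x 0 by rewrite vgeE // vx.
have hi i : kidx i -> kintegral P c1 c2 i x.
  by move=> ki; have [_ _ _ h _] := aboveP ki; apply/h.
have [f fE] : exists f, c1 x = f%:F.
  by apply: fraction_integral => Q mQ; have /andP[] := hi (Some Q) mQ.
have [g gE] : exists g, c2 x = g%:F.
  by apply: fraction_integral => Q mQ; have /andP[] := hi (Some Q) mQ.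
have dg : (0 < d)%N by case: P_irr; rewrite /pdeg; case: size => [|[]].
have /andP[] := hi None isT; rewrite fE gE -(tofracXn h) -tofracM.
have poly0 (r : {poly F}) : vge (@vinf F) r%:F 0 -> (size r <= 1)%N.
  have [->|r0] := eqVneq r 0; first by rewrite size_poly0.
  rewrite vgeE ?tofrac_eq0 // vinf_poly // /pdeg; move: (size r) => a; clear; lia.
move=> /poly0 sf /poly0; have [g0|g0] := eqVneq g 0; last first.
  rewrite size_mul ?expf_neq0 ?polyX_eq0 // size_polyXn.
  move: g0 dg; rewrite -size_poly_gt0; move: (size g) (pdeg P) => a b; clear; lia.
move=> _; move: sf => /size1_polyC fC; exists f`_0; last first.
  by rewrite {1}(coordE x) fE gE g0 fC coefC eqxx tofrac0 scale0r addr0.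
apply: contraNneq x0 => f0.
by rewrite (coordE x) fE gE g0 fC f0 polyC0 tofrac0 !scale0r addr0.
Qed.

Lemma const_neq0 (c : F) : c != 0 -> const L c != 0.
Proof. by move=> c0; rewrite /const algA_eq0 tofrac_eq0 polyC_eq0. Qed.

Lemma const_inj : injective (const L).
Proof.
move=> a b /eqP; rewrite -subr_eq0 -scalerBl -tofracB -polyCB => /eqP e.
by apply/eqP; rewrite -subr_eq0; apply/negPn/negP => /const_neq0; rewrite /const e eqxx.
Qed.

(** Elements with the same divisor differ by a nonzero constant. *)
Lemma same_divisor_card y : y != 0 ->
  has_card (fun x => x != 0 /\ forall v, v x = v y) q.-1.
Proof.
move=> y0; apply: (@has_card_image F L (fun c => c != 0) _ (fun c => const L c * y)).
- by move=> a b _ _ /(mulIf y0)/const_inj.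
- move=> x; split=> [[x0 xy]|[c c0 ->]].
    have [||c c0 cE] := @trivial_divisor_const (x / y).
    + exact: mulf_neq0 x0 (invr_neq0 y0).
    + by move=> v; rewrite (val_div (pval_valuation v)) // xy subrr.
    by exists c => //; rewrite -cE mulfVK.
  have k0 := const_neq0 c0; split; first exact: mulf_neq0 k0 y0.
  by move=> v; rewrite (valM (pval_valuation v)) // pval_const // add0r.
exists (enum [pred c : F | c != 0]); split; first exact: enum_uniq.
  by move=> c; rewrite mem_enum.
by rewrite -cardE -(cardC1 0); apply: eq_card => c.
Qed.

Variable v0 : place L.
Hypothesis dv0 : place_degree v0 = 1%N.
Local Notation N n := (fun v => if v == v0 then n%:Z else 0).

(* x |-> A + (x) maps the nonzero x of RR A onto the effective divisors in the class
   of A, with fibres the orbits of F^*. *)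
Lemma effective_fibre n (S : seq (place L -> int)) A : uniq S ->
  (forall E, E \in S <-> effective_of_degree n E) ->
  is_divisor A -> divisor_degree A = n%:Z ->
  exists l, [/\ (q.-1 * count (fun E => `[< linearly_equivalent E A >]) S + 1)%N = (q ^ l)%N
    & n%:Z + 2 - h%:Z <= l%:Z].
Proof.
move=> uS hS hA dA; have [l [[R [uR hR sR]] le]] := RR_card hA.
exists l; split; last by rewrite -dA.
pose R' := [seq x <- R | x != 0].
have memR' x : x \in R' <-> RR A x /\ x != 0.
  by rewrite mem_filter; split=> [/andP[? /hR]|[? ?]] //; apply/andP; split=> //; apply/hR.
have RRE x : x != 0 -> RR A x <-> forall v, 0 <= A v + v x.
  by move=> x0; split=> h v; have := h v; rewrite vgeE // -lerBlDl sub0r.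
pose S' := [seq E <- S | `[< linearly_equivalent E A >]].
have sR' : size R' = (q ^ l).-1.
  rewrite -sR size_filter (eq_count (a2 := predC (pred1 0))) // -(count_predC (pred1 0) R).
  rewrite (_ : count (pred1 0) R = 1%N) //.
  by rewrite count_uniq_mem // (_ : 0 \in R) //; apply/hR/RR0.
have uS' : uniq S' by exact: filter_uniq.
have memS' E : E \in S' <-> effective_of_degree n E /\ linearly_equivalent E A.
  rewrite mem_filter; split=> [/andP[/asboolP ? /hS]//|[hE le']].
  by apply/andP; split; [exact/asboolP|exact/hS].
suff E : (q ^ l).-1 = (size S' * q.-1)%N.
  by rewrite -size_filter mulnC -E addn1 prednK // expn_gt0 ltnW // card_finNzRing_gt1.
rewrite -sR'; apply: (@size_fibres_eq _ _ R' S' (fun x v => A v + v x) q.-1 uS').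
- move=> x /memR'[rx x0]; apply/memS'; split.
    have [hx dx] := principal_divisor x0.
    have [h1 h2] := divisorD hA hx; split=> //; first by move=> v; exact: (RRE x x0).1.
    by rewrite h2 dA dx addr0.
  by exists x => // v; rewrite addrAC subrr add0r.
move=> E /memS'[[hE E0 dE] [y y0 yE]].
apply: (has_card_uniq _ (same_divisor_card y0)).
exists [seq x <- R' | (fun v => A v + v x) == E]; split; last by rewrite size_filter.
  by rewrite !filter_uniq.
move=> x; rewrite mem_filter; split=> [/andP[/eqP e /memR'[_ x0]]|[x0 xy]].
  by split=> // v; rewrite -yE -e addrAC subrr add0r.
apply/andP; split; first by apply/eqP/funext => v; rewrite xy -yE addrC subrK.
by apply/memR'; split=> //; apply/(RRE x x0) => v; rewrite xy -yE addrC subrK.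
Qed.

(** Subtracting n v0 matches the classes of degree n with those of degree 0. Each contributes (q -
    1) times its number of effective divisors plus 1, a power of q with exponent at least n + 2 -
    h. *)
Theorem effective_class_number n A : (h <= n)%N -> has_card (effective_of_degree n) A ->
  (q ^ (n + 2 - h) %| q.-1 * A + divisor_class_number L)%N.
Proof.
move=> un [S [uS hS <-]].
have [hN dN] := divisor_scaled_place v0 n%:Z; rewrite dv0 mulr1 in dN.
pose cls E := divisor_class (fun v => E v - N n v).
have fibre B : is_divisor B -> divisor_degree B = n%:Z ->
    exists2 l, (q.-1 * count (fun E => cls E == cls B) S + 1)%N = (q ^ l)%N & (n + 2 - h <= l)%N.
  move=> hB dB; have [l [lE le]] := effective_fibre uS hS hB dB.
  exists l; last by move: le un; move: (uphalf _) => a; clear; lia.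
  rewrite -lE; congr (_ * _ + _)%N; apply: eq_in_count => E /hS[hE _ _].
  have [hEN _] := divisorB hE hN.
  apply/eqP/asboolP => [/(eq_divisor_class _ hEN)|] h; last apply/(eq_divisor_class _ hEN).
    by case: h => x x0 h; exists x => // v; rewrite -h opprB addrA subrK.
  by case: h => x x0 h; exists x => // v; rewrite -h opprB addrA subrK.
pose T := undup [seq cls E | E <- S].
have uT : uniq T := undup_uniq _.
have hT : has_card (@divisor_classes0 F L) (size T).
  exists T; split=> // c; rewrite mem_undup; split=> [/mapP[E /hS[hE _ dE] ->]|[B [hB dB] <-]].
    have [h1 h2] := divisorB hE hN.
    by exists (fun v => E v - N n v) => //; split; rewrite // h2 dE dN subrr.
  have [h1 h2] := divisorD hB hN; rewrite dB dN add0r in h2.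
  have [l lE nl] := fibre _ h1 h2.
  have clsE : cls (fun v => B v + N n v) = divisor_class B.
    by congr divisor_class; apply/funext => v; rewrite addrK.
  rewrite -clsE; apply/mapP.
  suff /hasP[E ES /eqP e] : has (fun E => cls E == cls (fun v => B v + N n v)) S by exists E.
  (* For a class without effective divisors [fibre] would say 1 = q^l with l > 0. So the images of
     effective divisors exhaust the classes. *)
  rewrite has_count lt0n; apply/eqP => c0; move: lE; rewrite c0 muln0 add0n => lE.
  have : (q ^ 0 < q ^ l)%N.
    by rewrite ltn_exp2l ?card_finNzRing_gt1 //; move: nl un; move: (uphalf _) => a; clear; lia.
  by rewrite -lE.
rewrite (class_number_card hT).
have SE := @size_sum_fibres _ _ S T cls uT (fun E ES => etrans (mem_undup _ _) (map_f cls ES)).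
(* Writing the class number as a sum of ones gives every class its own summand 1. *)
rewrite SE -(sum1_size T) big_distrr /= -big_split big_seq /=.
apply: (big_ind (fun m => q ^ (n + 2 - h) %| m)%N) => [|m m'|c]; [exact: dvdn0|exact: dvdn_add|].
rewrite mem_undup => /mapP[E /hS[hE _ dE] ->].
by have [l -> le] := fibre E hE dE; exact: dvdn_exp2l.
Qed.

End QuadraticExtension.

(** * The class number *)

Section EffectiveSum.
Variables (Q : int) (d : nat) (S : nat -> int).
Hypothesis S_big : forall j, (d <= j)%N -> S j = 0.

(** Both sides run over the triangle k + j <= n; the vanishing of S truncates it to j < d. *)
Lemma triangular_exchange (C : nat -> int) n : (d <= n)%N ->
  \sum_(k < n.+1) C k * \sum_(j < (n - k).+1) S j * Q ^+ (n - k - j) =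
  \sum_(j < d) S j * \sum_(k < (n - j).+1) C k * Q ^+ (n - j - k).
Proof.
move=> dn; pose T k j : int := C k * (S j * Q ^+ (n - k - j)).
transitivity (\sum_(k < n.+1) \sum_(j < n.+1 | (k + j <= n)%N) T k j).
  apply: eq_bigr => k _; rewrite mulr_sumr.
  rewrite (big_ord_widen n.+1 (T k)); last by rewrite ltnS leq_subr.
  by apply: eq_bigl => j; move: (ltn_ord k); clear; lia.
rewrite (exchange_big_dep predT) //=.
transitivity (\sum_(j < n.+1 | (j < d)%N) \sum_(k < n.+1 | (k + j <= n)%N) T k j).
  rewrite [RHS]big_mkcond; apply: eq_bigr => j _; case: ltnP => // dj.
  by rewrite big1 // => k _; rewrite /T S_big // mul0r mulr0.
rewrite -(big_ord_widen n.+1 (fun j => \sum_(k < n.+1 | (k + j <= n)%N) T k j)); last exact: leqW.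
apply: eq_bigr => j _; rewrite mulr_sumr.
rewrite [RHS](big_ord_widen n.+1 (fun k => S j * (C k * Q ^+ (n - j - k)))); last by rewrite ltnS leq_subr.
apply: eq_big => [k|k _]; first by move: (ltn_ord k) (ltn_ord j) dn; clear; lia.
by rewrite /T mulrCA (subnAC n k j).
Qed.

Lemma geometric_tail t : (Q - 1) * \sum_(k < t.+1) Q ^+ (t - k) = Q ^+ t.+1 - 1.
Proof.
rewrite subrX1; congr (_ * _); rewrite (reindex_inj rev_ord_inj) /=.
by apply: eq_bigr => k _; rewrite subSS subKn // -ltnS.
Qed.

Lemma arithmetic_geometric_tail t :
  (Q - 1) ^+ 2 * \sum_(k < t.+1) k.+1%:Z * Q ^+ (t - k) =
  Q ^+ t.+2 - (Q - 1) * t.+2%:Z - 1.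
Proof.
elim: t => [|t IH]; first by rewrite big_ord1 /= subnn; ring.
rewrite big_ord_recr /= subnn.
have -> : \sum_(k < t.+1) k.+1%:Z * Q ^+ (t.+1 - k) = Q * \sum_(k < t.+1) k.+1%:Z * Q ^+ (t - k).
  rewrite mulr_sumr; apply: eq_bigr => k _; rewrite subSn; last by rewrite -ltnS.
  by rewrite exprS mulrCA.
rewrite mulrDr mulrCA IH expr0 !exprS mulr1; move: (Q ^+ t) => X.
  have -> : t.+2%:Z = t%:Z + 2 by lia.
  have -> : t.+3%:Z = t%:Z + 3 by lia.
ring.
Qed.

End EffectiveSum.

Section SpecialValue.
Variables (F : finFieldType) (P G : {poly F}).
Hypothesis q_odd : odd #|F|.
Hypotheses (P_monic : P \is monic) (P_irr : irreducible_poly P).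
Hypothesis G_prim : primitive_root P G.
Local Notation q := #|F|.
Local Notation d := (pdeg P).
Local Notation Q := (q%:Z).

(* For L(u) the sum of the S_j u^j, this is the value at u = 1 of L(u) for odd d, and of
   L(u) / (1 - u) for even d, where L(1) = 0. *)
Definition lvalue : int :=
  if odd d then \sum_(j < d) legendre_sum P j
  else - \sum_(j < d) j%:Z * legendre_sum P j.

(** The factor at oo has coefficients C_k = 1 for odd d and k + 1 for even d. Summing the resulting
    progression leaves high powers of q plus terms that assemble to [lvalue]; in the even case its
    denominator is (q - 1)^2, hence the extra factor. *)
Lemma effective_count_mod n (A : int) : (d <= n)%N ->
  A = \sum_(k < n.+1) (\sum_(j < k.+1) eps P None ^+ j) *
        \sum_(j < (n - k).+1) legendre_sum P j * (q ^ (n - k - j))%N%:Z ->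
  (Q ^+ (n - d) %| (Q - 1) * ((Q - 1) * A + lvalue))%Z.
Proof.
move=> dn AE; pose C k : int := \sum_(j < k.+1) eps P None ^+ j.
have {}AE : A = \sum_(j < d) legendre_sum P j * \sum_(k < (n - j).+1) C k * Q ^+ (n - j - k).
  rewrite AE -(@triangular_exchange _ _ _ (fun j => @legendre_sum_big F P P_monic P_irr q_odd G G_prim j) _ _ dn).
  apply: eq_bigr => k _; congr (_ * _); apply: eq_bigr => j _; congr (_ * _).
  by rewrite -natz natrX natz.
have div m : (n - d <= m)%N -> (Q ^+ (n - d) %| Q ^+ m)%Z.
  by move=> /subnKC <-; rewrite exprD dvdz_mulr.
have divS m (f : nat -> nat) : (forall j, (j < d)%N -> (n - d <= f j)%N) ->
    (Q ^+ (n - d) %| \sum_(j < d) m j * Q ^+ f j)%Z.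
  by move=> h; apply: rpred_sum => j _; rewrite dvdz_mull // div // h.
rewrite /lvalue /eps in AE *; case: ifP => od.
  have Ck k : C k = 1.
    by rewrite /C /eps od big_ord_recl big1 ?addr0 // => j _; rewrite expr0n.
  suff -> : (Q - 1) * A + \sum_(j < d) legendre_sum P j = \sum_(j < d) legendre_sum P j * Q ^+ (n - j).+1.
    by rewrite dvdz_mull //; apply: (divS _ (fun j => (n - j).+1)) => j jd; lia.
  rewrite AE mulr_sumr -big_split; apply: eq_bigr => j _ /=.
  rewrite mulrCA; under eq_bigr => k _ do rewrite Ck mul1r.
  by rewrite geometric_tail mulrBr mulr1 subrK.
have Ck k : C k = k.+1%:Z.
  by rewrite /C /eps od; under eq_bigr => j _ do rewrite expr1n; rewrite sumr_const card_ord -natz.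
suff -> : (Q - 1) * ((Q - 1) * A - \sum_(j < d) j%:Z * legendre_sum P j) =
    \sum_(j < d) legendre_sum P j * Q ^+ (n - j).+2.
  by apply: (divS _ (fun j => (n - j).+2)) => j jd; lia.
have tot := legendre_sum_total P_monic P_irr q_odd G_prim (negbT od).
rewrite mulrBr mulrA -expr2 AE.
(* The part of the progression formula that is the same for all j contributes a multiple of the
   total of the S_j, which is 0. *)
have E : \sum_(j < d) legendre_sum P j * ((Q - 1) * (n.+2%:Z) + 1) = 0 by rewrite -mulr_suml tot mul0r.
rewrite -[LHS]addr0 -[X in _ + X]E !mulr_sumr -sumrB -big_split; apply: eq_bigr => j _ /=.
rewrite mulrCA; under eq_bigr => k _ do rewrite Ck.
rewrite arithmetic_geometric_tail.
have -> : (n - j).+2%:Z = n.+2%:Z - j%:Z by move: (ltn_ord j) dn; clear; lia.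
ring.
Qed.

End SpecialValue.

Section ClassNumberFormula.
Variables (F : finFieldType) (P G : {poly F}) (L : fieldExtType {fraction {poly F}}) (s : L).
Local Notation d := (pdeg P).
Local Notation q := #|F|.
Hypothesis q_odd : odd q.
Hypotheses (P_monic : P \is monic) (P_irr : irreducible_poly P).
Hypothesis G_prim : primitive_root P G.
Hypothesis s_sqr : s ^+ 2 = (((-1) ^+ d * P)%:F)%:A.
Hypothesis L_gen : <<1%VS; s>>%VS = {:L}%VS.

Theorem class_number_lvalue : (divisor_class_number L)%:Z = lvalue P.
Proof.
have [c1 [c2 coordE]] := coord_exists s_sqr L_gen.
have [above aboveP] := lies_above_exists q_odd P_monic P_irr s_sqr coordE.
(* The symbol at oo is 0 or 1, never -1, so a place above oo has degree 1. *)
have [v0 dv0] : exists v0 : place L, place_degree v0 = 1%N.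
  have [_ _ _ _] := aboveP None isT; rewrite /eps /=.
  case=> [[_ [p1 [p2 [_ d1 _]]]]|[_ [p1 [_ d1]]]|[]]; [by exists p1|by exists p1|].
  by case: (odd d).
have q1 : (1 < q)%N := card_finNzRing_gt1 F.
have div N : (q%:Z ^+ N %| (q%:Z - 1) * (lvalue P - (divisor_class_number L)%:Z))%Z.
  (* Large enough for q^N to divide both moduli q^(n - d) and q^(n + 2 - [uphalf d]). *)
  pose n := (N + d + uphalf d)%N.
  have [A hA AE] := effective_count q_odd P_monic P_irr s_sqr coordE aboveP n.
  have dn : (d <= n)%N by rewrite /n; move: (uphalf _) => a; clear; lia.
  have un : (uphalf d <= n)%N by rewrite /n; exact: leq_addl.
  have := effective_count_mod q_odd P_monic P_irr G_prim dn AE.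
  have := effective_class_number q_odd P_monic P_irr s_sqr coordE aboveP dv0 un hA.
  set h := divisor_class_number L => h1 h2.
  have {}h1 : (q%:Z ^+ N %| (q%:Z - 1) * A%:Z + h%:Z)%Z.
    have -> : (q%:Z - 1) * A%:Z + h%:Z = (q.-1 * A + h)%N%:Z.
      by rewrite PoszD PoszM -subn1 subzn // ltnW.
    rewrite dvdzE abszX; apply: dvdn_trans h1; apply: dvdn_exp2l.
    by rewrite /n; move: (uphalf _) => a; clear; lia.
  have {}h2 : (q%:Z ^+ N %| (q%:Z - 1) * ((q%:Z - 1) * A%:Z + lvalue P))%Z.
    by apply: dvdz_trans h2; rewrite dvdz_exp2l // /n; move: (uphalf _) => a; clear; lia.
  have -> : (q%:Z - 1) * (lvalue P - h%:Z) = (q%:Z - 1) * ((q%:Z - 1) * A%:Z + lvalue P) -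
    (q%:Z - 1) * ((q%:Z - 1) * A%:Z + h%:Z) by ring.
  by rewrite rpredB // dvdz_mull.
pose z := (q%:Z - 1) * (lvalue P - (divisor_class_number L)%:Z).
have : z = 0.
  apply/eqP; rewrite -absz_eq0 -leqn0 leqNgt; apply/negP => z0.
  (* The modulus q^|z| exceeds |z|, so it cannot divide a nonzero z. *)
  have := div `|z|%N; rewrite -/z dvdzE abszX => /(dvdn_leq z0).
  by rewrite leqNgt /= ltn_expl.
by move/eqP; rewrite mulf_eq0 subr_eq0 eqz_nat gtn_eqF //= subr_eq0 => /eqP.
Qed.

End ClassNumberFormula.

(** * Digits *)

Lemma expf_sub (R : fieldType) (x : R) k n : x != 0 -> (k <= n)%N ->
  x ^+ n / x ^+ k = x ^+ (n - k).
Proof. by move=> x0 kn; rewrite expfB_cond // (negbTE x0). Qed.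

Section DigitRemainder.
Variables (F : finFieldType) (P G : {poly F}) (H : nat -> {poly F}).
Local Notation K := {fraction {poly F}}.
Local Notation d := (pdeg P).
Local Notation g := (pdeg G).
Local Notation R k := (G ^+ k %% P).
Hypotheses (P0 : P != 0) (d_gt0 : (0 < d)%N) (deg_G : (d <= g)%N).
Hypothesis H_exp : digit_expansion G (P%:F)^-1 H.

Let G0 : G != 0.
Proof.
by apply: contraTneq (leq_trans d_gt0 deg_G) => ->; rewrite /pdeg size_poly0.
Qed.

(* The terms k > n have valuation > n deg G since deg H_k < deg G. *)
Lemma digit_rest n :
  vge (@vinf F) ((P%:F)^-1 - \sum_(0 <= k < n.+1) (H k)%:F / G%:F ^+ k) (n%:Z * g%:Z + 1).
Proof.
have vv := @vinf_valuation F; have [dig lim] := H_exp.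
have GF0 : G%:F != 0 :> K by rewrite tofrac_eq0.
have [n0 hn0] := lim (n%:Z * g%:Z + 1).
pose N := maxn n0 n; have := hn0 N (leq_maxl _ _).
set rN := _ - _ => hN; have {}hN : vge (@vinf F) rN (n%:Z * g%:Z + 1).
  by case: hN => [->|h]; [exact: vge_zero|rewrite /vge h orbT].
have -> : (P%:F)^-1 - \sum_(0 <= k < n.+1) (H k)%:F / G%:F ^+ k =
    rN + \sum_(n.+1 <= k < N.+1) (H k)%:F / G%:F ^+ k.
  by rewrite /rN (@big_cat_nat _ _ _ n.+1 0 N.+1) //= ?ltnS ?leq_maxr // opprD addrA subrK.
apply: (vgeD vv) hN _; rewrite big_seq; apply: (vge_sum vv) => k.
rewrite mem_index_iota => /andP[nk _].
have [->|Hk0] := eqVneq (H k) 0; first by rewrite tofrac0 mul0r vge_zero.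
have Gk0 := expf_neq0 k GF0; have HF0 : (H k)%:F != 0 :> K by rewrite tofrac_eq0.
rewrite (vgeE _ _ (mulf_neq0 HF0 (invr_neq0 Gk0))) (val_divX vv k GF0 HF0) !vinf_poly //.
have := dig k (leq_ltn_trans (leq0n _) nk); case=> [/eqP|]; first by rewrite (negbTE Hk0).
by move: (pdeg G) (pdeg (H k)) nk => a b; clear; nia.
Qed.

(** The left side is P G^n times the remainder of the expansion, so [digit_rest] bounds its degree
    by d - 1; as it is congruent to G^n modulo P, it is the residue. *)
Lemma digit_sum_mod n : G ^+ n - P * \sum_(0 <= k < n.+1) H k * G ^+ (n - k) = R n.
Proof.
have vv := @vinf_valuation F; have GF0 : G%:F != 0 :> K by rewrite tofrac_eq0.
have PF0 : P%:F != 0 :> K by rewrite tofrac_eq0.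
set f := LHS; have fE : f%:F = P%:F * G%:F ^+ n *
    ((P%:F)^-1 - \sum_(0 <= k < n.+1) (H k)%:F / G%:F ^+ k).
  rewrite /f tofracB tofracM tofracXn mulrBr mulrAC divff // mul1r -mulrA; congr (_ - _ * _).
  rewrite rmorph_sum mulr_sumr big_nat [RHS]big_nat; apply: eq_bigr => k /=.
  rewrite ltnS => kn; rewrite rmorphM /= tofracXn mulrCA; congr (_ * _).
  exact/esym/(expf_sub GF0 kn).
have sf : (size f < size P)%N.
  have [->|f0] := eqVneq f 0; first by rewrite size_poly0 size_poly_gt0.
  have Gn0 := expf_neq0 n GF0.
  have := vgeM vv (vge_val _ (P%:F * G%:F ^+ n)) (digit_rest n).
  rewrite -fE (valM vv PF0 Gn0) (valX vv n GF0) vgeE ?tofrac_eq0 // !vinf_poly //.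
  move: d_gt0 f0; rewrite -size_poly_gt0 [pdeg f]/pdeg [pdeg P]/pdeg.
  by move: (size f) (size P) (pdeg G) => a b c; clear; nia.
have -> : G ^+ n = f + P * \sum_(0 <= k < n.+1) H k * G ^+ (n - k) by rewrite subrK.
by rewrite modpD modp_mulr addr0 modp_small.
Qed.

Lemma digit_recursion k : P * H k.+1 = G * R k - R k.+1.
Proof.
rewrite -!digit_sum_mod [in X in _ = _ - X]big_nat_recr //= subnn expr0 mulr1.
have -> : \sum_(0 <= i < k.+1) H i * G ^+ (k.+1 - i) = G * \sum_(0 <= i < k.+1) H i * G ^+ (k - i).
  rewrite mulr_sumr big_nat [RHS]big_nat; apply: eq_bigr => i /= ik.
  by rewrite mulrCA -exprS subSn.
by rewrite exprS; ring.
Qed.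

(** In the recursion the term R_(k+1) has degree < d <= deg G, too small to affect the top of G
    R_k. *)
Lemma digit_lead k : R k != 0 ->
  lead_coef (P * H k.+1) = lead_coef (G * R k) /\ size (P * H k.+1) = size (G * R k).
Proof.
move=> Rk0; rewrite digit_recursion.
have lt : (size (- R k.+1) < size (G * R k)%R)%N.
  rewrite size_polyN size_mul //; apply: leq_trans (ltn_modpN0 _ P0) _.
  move: deg_G Rk0 G0; rewrite -!size_poly_gt0 /pdeg.
  by move: (size _) (size P) (size G) => a b c; clear; lia.
by rewrite lead_coefDl // size_polyDl.
Qed.

End DigitRemainder.

Section ClassNumberDigits.
Variables (F : finFieldType) (P G : {poly F}) (H : nat -> {poly F}).
Local Notation d := (pdeg P).
Local Notation R k := (G ^+ k %% P).
Local Notation rep := (\sum_(i < d) #|F| ^ i)%N.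
Hypothesis q_odd : odd #|F|.
Hypotheses (P_monic : P \is monic) (P_irr : irreducible_poly P).
Hypothesis G_prim : primitive_root P G.
Hypothesis deg_G : (d <= pdeg G)%N.
Hypothesis H_exp : digit_expansion G (P%:F)^-1 H.

Let P0 : P != 0 := monic_neq0 P_monic.
Let d_gt0 : (0 < d)%N. Proof. by case: P_irr; rewrite /pdeg; case: size => [|[]]. Qed.
Let G0 : G != 0.
Proof. by apply: contraTneq (leq_trans d_gt0 deg_G) => ->; rewrite /pdeg size_poly0. Qed.
Let R0 k : R k != 0 := primitive_modp_neq0 P_monic P_irr G_prim k.

Lemma digit_pdeg k : (pdeg (H k.+1))%:Z = (pdeg (R k))%:Z + (pdeg G)%:Z - d%:Z.
Proof.
have [_] := digit_lead P0 d_gt0 deg_G H_exp (R0 k).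
have [H0|H0] := eqVneq (H k.+1) 0.
  move=> /esym/eqP; rewrite H0 mulr0 size_poly0 size_poly_eq0.
  by rewrite mulf_eq0 (negbTE G0) (negbTE (R0 k)).
rewrite !size_mul // /pdeg; move: (R0 k) G0 P0 H0; rewrite -!size_poly_gt0.
by move: (size _) (size _) (size P) (size G) => a b c e; clear; lia.
Qed.

Lemma digit_lead_sign k : lead_sign (H k.+1) = lead_sign G * lead_sign (R k).
Proof.
have [lE _] := digit_lead P0 d_gt0 deg_G H_exp (R0 k).
rewrite -(lead_signM q_odd G0 (R0 k)) /lead_sign -lE lead_coefM.
by move: P_monic; rewrite monicE => /eqP ->; rewrite mul1r.
Qed.

Lemma lead_sign_sqr (f : {poly F}) : lead_sign f * lead_sign f = 1.
Proof. by rewrite /lead_sign; case: ifP; rewrite ?mulr1 // mulrNN mulr1. Qed.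

(** The digit H_(k+1) belongs to R_k, and this shift of index produces the minus sign. For odd d the
    factor [lead_sign G] appears once outside and once in every digit, and squares to 1. *)
Lemma digit_sum_lvalue : lvalue P =
  if odd d then - lead_sign G * \sum_(1 <= k < rep.+1) (-1) ^+ k * lead_sign (H k)
  else \sum_(1 <= k < rep.+1) (-1) ^+ k * (pdeg (H k))%:Z.
Proof.
have sumE (w : {poly F} -> int) := sum_monics_powers P_monic P_irr q_odd G_prim w.
have legE k : legendre P (monic_part (R k)) = (if odd d then lead_sign (R k) else 1) * (-1) ^+ k.
  by rewrite (lead_legendre P_monic P_irr q_odd) ?R0 // (legendre_R P_monic P_irr q_odd G_prim).
rewrite /lvalue; case: ifP => od; rewrite big_add1 /= big_mkord.
  rewrite mulr_sumr sumE; apply: eq_bigr => k _.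
  by rewrite legE od digit_lead_sign exprS -[LHS]mul1r -[X in X * _ = _](lead_sign_sqr G); ring.
have -> : \sum_(j < d) j%:Z * legendre_sum P j =
    \sum_(j < d) \sum_(f <- monics F j) (pdeg f)%:Z * legendre P f.
  apply: eq_bigr => j _; rewrite mulr_sumr big_seq [RHS]big_seq.
  by apply: eq_bigr => f /monicsP[_ _ ->].
(* The degrees of H_(k+1) and R_k differ by the constant deg G - d, whose contribution is a multiple
   of the total of the S_j. *)
have tot : \sum_(k < rep) legendre P (monic_part (R k)) * ((pdeg G)%:Z - d%:Z) = 0.
  by rewrite -mulr_suml -sumE (legendre_sum_total P_monic P_irr q_odd G_prim (negbT od)) mul0r.
rewrite sumE -[LHS]subr0 -[X in _ - X]tot -sumrN -sumrB.
apply: eq_bigr => k _; rewrite legE od mul1r digit_pdeg exprS.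
have -> : pdeg (monic_part (R k)) = pdeg (R k) by rewrite /pdeg size_monic_part.
ring.
Qed.

End ClassNumberDigits.

Unset Implicit Arguments.
Set Strict Implicit.
Set Printing Implicit Defensive.

Theorem theorem1p2 (q p m : nat) (F : finFieldType) (d : nat) (P G : {poly F})
    (L : fieldExtType {fraction {poly F}}) (s : L) (H : nat -> {poly F})
    (p_prime : prime p) (p_odd : odd p) (m_gt0 : (0 < m)%N)
    (q_def : q = (p ^ m)%N) (card_F : #|F| = q)
    (P_monic : P \is monic) (P_irr : irreducible_poly P) (deg_P : pdeg P = d)
    (G_prim : primitive_root P G) (deg_G : (pdeg P <= pdeg G)%N)
    (s_sqr : s ^+ 2 = (((-1) ^+ d * P)%:F)%:A)
    (L_gen : <<1%VS; s>>%VS = {:L}%VS)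
    (H_exp : digit_expansion G (P%:F)^-1 H) :
  let r := ((q ^ d - 1) %/ (q - 1))%N in
  (divisor_class_number L)%:Z =
    if odd d then
      - lead_sign G * \sum_(1 <= k < r.+1) (-1) ^+ k * lead_sign (H k)
    else
      \sum_(1 <= k < r.+1) (-1) ^+ k * (pdeg (H k))%:Z.
Proof.
subst d; have q_odd : odd #|F| by rewrite card_F q_def oddX p_odd orbT.
rewrite /= (class_number_lvalue q_odd P_monic P_irr G_prim s_sqr L_gen).
rewrite (digit_sum_lvalue q_odd P_monic P_irr G_prim deg_G H_exp).
have -> : ((q ^ pdeg P - 1) %/ (q - 1))%N = (\sum_(i < pdeg P) #|F| ^ i)%N.
  by rewrite -card_F !subn1 -rep_q mulKn // -ltnS prednK ?card_finNzRing_gt1 // ltnW // card_finNzRing_gt1.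
by [].
Qed.
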